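(* Let $\mathscr J$ be a Jacobi matrix with parameters $b_n>0$, $a_n\in\mathbb R$ satisfying, for $n\ge1$, $$b_n=n^{\beta_1}\Big(x_0+\frac{x_1}n+\chi_n\Big),\qquad a_n=n^{\beta_2}\Big(y_0+\frac{y_1}n+\mu_n\Big),$$ where $\beta_1,\beta_2,x_0,x_1,y_0,y_1$ are real, $x_0>0$, $y_0\ne0$, and $\sum_{n=1}^\infty\sqrt n\,(|\chi_n|+|\mu_n|)<\infty$. Assume that the simply critical case takes place, i.e. $\beta_1=\beta_2=:\beta$, $|y_0|=2x_0$ and $\beta\ne\sigma:=\frac{2x_1}{x_0}-\frac{2y_1}{y_0}$, and that $$\frac32<\beta<\min\{2,\sigma\}.$$ Then $\mathscr J$ is in limit circle case, and its Nevanlinna matrix $W$ satisfies $$\max_{|z|=r}\log\|W(z)\|\asymp r^{\frac1{2(\beta-1)}},\qquad r\text{ sufficiently large},$$ and its order is $\frac1{2(\beta-1)}$.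
   Context: **Jacobi matrix.** $\mathscr J$ is the tridiagonal matrix with diagonal $(a_n)_{n\ge0}$ and off-diagonal $(b_n)_{n\ge0}$, $a_n\in\mathbb R$, $b_n>0$. Its minimal operator is the closure in $\ell^2(\mathbb N_0)$ of $u\mapsto\mathscr Ju$ on finitely supported sequences. $\mathscr J$ is in limit circle case if the minimal operator is not self-adjoint (equivalently, for every $z\in\mathbb C$ all solutions of $b_nu_{n+1}+a_nu_n+b_{n-1}u_{n-1}=zu_n$, $n\ge1$, are in $\ell^2$; equivalently, the associated Hamburger moment problem is indeterminate), and in limit point case otherwise. **Nevanlinna matrix.** Let $p_n,q_n$ be the orthogonal polynomials of first and second kind: both solve $b_nu_{n+1}(z)+a_nu_n(z)+b_{n-1}u_{n-1}(z)=zu_n(z)$, $n\ge1$, with $p_0=1$, $p_1(z)=(z-a_0)/b_0$, $q_0=0$, $q_1=1/b_0$. In limit circle case the Nevanlinna matrix is the entire matrix function $W=\begin{pmatrix} A & C \\ B & D \end{pmatrix}$ with $A(z)=z\sum_k q_k(0)q_k(z)$, $B(z)=-1+z\sum_k q_k(0)p_k(z)$, $C(z)=1+z\sum_k p_k(0)q_k(z)$, $D(z)=z\sum_k p_k(0)p_k(z)$. Its order is $\limsup_{r\to\infty}\frac{\log\log\max_{|z|=r}\|W(z)\|}{\log r}$. **Comparison.** $f\asymp g$ for sufficiently large $r$ means that there are $c,C,r_0>0$ with $cg(r)\le f(r)\le Cg(r)$ for all $r\ge r_0$. *)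

(* Defs.v *)
From Stdlib Require Import Reals.
From Coquelicot Require Import Coquelicot.

Local Open Scope R_scope.

(** * Complex series and the Hilbert space l^2(N_0) *)

(* As with [Series], this is the sum only when the series converges. *)
Definition CSeries (u : nat -> C) : C :=
  (Series (fun n => Re (u n)), Series (fun n => Im (u n))).

Definition ell2 (u : nat -> C) : Prop := ex_series (fun n => Cmod (u n) ^ 2).

Definition ell2_norm (u : nat -> C) : R := sqrt (Series (fun n => Cmod (u n) ^ 2)).

Definition ell2_inner (u v : nat -> C) : C :=
  CSeries (fun n => (u n * Cconj (v n))%C).

(** * Unbounded operators *)

(* An operator on l^2 is given by its graph: [T u v] means that u is in the
   domain and T u = v. *)
Definition operator : Type := (nat -> C) -> (nat -> C) -> Prop.

Definition op_closure (T : operator) : operator := fun u v =>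
  ell2 u /\ ell2 v /\
  forall eps : posreal, exists u' v' : nat -> C,
    T u' v' /\
    ell2_norm (fun n => (u n - u' n)%C) < eps /\
    ell2_norm (fun n => (v n - v' n)%C) < eps.

Definition op_adjoint (T : operator) : operator := fun f g =>
  ell2 f /\ ell2 g /\
  forall u v : nat -> C, T u v -> ell2_inner v f = ell2_inner u g.

Definition self_adjoint (T : operator) : Prop :=
  forall u v : nat -> C, T u v <-> op_adjoint T u v.

(** * Jacobi matrices *)

(* [a] is the diagonal and [b] the off-diagonal. *)
Definition jacobi_apply (a b : nat -> R) (u : nat -> C) (n : nat) : C :=
  match n with
  | O => (b 0%nat * u 1%nat + a 0%nat * u 0%nat)%C
  | S k => (b n * u (S n) + a n * u n + b k * u k)%C
  end.

Definition finitely_supported (u : nat -> C) : Prop :=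
  exists N : nat, forall n : nat, (N <= n)%nat -> u n = 0%C.

Definition jacobi_finite (a b : nat -> R) : operator := fun u v =>
  finitely_supported u /\ forall n : nat, v n = jacobi_apply a b u n.

Definition jacobi_minimal (a b : nat -> R) : operator :=
  op_closure (jacobi_finite a b).

Definition limit_circle (a b : nat -> R) : Prop :=
  ~ self_adjoint (jacobi_minimal a b).

(** * Nevanlinna matrix *)

(* The solution of b_n u_{n+1} + a_n u_n + b_{n-1} u_{n-1} = z u_n (n >= 1)
   with initial values u0, u1. *)
Fixpoint jacobi_solution (a b : nat -> R) (z u0 u1 : C) (n : nat) : C :=
  match n with
  | O => u0
  | S m =>
    match m with
    | O => u1
    | S k =>
      (((z - a m) * jacobi_solution a b z u0 u1 m
        - b k * jacobi_solution a b z u0 u1 k) / b m)%C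
    end
  end.

Definition poly_p (a b : nat -> R) (n : nat) (z : C) : C :=
  jacobi_solution a b z 1%C ((z - a 0%nat) / b 0%nat)%C n.

Definition poly_q (a b : nat -> R) (n : nat) (z : C) : C :=
  jacobi_solution a b z 0%C (1 / b 0%nat)%C n.

Definition nev_A (a b : nat -> R) (z : C) : C :=
  (z * CSeries (fun k => poly_q a b k 0 * poly_q a b k z))%C.

Definition nev_B (a b : nat -> R) (z : C) : C :=
  (- (1) + z * CSeries (fun k => poly_q a b k 0 * poly_p a b k z))%C.

Definition nev_C (a b : nat -> R) (z : C) : C :=
  (1 + z * CSeries (fun k => poly_p a b k 0 * poly_q a b k z))%C.

Definition nev_D (a b : nat -> R) (z : C) : C :=
  (z * CSeries (fun k => poly_p a b k 0 * poly_p a b k z))%C.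

(* In the limit circle case p_k(z) and q_k(z) are square summable in k for every
   z, so all four series converge absolutely.  The first row is (A, C). *)
Definition nevanlinna (a b : nat -> R) (z : C) : @matrix C 2 2 :=
  mk_matrix 2 2 (fun i j =>
    match i, j with
    | O, O => nev_A a b z
    | O, S _ => nev_C a b z
    | S _, O => nev_B a b z
    | S _, S _ => nev_D a b z
    end).

(** * Growth *)

(* Frobenius norm.  Changing the norm changes log ||W|| by a bounded amount
   only, which affects neither the growth statement nor the order. *)
Definition mat_norm (M : @matrix C 2 2) : R :=
  sqrt (sum_n (fun i => sum_n (fun j => Cmod (coeff_mat (RtoC 0) M i j) ^ 2) 1) 1).

(* For f continuous on the circle |z| = r, r >= 0, the least upper bound is
   finite and attained, so this is the maximum of f there. *)
Definition circle_max (f : C -> R) (r : R) : R :=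
  real (Lub_Rbar (fun t => exists z : C, Cmod z = r /\ t = f z)).

Definition asymp_infty (f g : R -> R) : Prop :=
  exists c1 c2 r0 : R, 0 < c1 /\ 0 < c2 /\ 0 < r0 /\
    forall r : R, r0 <= r -> c1 * g r <= f r <= c2 * g r.

(* limsup of f at +oo; the analogue of [is_LimSup_seq] for real functions. *)
Definition is_LimSup_infty (f : R -> R) (l : Rbar) : Prop :=
  match l with
  | Finite l0 =>
    forall eps : posreal,
      (forall r0 : R, exists r : R, r0 <= r /\ l0 - eps < f r) /\
      (exists r0 : R, forall r : R, r0 <= r -> f r < l0 + eps)
  | p_infty => forall (m : R) (r0 : R), exists r : R, r0 <= r /\ m < f r
  | m_infty => forall m : R, exists r0 : R, forall r : R, r0 <= r -> f r < m
  end.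

Definition has_order (W : C -> @matrix C 2 2) (rho : Rbar) : Prop :=
  is_LimSup_infty
    (fun r => ln (ln (circle_max (fun z => mat_norm (W z)) r)) / ln r) rho.

(* Main.v *)
Require Import Defs.
From Stdlib Require Import Reals Lra Lia Psatz.
From Coquelicot Require Import Coquelicot.

Local Open Scope R_scope.

(** Write a solution of the recurrence through its increments: with
    w_n = b_{n-1} (u_n - u_{n-1}) the equation at spectral parameter z reads
    w_{n+1} - w_n = (z - Q_n) u_n, where Q_n is the sum of the n-th row of the
    matrix.  Replacing u_n by s^n u_n with s = 1 or -1 replaces (a, z) by
    (s a, s z), so one may assume y_0 = -2 x_0; then the leading terms of Q_n
    cancel and Q_n ~ x_0 (sigma - beta) n^(beta - 1), a positive potential.
    The recurrence is a discrete Sturm-Liouville equation with weight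
    x_0 n^beta, oscillating for n beyond the turning point
    N ~ |z|^(1/(beta - 1)) at which |z| and Q_n balance, and of exponential
    type before it.  The WKB exponent up to the turning point is
    sum_{n <= N} |z|^(1/2) n^(-beta/2) ~ N^(1/2) = |z|^(1/(2(beta - 1))), which is
    the claimed growth of log ||W||.

    At z = 0 there is no turning point: a quadratic form in (u_n, w_n), corrected
    by a cross term, is almost conserved ([solution_bound]), whence
    |u_n|^2 = O(n^(1/2 - beta)) for every solution.  Since beta > 3/2 all of them
    are square summable.  The two solutions p(0), q(0) then give elements
    (p(0), 0) and (q(0), e_0) of the adjoint graph which violate symmetry, so the
    minimal operator is not self-adjoint ([limit_circle_of_square_summable]).

    Expanding a solution at z in the basis p(0), q(0)
    ([variation_of_constants]) produces coefficients which are the truncations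
    of the series for B, D (solution p) and A, C (solution q).  The upper bound
    has two parts.  Up to N a weighted norm grows by at most
    exp(C N^(1/2)) ([bound_before_turning_point]).  Beyond N the coefficients
    move by a factor exp(C |z| sum_{n >= N} n^(1/2 - beta)), which is again
    exp(C N^(1/2)) because |z| ~ N^(beta - 1) ([coef_lim_upper]).

    For the lower bound take z = s i r.  The Wronskian of p(z) with its conjugate
    increases with n in absolute value, and its limit shows
    |B(z)| |D(z)| >= r sum_n |p_n(z)|^2 ([coef_wronskian]).  So it is enough that p(z) grows before the turning
    point, whatever happens beyond it.  There the flux
    Re(conj(u) w) + Im(conj(u) w) gains at each step an amount
    comparable to |w|^2/b_n + r |u|^2, hence a fraction (r/b_n)^(1/2) of itself
    ([square_sum_lower_bound]).  The irregular part of Q_n, which is controlled only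
    in sum, is absorbed by adding its partial sums times |u|^2 to the flux. *)

(** * Real powers of natural numbers *)

Lemma Rpower_pos (x a : R) : 0 < Rpower x a.
Proof. apply exp_pos. Qed.

Lemma Rpower_le_base (a x y : R) : 0 <= a -> 0 < x -> x <= y -> Rpower x a <= Rpower y a.
Proof. intros; apply Rle_Rpower_l; lra. Qed.

Lemma Rpower_le_base_neg (a x y : R) : a <= 0 -> 0 < x -> x <= y -> Rpower y a <= Rpower x a.
Proof.
  intros Ha Hx Hxy.
  replace a with (- - a) by ring.
  rewrite 2!(Rpower_Ropp _ (- a)).
  apply Rinv_le_contravar; [apply Rpower_pos|].
  apply Rpower_le_base; lra.
Qed.

Lemma Rpower_ge_1 (x a : R) : 1 <= x -> 0 <= a -> 1 <= Rpower x a.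
Proof. intros Hx Ha. rewrite <- (Rpower_O x) at 1 by lra. apply Rle_Rpower; assumption. Qed.

Lemma Rpower_le_1 (x a : R) : 1 <= x -> a <= 0 -> Rpower x a <= 1.
Proof.
  intros Hx Ha. apply Rle_trans with (Rpower x 0); [apply Rle_Rpower; assumption|].
  rewrite Rpower_O by lra. lra.
Qed.

Lemma Rpower_near (a : R) : exists K : R, 0 < K /\
  forall x y : R, 0 < x -> x <= y <= 2 * x -> Rpower y a <= K * Rpower x a.
Proof.
  destruct (Rle_dec 0 a) as [Ha|Ha].
  - exists (Rpower 2 a); split; [apply Rpower_pos|].
    intros x y Hx Hy. rewrite Rpower_mult_distr by lra.
    apply Rpower_le_base; lra.
  - exists 1; split; [lra|]. intros x y Hx Hy.
    rewrite Rmult_1_l. apply Rpower_le_base_neg; lra.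
Qed.

Lemma Rpower_MVT (p x y : R) : 0 < x -> x < y ->
  exists xi : R, x < xi < y /\ Rpower y p - Rpower x p = p * Rpower xi (p - 1) * (y - x).
Proof.
  intros Hx Hxy.
  destruct (MVT_cor2 (fun t => Rpower t p) (fun t => p * Rpower t (p - 1)) x y Hxy) as [xi [H1 H2]].
  - intros t Ht. apply derivable_pt_lim_power; lra.
  - exists xi. split; [lra|]. exact H1.
Qed.

Lemma Rpower_diff1 (p : R) : exists K : R, 0 < K /\
  forall x y : R, 1 <= x -> x <= y <= x + 1 ->
    Rabs (Rpower y p - Rpower x p) <= K * Rpower x (p - 1).
Proof.
  destruct (Rpower_near (p - 1)) as [K [HK H]].
  exists (Rabs p * K + 1). split.
  { pose proof (Rabs_pos p); nra. }
  intros x y Hx Hy.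
  pose proof (Rpower_pos x (p - 1)) as P0. pose proof (Rabs_pos p) as P1.
  destruct (Req_dec x y) as [<-|Hne].
  { rewrite Rminus_diag, Rabs_R0. apply Rmult_le_pos; [nra|lra]. }
  assert (Hlt : x < y) by (destruct Hy as [[Hy|Hy] _]; [exact Hy|contradiction]).
  destruct (Rpower_MVT p x y) as [xi [H1 ->]]; [lra|exact Hlt|].
  rewrite 2!Rabs_mult, (Rabs_right (y - x)) by lra.
  rewrite (Rabs_right (Rpower xi _)) by (apply Rgt_ge, Rpower_pos).
  assert (Rpower xi (p - 1) <= K * Rpower x (p - 1)) by (apply H; lra).
  pose proof (Rpower_pos xi (p - 1)).
  apply Rle_trans with (Rabs p * Rpower xi (p - 1)).
  { assert (0 <= Rabs p * Rpower xi (p - 1)) by nra. nra. }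
  nra.
Qed.

Lemma Rpower_diff2 (p : R) : exists K : R, 0 < K /\
  forall x : R, 1 <= x ->
    Rabs (Rpower (x + 1) p - Rpower x p - p * Rpower x (p - 1)) <= K * Rpower x (p - 2).
Proof.
  destruct (Rpower_diff1 (p - 1)) as [K [HK H]].
  exists (Rabs p * K + 1). split.
  { pose proof (Rabs_pos p); nra. }
  intros x Hx.
  destruct (Rpower_MVT p x (x + 1)) as [xi [H1 H2]]; [lra|lra|].
  rewrite H2. replace (x + 1 - x) with 1 by ring.
  replace (p * Rpower xi (p - 1) * 1 - p * Rpower x (p - 1))
    with (p * (Rpower xi (p - 1) - Rpower x (p - 1))) by ring.
  rewrite Rabs_mult.
  assert (H3 : Rabs (Rpower xi (p - 1) - Rpower x (p - 1)) <= K * Rpower x (p - 1 - 1))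
    by (apply H; lra).
  replace (p - 1 - 1) with (p - 2) in H3 by ring.
  pose proof (Rpower_pos x (p - 2)). pose proof (Rabs_pos p). nra.
Qed.

Lemma Rpower_pred_mult (x p : R) : 0 < x -> Rpower x (p - 1) * x = Rpower x p.
Proof.
  intros Hx. rewrite <- (Rpower_1 x) at 2 by assumption.
  rewrite <- Rpower_plus. f_equal. ring.
Qed.

Lemma INR_S_ge1 (n : nat) : 1 <= INR (S n).
Proof. rewrite S_INR. pose proof (pos_INR n). lra. Qed.

Lemma INR_ge1 (n : nat) : (1 <= n)%nat -> 1 <= INR n.
Proof. intros H. destruct n; [lia|]. apply INR_S_ge1. Qed.

(** By the mean value theorem the increment of x^(1-a) over [n, n+1] is (1 - a)
    xi^(-a), and xi <= 2 n.  The case a < 1 bounds growing sums and the case a > 1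
    bounds tails, in both cases by telescoping. *)
Lemma Rpower_primitive (a : R) : 0 < a -> a <> 1 -> forall n : nat, (1 <= n)%nat ->
  Rpower (INR n) (- a) <=
    Rpower 2 a / (1 - a) * (Rpower (INR (S n)) (1 - a) - Rpower (INR n) (1 - a)).
Proof.
  intros Ha Ha1 n Hn. apply INR_ge1 in Hn.
  destruct (Rpower_MVT (1 - a) (INR n) (INR (S n))) as [xi [H1 H2]]; [lra|rewrite S_INR; lra|].
  rewrite S_INR in H1, H2 |- *. rewrite H2. replace (INR n + 1 - INR n) with 1 by ring.
  replace (1 - a - 1) with (- a) by ring.
  replace (Rpower 2 a / (1 - a) * ((1 - a) * Rpower xi (- a) * 1))
    with (Rpower 2 a * Rpower xi (- a)) by (field; lra).
  apply Rle_trans with (Rpower 2 a * Rpower (2 * INR n) (- a)).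
  - rewrite <- Rpower_mult_distr by lra. rewrite <- Rmult_assoc, <- Rpower_plus.
    rewrite Rplus_opp_r, Rpower_O by lra. lra.
  - apply Rmult_le_compat_l; [apply Rlt_le, Rpower_pos|].
    apply Rpower_le_base_neg; lra.
Qed.

(** * Partial sums and a discrete Gronwall inequality *)

Fixpoint partial_sum (f : nat -> R) (n : nat) : R :=
  match n with O => 0 | S m => partial_sum f m + f m end.

Lemma partial_sum_sum_n (f : nat -> R) (n : nat) : partial_sum f (S n) = sum_n f n.
Proof.
  induction n as [|n IH]; [simpl; rewrite sum_O; ring|].
  rewrite sum_Sn, <- IH. reflexivity.
Qed.

Lemma ex_series_of_bounded (f : nat -> R) (M : R) :
  (forall n, 0 <= f n) -> (forall n, partial_sum f n <= M) -> ex_series f.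
Proof.
  intros Hf HM.
  destruct (ex_finite_lim_seq_incr (sum_n f) M) as [l Hl].
  - intros n. rewrite sum_Sn. unfold plus; simpl. specialize (Hf (S n)). lra.
  - intros n. rewrite <- partial_sum_sum_n. apply HM.
  - exists l. exact Hl.
Qed.

Lemma ex_series_dominated (f g : nat -> R) :
  (forall n, Rabs (f n) <= g n) -> ex_series g -> ex_series f.
Proof. exact (ex_series_le f g). Qed.

Lemma partial_sum_mono (f : nat -> R) : (forall n, 0 <= f n) ->
  forall m n, (m <= n)%nat -> partial_sum f m <= partial_sum f n.
Proof.
  intros Hf m n H; induction H as [|n H IH]; [lra|]. simpl. specialize (Hf n). lra.
Qed.

Lemma partial_sum_le_Series (f : nat -> R) : (forall n, 0 <= f n) -> ex_series f ->
  forall n, partial_sum f n <= Series f.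
Proof.
  intros Hf Hex n.
  apply Rle_trans with (partial_sum f (S n)); [apply partial_sum_mono; [assumption|lia]|].
  rewrite partial_sum_sum_n.
  apply (is_lim_seq_incr_compare (sum_n f)).
  - apply (Series_correct f Hex).
  - intros k. rewrite sum_Sn. unfold plus; simpl. specialize (Hf (S k)). lra.
Qed.

Lemma ex_series_Rpower (a : R) : 1 < a -> ex_series (fun n => Rpower (INR (S n)) (- a)).
Proof.
  intros Ha. apply ex_series_of_bounded with (Rpower 2 a / (a - 1)).
  - intros n; apply Rlt_le, Rpower_pos.
  - intros n.
    assert (H : partial_sum (fun k => Rpower (INR (S k)) (- a)) n <=
      Rpower 2 a / (a - 1) * (1 - Rpower (INR (S n)) (1 - a))).
    { induction n as [|n IH].
      - simpl partial_sum. simpl INR. unfold Rpower at 2. rewrite ln_1, Rmult_0_r, exp_0. lra.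
      - cbn [partial_sum].
        pose proof (Rpower_primitive a ltac:(lra) ltac:(lra) (S n) ltac:(lia)) as H.
        replace (Rpower 2 a / (1 - a)) with (- (Rpower 2 a / (a - 1))) in H by (field; lra).
        clear -H IH. set (X := Rpower 2 a / (a - 1)) in *. nra. }
    apply Rle_trans with (1 := H).
    pose proof (Rpower_pos (INR (S n)) (1 - a)). pose proof (Rpower_pos 2 a).
    assert (0 < Rpower 2 a / (a - 1)) by (apply Rdiv_lt_0_compat; lra). nra.
Qed.

(** The accumulated exponent is carried by a potential Th rather than by a sum, so
    that it can be taken to be an explicit primitive such as n^(1-a). *)
Lemma gronwall (E Th : nat -> R) (m n : nat) : (m <= n)%nat ->
  (forall k, (m <= k < n)%nat -> E (S k) <= E k * exp (Th (S k) - Th k)) ->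
  E n <= E m * exp (Th n - Th m).
Proof.
  intros Hn; induction Hn as [|n Hn IH]; intros H.
  - rewrite Rminus_diag, exp_0. lra.
  - apply Rle_trans with (1 := H n ltac:(lia)).
    replace (Th (S n) - Th m) with ((Th n - Th m) + (Th (S n) - Th n)) by ring.
    rewrite exp_plus, <- Rmult_assoc.
    apply Rmult_le_compat_r; [apply Rlt_le, exp_pos|]. apply IH. intros k Hk; apply H; lia.
Qed.

Lemma exp_le (x y : R) : x <= y -> exp x <= exp y.
Proof. intros [H| ->]; [apply Rlt_le, exp_increasing, H|lra]. Qed.

(** * Eventual domination *)

Definition bigO (f g : nat -> R) : Prop :=
  exists K : R, 0 <= K /\ eventually (fun n => Rabs (f n) <= K * g n).

Lemma bigO_plus f1 f2 g : bigO f1 g -> bigO f2 g -> bigO (fun n => f1 n + f2 n) g.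
Proof.
  intros [K1 [P1 H1]] [K2 [P2 H2]]. exists (K1 + K2); split; [lra|].
  generalize (filter_and _ _ H1 H2). apply filter_imp. intros n [A B].
  apply Rle_trans with (1 := Rabs_triang _ _). lra.
Qed.

Lemma bigO_mult f1 f2 g1 g2 : bigO f1 g1 -> bigO f2 g2 ->
  bigO (fun n => f1 n * f2 n) (fun n => g1 n * g2 n).
Proof.
  intros [K1 [P1 H1]] [K2 [P2 H2]]. exists (K1 * K2); split; [nra|].
  generalize (filter_and _ _ H1 H2). apply filter_imp. intros n [A B].
  rewrite Rabs_mult. replace (K1 * K2 * (g1 n * g2 n)) with (K1 * g1 n * (K2 * g2 n)) by ring.
  apply Rmult_le_compat; try apply Rabs_pos; assumption.
Qed.

Lemma bigO_trans f g h C : 0 <= C -> bigO f g -> eventually (fun n => g n <= C * h n) -> bigO f h.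
Proof.
  intros HC [K [P H]] H2. exists (K * C); split; [nra|].
  generalize (filter_and _ _ H H2). apply filter_imp. intros n [A B].
  apply Rle_trans with (1 := A). rewrite Rmult_assoc. apply Rmult_le_compat_l; assumption.
Qed.

Lemma bigO_ext f1 f2 g : eventually (fun n => f1 n = f2 n) -> bigO f1 g -> bigO f2 g.
Proof.
  intros He [K [P H]]. exists K; split; [exact P|].
  generalize (filter_and _ _ He H). apply filter_imp. intros n [A B]. rewrite <- A. exact B.
Qed.

Lemma bigO_const c : bigO (fun _ => c) (fun _ => 1).
Proof.
  exists (Rabs c); split; [apply Rabs_pos|]. exists 0%nat; intros n _. lra.
Qed.

Lemma eventually_ge (m : nat) : eventually (fun n => (m <= n)%nat).
Proof. exists m; auto. Qed.

Lemma bigO_mult_bounded f1 f2 g : bigO f1 (fun _ => 1) -> bigO f2 g ->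
  bigO (fun n => f1 n * f2 n) g.
Proof.
  intros H1 H2. apply bigO_trans with (2 := bigO_mult _ _ _ _ H1 H2) (C := 1); [lra|].
  apply filter_forall; intros n; lra.
Qed.

Lemma bigO_self g : (forall n, 0 <= g n) -> bigO g g.
Proof.
  intros H. exists 1; split; [lra|]. apply filter_forall; intros n.
  rewrite Rabs_right by (apply Rle_ge, H). lra.
Qed.

Lemma bigO_abs g : bigO g (fun n => Rabs (g n)).
Proof. exists 1; split; [lra|]. apply filter_forall; intros n. lra. Qed.

(** A positive majorant absorbs the finitely many exceptional indices into the
    constant. *)
Lemma bigO_everywhere f g : bigO f g -> (forall n, (1 <= n)%nat -> 0 < g n) ->
  exists K, 0 < K /\ forall n, (1 <= n)%nat -> Rabs (f n) <= K * g n.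
Proof.
  intros [K [HK [N HN]]] Hg.
  assert (H : forall m, exists K', K <= K' /\ forall n, (1 <= n)%nat ->
     (n < m \/ N <= n)%nat -> Rabs (f n) <= K' * g n).
  { induction m as [|m [K' [H1 H2]]].
    - exists K; split; [lra|]. intros n _ [Hn|Hn]; [lia|]. apply HN, Hn.
    - destruct (Nat.eq_dec m 0) as [->|Hm].
      { exists K'; split; [exact H1|]. intros n Hn Hn2. apply H2; lia. }
      exists (K' + Rabs (f m) / g m).
      assert (P : 0 <= Rabs (f m) / g m)
        by (apply Rdiv_le_0_compat; [apply Rabs_pos|apply Hg; lia]).
      split; [lra|]. intros n Hn Hn2. pose proof (Hg n Hn).
      destruct (Nat.eq_dec n m) as [->|Hne].
      + replace ((K' + Rabs (f m) / g m) * g m) with (K' * g m + Rabs (f m)) by (field; lra). nra.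
      + specialize (H2 n Hn ltac:(lia)). nra. }
  destruct (H N) as [K' [H1 H2]]. exists (K' + 1); split; [lra|].
  intros n Hn. pose proof (Hg n Hn). specialize (H2 n Hn ltac:(lia)). nra.
Qed.

Lemma is_lim_seq_eventually_le (f : nat -> R) (l d : R) : is_lim_seq f l -> 0 < d ->
  eventually (fun n => Rabs (f n - l) <= d).
Proof.
  intros H Hd. apply is_lim_seq_spec in H. specialize (H (mkposreal d Hd)). simpl in H.
  revert H; apply filter_imp. intros n; lra.
Qed.

Lemma is_lim_Rpower_neg (a : R) : 0 < a -> is_lim_seq (fun n => Rpower (INR n) (- a)) 0.
Proof.
  intros Ha. apply is_lim_seq_spec. intros eps.
  destruct (nfloor_ex (Rpower eps (- / a))) as [m [Hm1 Hm2]]; [apply Rlt_le, Rpower_pos|].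
  exists (S m). intros n Hn. rewrite Rminus_0_r, Rabs_right by (apply Rgt_ge, Rpower_pos).
  assert (Hn' : INR m + 1 <= INR n) by (rewrite <- S_INR; apply le_INR, Hn).
  pose proof (cond_pos eps) as Pe. pose proof (Rpower_pos eps (- / a)) as P1.
  apply Rlt_le_trans with (Rpower (Rpower eps (- / a)) (- a)).
  - rewrite !(Rpower_Ropp _ a). apply Rinv_lt_contravar.
    + apply Rmult_lt_0_compat; apply Rpower_pos.
    + apply Rlt_Rpower_l; lra.
  - rewrite Rpower_mult. replace (- / a * - a) with 1 by (field; lra).
    rewrite Rpower_1 by lra. lra.
Qed.

(** * The critical regime after the change of sign *)

(** The form in which the hypotheses are used: b_n = x_0 n^be (1 + h_n), and the row
    sums of the matrix equal x_0 c n^(be-1) + e_n with c > 0.  The perturbations h and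
    e are summable against the weights with which they enter the energy of a solution
    at z = 0. *)
Record critical (al b : nat -> R) (x0 c be : R) (h e : nat -> R) : Prop := {
  cr_x0 : 0 < x0;
  cr_c : 0 < c;
  cr_be : 3 / 2 < be < 2;
  cr_pos : forall n, 0 < b n;
  cr_b : forall n, (1 <= n)%nat -> b n = x0 * Rpower (INR n) be * (1 + h n);
  cr_row : forall n, (1 <= n)%nat ->
    al n + b n + b (pred n) = x0 * c * Rpower (INR n) (be - 1) + e n;
  cr_h : ex_series (fun n => Rpower (INR (S n)) (- (1 / 2)) * Rabs (h (S n)));
  cr_h0 : is_lim_seq h 0;
  cr_e : ex_series (fun n => Rpower (INR (S n)) (- (be - 1 / 2)) * Rabs (e (S n)))
}.

(** * Decay of the solutions at z = 0 *)

Section Lyapunov.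
Context (al b : nat -> R) (x0 c be : R) (h e : nat -> R).
Hypothesis Hcr : critical al b x0 c be h e.

(* Heuristically |u_n| ~ Y_n^(-1/2) and |w_n| ~ Y_n^(1/2), while the phase advances
   by a multiple of rho_n = n^(-1/2).  All errors of one step are measured by err. *)
Let om := be - 1 / 2.
Let Y n := Rpower (INR n) om.
Let rho n := Rpower (INR n) (- (1 / 2)).
Let eps n := e n / Y n.
Let err n := Rpower (INR n) (- (3 / 2)) + rho n * Rabs (h n) + Rabs (eps n).
(* The coefficient of the cross term that removes the errors of order 1/n. *)
Let ga := x0 * (om - c).
Let rem_up n := Y (S n) / Y n - 1 - om * rho n ^ 2.
Let rem_down n := Y n / Y (S n) - 1 + om * rho n ^ 2.
Let drho n := rho (S n) - rho n.
Let hinv n := / (1 + h n) - 1.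

Lemma rho_sq n : (1 <= n)%nat -> rho n ^ 2 = Rpower (INR n) (-1).
Proof.
  intros Hn. unfold rho. simpl. rewrite Rmult_1_r, <- Rpower_plus. f_equal. lra.
Qed.

Lemma err_ge n : Rpower (INR n) (- (3 / 2)) <= err n /\ rho n * Rabs (h n) <= err n /\ Rabs (eps n) <= err n.
Proof.
  unfold err. pose proof (Rpower_pos (INR n) (- (3 / 2))). pose proof (Rpower_pos (INR n) (- (1 / 2))).
  pose proof (Rabs_pos (h n)). pose proof (Rabs_pos (eps n)). unfold rho in *.
  assert (0 <= Rpower (INR n) (- (1 / 2)) * Rabs (h n)) by nra. lra.
Qed.

Lemma bigO_power_ratio (p : R) :
  bigO (fun n => Rpower (INR (S n)) p / Rpower (INR n) p - 1 - p * rho n ^ 2) err.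
Proof.
  destruct (Rpower_diff2 p) as [K [HK H]]. exists K; split; [lra|].
  exists 1%nat. intros n Hn. pose proof (INR_ge1 n Hn) as Hx.
  specialize (H (INR n) Hx). rewrite <- S_INR in H.
  pose proof (Rpower_pos (INR n) p) as Pp.
  rewrite rho_sq by assumption.
  replace (Rpower (INR (S n)) p / Rpower (INR n) p - 1 - p * Rpower (INR n) (-1)) with
    ((Rpower (INR (S n)) p - Rpower (INR n) p - p * Rpower (INR n) (p - 1)) * Rpower (INR n) (- p)).
  - rewrite Rabs_mult, (Rabs_right (Rpower _ (- p))) by (apply Rgt_ge, Rpower_pos).
    apply Rle_trans with (K * Rpower (INR n) (p - 2) * Rpower (INR n) (- p)).
    { apply Rmult_le_compat_r; [apply Rlt_le, Rpower_pos|exact H]. }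
    rewrite Rmult_assoc, <- Rpower_plus. apply Rmult_le_compat_l; [lra|].
    apply Rle_trans with (2 := proj1 (err_ge n)). apply Rle_Rpower; lra.
  - replace (p - 1) with (p + -1) by ring. rewrite Rpower_plus, (Rpower_Ropp _ p). field. lra.
Qed.

Lemma bigO_rem_up : bigO rem_up err.
Proof. apply (bigO_power_ratio om). Qed.

Lemma bigO_rem_down : bigO rem_down err.
Proof.
  apply bigO_ext with (2 := bigO_power_ratio (- om)).
  exists 1%nat; intros n Hn. unfold rem_down, Y. rewrite !Rpower_Ropp.
  pose proof (Rpower_pos (INR n) om). pose proof (Rpower_pos (INR (S n)) om). field. lra.
Qed.

Lemma bigO_drho : bigO drho err.
Proof.
  destruct (Rpower_diff1 (- (1 / 2))) as [K [HK H]]. exists K; split; [lra|].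
  exists 1%nat. intros n Hn. pose proof (INR_ge1 n Hn) as Hx.
  unfold drho, rho. rewrite S_INR.
  apply Rle_trans with (1 := H (INR n) (INR n + 1) Hx ltac:(lra)).
  apply Rmult_le_compat_l; [lra|]. apply Rle_trans with (2 := proj1 (err_ge n)).
  replace (- (1 / 2) - 1) with (- (3 / 2)) by field. lra.
Qed.

Lemma bigO_rho : bigO rho (fun _ => 1).
Proof.
  exists 1; split; [lra|]. exists 1%nat. intros n Hn. pose proof (INR_ge1 n Hn).
  unfold rho. rewrite Rabs_right by (apply Rgt_ge, Rpower_pos).
  rewrite Rmult_1_r. apply Rpower_le_1; lra.
Qed.

Lemma h_small : eventually (fun n => Rabs (h n) <= / 2).
Proof.
  generalize (is_lim_seq_eventually_le h 0 (/ 2) (cr_h0 _ _ _ _ _ _ _ Hcr) ltac:(lra)).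
  apply filter_imp. intros n. rewrite Rminus_0_r. auto.
Qed.

Lemma bigO_hinv : bigO hinv (fun n => Rabs (h n)).
Proof.
  exists 2; split; [lra|]. generalize h_small. apply filter_imp. intros n Hn.
  unfold hinv. assert (0 < 1 + h n) by (pose proof (Rabs_maj2 (h n)); lra).
  replace (/ (1 + h n) - 1) with (h n * - / (1 + h n)) by (field; lra).
  rewrite Rabs_mult, Rabs_Ropp, (Rabs_right (/ _)) by (apply Rgt_ge, Rinv_0_lt_compat; assumption).
  rewrite Rmult_comm. apply Rmult_le_compat_r; [apply Rabs_pos|].
  rewrite <- (Rinv_inv 2). apply Rinv_le_contravar; [lra|].
  pose proof (Rabs_maj2 (h n)); lra.
Qed.

Lemma bigO_hinv_bounded : bigO hinv (fun _ => 1).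
Proof.
  apply bigO_trans with (2 := bigO_hinv) (C := / 2); [lra|].
  generalize h_small. apply filter_imp. intros n; lra.
Qed.

Lemma bigO_rho_hinv : bigO (fun n => rho n * hinv n) err.
Proof.
  apply bigO_trans with (2 := bigO_mult _ _ _ _ (bigO_self rho (fun n => Rlt_le _ _ (Rpower_pos _ _))) bigO_hinv) (C := 1); [lra|].
  apply filter_forall. intros n. rewrite Rmult_1_l. apply err_ge.
Qed.

Lemma bigO_eps : bigO eps err.
Proof.
  apply bigO_trans with (2 := bigO_abs eps) (C := 1); [lra|].
  apply filter_forall. intros n. rewrite Rmult_1_l. apply err_ge.
Qed.

Lemma err_summable : ex_series (fun n => err (S n)).
Proof.
  unfold err. apply (ex_series_plus (fun n => Rpower (INR (S n)) (- (3 / 2)) + rho (S n) * Rabs (h (S n))) (fun n => Rabs (eps (S n)))).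
  - apply (ex_series_plus (fun n => Rpower (INR (S n)) (- (3 / 2))) (fun n => rho (S n) * Rabs (h (S n)))).
    + apply ex_series_Rpower; lra.
    + apply (cr_h _ _ _ _ _ _ _ Hcr).
  - apply (ex_series_ext (fun n => Rpower (INR (S n)) (- (be - 1 / 2)) * Rabs (e (S n)))).
    + intros n. unfold eps, Y, Rdiv. rewrite Rabs_mult, Rabs_inv, Rpower_Ropp.
      rewrite (Rabs_right (Rpower _ _)) by (apply Rgt_ge, Rpower_pos).
      unfold om, Rdiv. match goal with |- ?p = ?q => change (@eq R p q) end; ring.
    + apply (cr_e _ _ _ _ _ _ _ Hcr).
Qed.

Lemma err_eventually_le_1 : eventually (fun n => err n <= 1).
Proof.
  pose proof (ex_series_lim_0 _ err_summable) as H.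
  assert (H' : is_lim_seq err 0) by (apply is_lim_seq_incr_1, H).
  generalize (is_lim_seq_eventually_le _ _ 1 H' ltac:(lra)). apply filter_imp.
  intros n Hn. rewrite Rminus_0_r in Hn. pose proof (RRle_abs (err n)). lra.
Qed.

Lemma bigO_eps_bounded : bigO eps (fun _ => 1).
Proof.
  apply bigO_trans with (2 := bigO_eps) (C := 1); [lra|].
  generalize err_eventually_le_1; apply filter_imp; intros; lra.
Qed.

(* The coefficients of Y u^2, u w' and w'^2 / Y in the increment of the energy; see
   energy_step, where w' is the value of w at n + 1. *)
Let coef_uu n := c * x0 ^ 2 * (Y (S n) / Y n - 1) - ga * rho n * (x0 * c * rho n + eps n)
   - (x0 * c * rho n + eps n) ^ 2.
Let coef_uw n := 2 * c * x0 * (Y (S n) / Y n) * rho n * (1 + hinv n) + ga * (rho (S n) - rho n)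
   - 2 * (x0 * c * rho n + eps n).
Let coef_ww n := c * (Y (S n) / Y n) * rho n ^ 2 * (1 + hinv n) ^ 2
   + (om - c) * rho (S n) * rho n * (1 + hinv n) + Y n / Y (S n) - 1.

Ltac bigO_terms := repeat first
  [ assumption | apply bigO_const | apply bigO_rho | apply bigO_hinv_bounded | apply bigO_eps_bounded
  | apply bigO_plus | apply bigO_mult_bounded ].

(** The terms of order rho^2 cancel by the choice of ga. *)
Lemma bigO_coef_uu : bigO coef_uu err.
Proof.
  pose proof bigO_rem_up as H1. pose proof bigO_eps as H2.
  apply bigO_ext with (f1 := fun n => (c * x0 ^ 2) * rem_up n +
    (- (ga + 2 * x0 * c) * rho n + (-1) * eps n) * eps n).
  - exists 1%nat; intros n Hn. unfold coef_uu, rem_up, ga, om. field. apply Rgt_not_eq, Rpower_pos.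
  - bigO_terms.
Qed.

Lemma bigO_rho_cube : bigO (fun n => rho n * rho n * rho n) err.
Proof.
  exists 1; split; [lra|]. exists 1%nat; intros n Hn.
  rewrite Rabs_right by (unfold rho; apply Rle_ge; repeat apply Rmult_le_pos; apply Rlt_le, Rpower_pos).
  rewrite Rmult_1_l. apply Rle_trans with (2 := proj1 (err_ge n)). unfold rho.
  rewrite <- !Rpower_plus. right. f_equal. field.
Qed.

(** The terms of order rho cancel because the form c x_0^2 Y u^2 + w^2 / Y is the
    energy adapted to the frequency. *)
Lemma bigO_coef_uw : bigO coef_uw err.
Proof.
  pose proof bigO_rem_up as H1. pose proof bigO_eps as H2. pose proof bigO_rho_hinv as H3.
  pose proof bigO_drho as H4. pose proof bigO_rho as H5.
  pose proof bigO_rho_cube as H6.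
  apply bigO_ext with (f1 := fun n => 2 * c * x0 * (om * (1 + hinv n) * (rho n * rho n * rho n) + rho n * (1 + hinv n) * rem_up n + rho n * hinv n)
     + ga * drho n + (-2) * eps n).
  - exists 1%nat; intros n Hn. unfold coef_uw, rem_up, drho. field. apply Rgt_not_eq, Rpower_pos.
  - repeat first [ assumption | apply bigO_const | apply bigO_hinv_bounded | apply bigO_plus | apply bigO_mult_bounded ].
Qed.

(** The terms of order rho^2 cancel by the same choice of ga as for the coefficient of
    u^2, which is what makes the form almost invariant. *)
Lemma bigO_coef_ww : bigO coef_ww err.
Proof.
  pose proof bigO_rem_up as H1. pose proof bigO_rem_down as H2. pose proof bigO_rho_hinv as H3.
  pose proof bigO_drho as H4. pose proof bigO_rho as H5.
  pose proof bigO_rho_cube as H6.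
  apply bigO_ext with (f1 := fun n =>
     c * (rho n * (om * (1 + hinv n) * (1 + hinv n)) * (rho n * rho n * rho n)
          + rho n * rho n * (1 + hinv n) * (1 + hinv n) * rem_up n
          + (rho n * (2 + hinv n)) * (rho n * hinv n))
     + (om - c) * (rho n * (1 + hinv n) * drho n + rho n * (rho n * hinv n)) + rem_down n).
  - exists 1%nat; intros n Hn. unfold coef_ww, rem_up, rem_down, drho.
    pose proof (Rpower_pos (INR n) om). pose proof (Rpower_pos (INR (S n)) om).
    field. unfold Y; lra.
  - repeat first [ assumption | apply bigO_const | apply bigO_hinv_bounded | apply bigO_plus | apply bigO_mult_bounded ].
Qed.

(** One step of the recurrence at z = 0 updates w first and u afterwards.  Writing the
    increment in u and the new w' keeps every coefficient polynomial in the small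
    quantities. *)
Lemma energy_step (u w' Y0 Y1 r0 r1 H ep g : R) : 0 < Y0 -> 0 < Y1 -> 0 < x0 ->
  g = x0 * (om - c) ->
  let u' := u + w' * r0 * H / (x0 * Y0) in
  let w := w' + (x0 * c * r0 + ep) * Y0 * u in
  (c * x0 ^ 2 * Y1 * u' ^ 2 + g * r1 * u' * w' + w' ^ 2 / Y1)
  - (c * x0 ^ 2 * Y0 * u ^ 2 + g * r0 * u * w + w ^ 2 / Y0)
  = (c * x0 ^ 2 * (Y1 / Y0 - 1) - g * r0 * (x0 * c * r0 + ep) - (x0 * c * r0 + ep) ^ 2) * (Y0 * u ^ 2)
   + (2 * c * x0 * (Y1 / Y0) * r0 * H + g * (r1 - r0) - 2 * (x0 * c * r0 + ep)) * (u * w')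
   + (c * (Y1 / Y0) * r0 ^ 2 * H ^ 2 + (om - c) * r1 * r0 * H + Y0 / Y1 - 1) * (w' ^ 2 / Y0).
Proof.
  intros P0 P1 P2 -> u' w. unfold u', w. field. lra.
Qed.

Lemma am_gm (Y0 u w : R) : 0 < Y0 -> Rabs (u * w) <= (Y0 * u ^ 2 + w ^ 2 / Y0) / 2.
Proof.
  intros P.
  assert (H1 : 0 <= (Y0 * u - w) ^ 2 / Y0) by (apply Rdiv_le_0_compat; [apply pow2_ge_0|exact P]).
  assert (H2 : 0 <= (Y0 * u + w) ^ 2 / Y0) by (apply Rdiv_le_0_compat; [apply pow2_ge_0|exact P]).
  replace ((Y0 * u - w) ^ 2 / Y0) with (Y0 * u ^ 2 + w ^ 2 / Y0 - 2 * (u * w)) in H1 by (field; lra).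
  replace ((Y0 * u + w) ^ 2 / Y0) with (Y0 * u ^ 2 + w ^ 2 / Y0 + 2 * (u * w)) in H2 by (field; lra).
  apply Rabs_le. lra.
Qed.

(** The energy c x_0^2 Y u^2 + ga rho u w + w^2 / Y is positive definite for large n,
    and its relative increments are O(err), which is summable.  Hence it stays
    bounded, and it dominates Y u^2. *)
Lemma solution_bound (u : nat -> R) :
  (forall n, (1 <= n)%nat -> b n * u (S n) + al n * u n + b (pred n) * u (pred n) = 0) ->
  exists K, 0 < K /\ forall n, (1 <= n)%nat -> Rabs (u n) <= K * Rpower (INR n) (- (om / 2)).
Proof.
  intros Hu.
  pose proof (cr_x0 _ _ _ _ _ _ _ Hcr) as Px0. pose proof (cr_c _ _ _ _ _ _ _ Hcr) as Pc.
  assert (PY : forall n, 0 < Y n) by (intros; apply Rpower_pos).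
  assert (Pr : forall n, 0 < rho n) by (intros; apply Rpower_pos).
  set (w := fun n => b (pred n) * (u n - u (pred n))).
  set (En := fun n => c * x0 ^ 2 * Y n * u n ^ 2 + ga * rho n * u n * w n + w n ^ 2 / Y n).
  set (G := fun n => Y n * u n ^ 2 + w (S n) ^ 2 / Y n).
  set (N0 := fun n => Y n * u n ^ 2 + w n ^ 2 / Y n).
  assert (PN : forall n, 0 <= w n ^ 2 / Y n) by (intros n; apply Rdiv_le_0_compat; [apply pow2_ge_0|apply PY]).
  assert (PG : forall n, 0 <= Y n * u n ^ 2) by (intros n; pose proof (PY n); pose proof (pow2_ge_0 (u n)); nra).
  assert (Hw : forall n, (1 <= n)%nat -> w n = w (S n) + (x0 * c * rho n + eps n) * Y n * u n).
  { intros n Hn. unfold w. simpl pred.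
    pose proof (Hu n Hn) as H1. pose proof (cr_row _ _ _ _ _ _ _ Hcr n Hn) as H2.
    replace (Rpower (INR n) (be - 1)) with (rho n * Y n) in H2
      by (unfold rho, Y, om; rewrite <- Rpower_plus; f_equal; field).
    replace ((x0 * c * rho n + eps n) * Y n * u n) with ((x0 * c * (rho n * Y n) + e n) * u n)
      by (unfold eps; field; apply Rgt_not_eq, PY).
    rewrite <- H2. lra. }
  assert (HE : eventually (fun n => En (S n) - En n =
      coef_uu n * (Y n * u n ^ 2) + coef_uw n * (u n * w (S n)) + coef_ww n * (w (S n) ^ 2 / Y n))).
  { generalize (filter_and _ _ h_small (eventually_ge 1)). apply filter_imp. intros n [Hh Hn].
    assert (Ph : 0 < 1 + h n) by (pose proof (Rabs_maj2 (h n)); lra).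
    assert (Hu1 : u (S n) = u n + w (S n) * rho n * (1 + hinv n) / (x0 * Y n)).
    { unfold w, hinv; simpl pred. rewrite (cr_b _ _ _ _ _ _ _ Hcr n Hn).
      replace (Rpower (INR n) be) with (Y n / rho n).
      - pose proof (PY n). pose proof (Pr n). field. repeat split; lra.
      - unfold Y, rho, om, Rdiv. rewrite <- Rpower_Ropp, <- Rpower_plus. f_equal. field. }
    unfold En. rewrite Hu1, (Hw n Hn).
    rewrite (energy_step (u n) (w (S n)) (Y n) (Y (S n)) (rho n) (rho (S n)) (1 + hinv n) (eps n) ga); auto. }
  (* positivity: the cross term is smaller by the factor rho *)
  set (k0 := Rmin (c * x0 ^ 2) 1 / 2).
  assert (Pcx : 0 < c * x0 ^ 2) by (apply Rmult_lt_0_compat; [|apply pow_lt]; assumption).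
  assert (Pk0 : 0 < k0) by (unfold k0; apply Rdiv_lt_0_compat; [apply Rmin_pos; lra|lra]).
  assert (HN : eventually (fun n => k0 * N0 n <= En n)).
  { assert (Hl : is_lim_seq (fun n => Rabs ga * rho n) 0).
    { replace (Finite 0) with (Rbar_mult (Rabs ga) 0) by (simpl; f_equal; ring).
      apply is_lim_seq_scal_l, is_lim_Rpower_neg. lra. }
    generalize (is_lim_seq_eventually_le _ _ k0 Hl Pk0). apply filter_imp. intros n Hn.
    rewrite Rminus_0_r in Hn. pose proof (Pr n). pose proof (Rabs_pos ga).
    rewrite Rabs_right in Hn by nra.
    pose proof (am_gm (Y n) (u n) (w n) (PY n)) as HA. fold (N0 n) in HA.
    assert (HB : Rabs (ga * rho n * u n * w n) <= k0 * (N0 n)).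
    { replace (ga * rho n * u n * w n) with (ga * rho n * (u n * w n)) by ring.
      rewrite 2!Rabs_mult, (Rabs_right (rho n)) by lra.
      assert (0 <= N0 n) by (unfold N0; specialize (PN n); specialize (PG n); lra).
      apply Rle_trans with (k0 * (N0 n / 2)); [|nra].
      apply Rmult_le_compat; [nra|apply Rabs_pos|exact Hn|exact HA]. }
    pose proof (Rabs_maj2 (ga * rho n * u n * w n)) as HC.
    unfold En. 
    assert (k0 * 2 <= c * x0 ^ 2) by (unfold k0; pose proof (Rmin_l (c * x0 ^ 2) 1); lra).
    assert (k0 * 2 <= 1) by (unfold k0; pose proof (Rmin_r (c * x0 ^ 2) 1); lra).
    specialize (PG n); specialize (PN n). unfold N0 in *.
    assert (2 * k0 * (Y n * u n ^ 2) <= c * x0 ^ 2 * (Y n * u n ^ 2)) by nra.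
    assert (2 * k0 * (w n ^ 2 / Y n) <= w n ^ 2 / Y n) by nra. nra. }
  (* passing between w and w' costs a bounded factor *)
  destruct (bigO_plus _ _ _ (bigO_mult_bounded _ _ _ (bigO_const (x0 * c)) bigO_rho) bigO_eps_bounded) as [K1 [PK1 HK1]].
  set (K2 := 2 + 2 * K1 ^ 2).
  assert (HG : eventually (fun n => G n <= K2 * N0 n)).
  { generalize (filter_and _ _ HK1 (eventually_ge 1)). apply filter_imp. intros n [H1 Hn].
    rewrite Rmult_1_r in H1. specialize (Hw n Hn). set (A := x0 * c * rho n + eps n) in *.
    assert (HA : A ^ 2 <= K1 ^ 2) by (apply pow_maj_Rabs; exact H1).
    pose proof (pow2_ge_0 (w n + A * Y n * u n)) as HS.
    assert (HS2 : 0 <= (w n + A * Y n * u n) ^ 2 / Y n) by (apply Rdiv_le_0_compat; [exact HS|apply PY]).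
    unfold G, N0. replace (w (S n)) with (w n - A * Y n * u n) by lra.
    assert (HI : (w n - A * Y n * u n) ^ 2 / Y n = 2 * (w n ^ 2 / Y n) + 2 * A ^ 2 * (Y n * u n ^ 2) - (w n + A * Y n * u n) ^ 2 / Y n)
      by (field; apply Rgt_not_eq, PY).
    rewrite HI. specialize (PG n); specialize (PN n). unfold K2. nra. }
  destruct bigO_coef_uu as [Ka [Pa Ha]]. destruct bigO_coef_uw as [Km [Pm Hm]]. destruct bigO_coef_ww as [Kd [Pd Hd]].
  set (K3 := (Ka + Km + Kd) * K2 / k0).
  assert (PK3 : 0 <= K3).
  { unfold K3, K2. apply Rdiv_le_0_compat; [|exact Pk0]. pose proof (pow2_ge_0 K1). nra. }
  assert (Htau : forall n, 0 <= err n).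
  { intros n. pose proof (err_ge n) as [T _]. pose proof (Rpower_pos (INR n) (- (3 / 2))). lra. }
  assert (Hstep : eventually (fun n => En (S n) <= En n * exp (K3 * err n))).
  { generalize (filter_and _ _ HE (filter_and _ _ HN (filter_and _ _ HG (filter_and _ _ Ha (filter_and _ _ Hm Hd))))).
    apply filter_imp. intros n (A1 & A2 & A3 & A4 & A5 & A6).
    pose proof (am_gm (Y n) (u n) (w (S n)) (PY n)) as HA. fold (G n) in HA.
    pose proof (PG n) as G1.
    assert (G2 : 0 <= w (S n) ^ 2 / Y n) by (apply Rdiv_le_0_compat; [apply pow2_ge_0|apply PY]).
    specialize (Htau n).
    assert (B1 : coef_uu n * (Y n * u n ^ 2) <= Ka * err n * G n).
    { apply Rle_trans with (Ka * err n * (Y n * u n ^ 2)).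
      - apply Rmult_le_compat_r; [exact G1|]. pose proof (RRle_abs (coef_uu n)); lra.
      - apply Rmult_le_compat_l; [nra|unfold G; lra]. }
    assert (B3 : coef_ww n * (w (S n) ^ 2 / Y n) <= Kd * err n * G n).
    { apply Rle_trans with (Kd * err n * (w (S n) ^ 2 / Y n)).
      - apply Rmult_le_compat_r; [exact G2|]. pose proof (RRle_abs (coef_ww n)); lra.
      - apply Rmult_le_compat_l; [nra|unfold G; lra]. }
    assert (B2 : coef_uw n * (u n * w (S n)) <= Km * err n * G n).
    { apply Rle_trans with (1 := RRle_abs _). rewrite Rabs_mult.
      apply Rmult_le_compat; [apply Rabs_pos|apply Rabs_pos|exact A5|]. unfold G in *; lra. }
    assert (B4 : G n <= K2 / k0 * En n).
    { apply Rle_trans with (1 := A3). unfold Rdiv. rewrite Rmult_assoc. apply Rmult_le_compat_l.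
      - unfold K2. pose proof (pow2_ge_0 K1). lra.
      - apply (Rmult_le_reg_l k0); [exact Pk0|]. rewrite <- Rmult_assoc, Rinv_r by lra. lra. }
    assert (B5 : En (S n) <= En n * (1 + K3 * err n)).
    { replace (En (S n)) with (En n + (En (S n) - En n)) by ring. rewrite A1.
      replace (En n * (1 + K3 * err n)) with (En n + (Ka + Km + Kd) * err n * (K2 / k0 * En n))
        by (unfold K3; field; lra).
      assert ((Ka + Km + Kd) * err n * G n <= (Ka + Km + Kd) * err n * (K2 / k0 * En n)).
      { apply Rmult_le_compat_l; [|exact B4]. apply Rmult_le_pos; lra. }
      lra. }
    apply Rle_trans with (1 := B5). apply Rmult_le_compat_l.
    - assert (0 <= N0 n) by (unfold N0; specialize (PN n); lra). nra.
    - apply exp_ineq1_le. }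
  destruct (filter_and _ _ Hstep (filter_and _ _ HN (eventually_ge 1))) as [N HNN].
  pose (Th := fun n => K3 * partial_sum (fun k => err (S k)) (pred n)).
  set (S0 := Series (fun k => err (S k))).
  assert (Hbd : forall n, (N <= n)%nat -> En n <= Rabs (En N) * exp (K3 * S0)).
  { intros n Hn. 
    apply Rle_trans with (En N * exp (Th n - Th N)).
    - apply (gronwall En Th N); [exact Hn|]. intros k [Hk _].
      destruct (HNN k Hk) as (A1 & _ & A3). 
      replace (Th (S k) - Th k) with (K3 * err k); [exact A1|].
      unfold Th. destruct k; [lia|]. simpl. ring.
    - pose proof (partial_sum_le_Series _ (fun k => Htau (S k)) err_summable (pred n)) as H1. fold S0 in H1.
      pose proof (partial_sum_mono _ (fun k => Htau (S k)) 0 (pred N) ltac:(lia)) as H2. simpl in H2.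
      apply Rle_trans with (Rabs (En N) * exp (Th n - Th N)).
      + apply Rmult_le_compat_r; [apply Rlt_le, exp_pos|apply RRle_abs].
      + apply Rmult_le_compat_l; [apply Rabs_pos|].
        apply exp_le. unfold Th. nra. }
  set (M := Rabs (En N) * exp (K3 * S0) / k0) in *.
  apply bigO_everywhere; [|intros; apply Rpower_pos].
  exists (sqrt M). split; [apply sqrt_pos|]. exists N. intros n Hn.
  specialize (Hbd n Hn). destruct (HNN n Hn) as (_ & A2 & _).
  assert (A3 : Y n * u n ^ 2 <= M).
  { apply (Rmult_le_reg_l k0); [exact Pk0|].
    replace (k0 * M) with (Rabs (En N) * exp (K3 * S0)) by (unfold M; field; lra).
    unfold N0 in A2. specialize (PN n). nra. }
  replace (Rpower (INR n) (- (om / 2))) with (/ sqrt (Y n)).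
  - pose proof (sqrt_lt_R0 _ (PY n)) as Ps.
    apply (Rmult_le_reg_r (sqrt (Y n))); [exact Ps|].
    rewrite Rmult_assoc, Rinv_l, Rmult_1_r by lra.
    rewrite <- (Rabs_right (sqrt (Y n))) by lra. rewrite <- Rabs_mult, <- sqrt_Rsqr_abs.
    apply sqrt_le_1_alt. unfold Rsqr.
    replace (u n * sqrt (Y n) * (u n * sqrt (Y n))) with (u n ^ 2 * (sqrt (Y n) * sqrt (Y n))) by ring.
    rewrite sqrt_sqrt by (apply Rlt_le, PY). lra.
  - unfold Y. rewrite <- Rpower_sqrt by apply Rpower_pos. rewrite Rpower_mult, <- Rpower_Ropp. f_equal; field.
Qed.

End Lyapunov.

Section Bounds.
Context (al b : nat -> R) (x0 c be : R) (h e : nat -> R).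
Hypothesis Hcr : critical al b x0 c be h e.

Lemma offdiag_upper : exists K, 0 < K /\ forall n, (1 <= n)%nat -> b n <= K * Rpower (INR n) be.
Proof.
  destruct (bigO_everywhere b (fun n => Rpower (INR n) be)) as [K [PK HK]].
  - exists (2 * x0). pose proof (cr_x0 _ _ _ _ _ _ _ Hcr). split; [lra|].
    generalize (filter_and _ _ (h_small _ _ _ _ _ _ _ Hcr) (eventually_ge 1)). apply filter_imp.
    intros n [H1 H2]. rewrite Rabs_right by (apply Rgt_ge, (cr_pos _ _ _ _ _ _ _ Hcr)).
    rewrite (cr_b _ _ _ _ _ _ _ Hcr n H2). pose proof (RRle_abs (h n)).
    pose proof (Rpower_pos (INR n) be). assert (0 < x0 * Rpower (INR n) be) by nra. nra.
  - intros; apply Rpower_pos.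
  - exists K; split; [exact PK|]. intros n Hn. apply Rle_trans with (1 := RRle_abs _), HK, Hn.
Qed.

Lemma offdiag_lower : exists K, 0 < K /\ forall n, (1 <= n)%nat -> K * Rpower (INR n) be <= b n.
Proof.
  destruct (bigO_everywhere (fun n => Rpower (INR n) be) b) as [K [PK HK]].
  - exists (2 / x0). pose proof (cr_x0 _ _ _ _ _ _ _ Hcr) as P.
    assert (0 < 2 / x0) by (apply Rdiv_lt_0_compat; lra). split; [lra|].
    generalize (filter_and _ _ (h_small _ _ _ _ _ _ _ Hcr) (eventually_ge 1)). apply filter_imp.
    intros n [H1 H2]. rewrite Rabs_right by (apply Rgt_ge, Rpower_pos).
    rewrite (cr_b _ _ _ _ _ _ _ Hcr n H2). pose proof (Rabs_maj2 (h n)).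
    pose proof (Rpower_pos (INR n) be).
    replace (2 / x0 * (x0 * Rpower (INR n) be * (1 + h n))) with (Rpower (INR n) be * (2 * (1 + h n)))
      by (field; lra). nra.
  - intros; apply (cr_pos _ _ _ _ _ _ _ Hcr).
  - exists (/ K); split; [apply Rinv_0_lt_compat, PK|]. intros n Hn.
    apply (Rmult_le_reg_l K); [exact PK|]. rewrite <- Rmult_assoc, Rinv_r, Rmult_1_l by lra.
    apply Rle_trans with (1 := RRle_abs _), HK, Hn.
Qed.
End Bounds.

(** * Variation of constants with respect to z = 0 *)

Lemma jacobi_solution_step a b z u0 u1 n :
  jacobi_solution a b z u0 u1 (S (S n)) =
  (((z - a (S n)) * jacobi_solution a b z u0 u1 (S n)
    - b n * jacobi_solution a b z u0 u1 n) / b (S n))%C.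
Proof. reflexivity. Qed.

Fixpoint Cpartial_sum (f : nat -> C) (n : nat) : C :=
  match n with O => RtoC 0 | S m => (Cpartial_sum f m + f m)%C end.

Lemma RtoC_neq0 (x : R) : x <> 0 -> RtoC x <> RtoC 0.
Proof. intros H E. apply H. apply RtoC_inj, E. Qed.

Definition climit (x : nat -> C) (l : C) : Prop :=
  is_lim_seq (fun n => Re (x n)) (Re l) /\ is_lim_seq (fun n => Im (x n)) (Im l).

Lemma climit_Cmod x l : climit x l -> is_lim_seq (fun n => Cmod (x n)) (Cmod l).
Proof.
  intros [H1 H2]. unfold Cmod.
  apply is_lim_seq_continuous with (f := sqrt) (u := fun n => fst (x n) ^ 2 + snd (x n) ^ 2).
  - apply continuity_pt_sqrt. pose proof (pow2_ge_0 (fst l)). pose proof (pow2_ge_0 (snd l)). lra.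
  - simpl. apply is_lim_seq_plus'.
    + apply is_lim_seq_mult'; [exact H1|]. apply is_lim_seq_mult'; [exact H1|apply is_lim_seq_const].
    + apply is_lim_seq_mult'; [exact H2|]. apply is_lim_seq_mult'; [exact H2|apply is_lim_seq_const].
Qed.

Lemma climit_affine x l A z : climit x l -> climit (fun n => A + z * x n)%C (A + z * l)%C.
Proof.
  intros [H1 H2]. destruct A as [A1 A2], z as [z1 z2].
  split; simpl.
  - apply is_lim_seq_plus'; [apply is_lim_seq_const|].
    apply is_lim_seq_minus'; apply is_lim_seq_mult'; (apply is_lim_seq_const || assumption).
  - apply is_lim_seq_plus'; [apply is_lim_seq_const|].
    apply is_lim_seq_plus'; apply is_lim_seq_mult'; (apply is_lim_seq_const || assumption).
Qed.

Lemma Im_le_Cmod (z : C) : Rabs (Im z) <= Cmod z.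
Proof. destruct z as [x y]. apply Rle_trans with (2 := Rmax_Cmod (x, y)). apply Rmax_r. Qed.

Lemma is_lim_partial_sum (f : nat -> R) : ex_series f -> is_lim_seq (partial_sum f) (Series f).
Proof.
  intros H. apply is_lim_seq_incr_1.
  apply is_lim_seq_ext with (sum_n f); [intros n; symmetry; apply partial_sum_sum_n|].
  apply (Series_correct f H).
Qed.

Lemma Re_Cpartial_sum f n : Re (Cpartial_sum f n) = partial_sum (fun k => Re (f k)) n.
Proof. induction n as [|n IH]; [reflexivity|]. cbn [partial_sum]. rewrite <- IH. reflexivity. Qed.

Lemma Im_Cpartial_sum f n : Im (Cpartial_sum f n) = partial_sum (fun k => Im (f k)) n.
Proof. induction n as [|n IH]; [reflexivity|]. cbn [partial_sum]. rewrite <- IH. reflexivity. Qed.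

Lemma climit_CSeries (f : nat -> C) (g : nat -> R) :
  (forall k, Cmod (f k) <= g k) -> ex_series g -> climit (Cpartial_sum f) (CSeries f).
Proof.
  intros Hf Hg. split; simpl.
  - apply is_lim_seq_ext with (1 := fun n => eq_sym (Re_Cpartial_sum f n)).
    apply is_lim_partial_sum. apply (ex_series_le (fun k => Re (f k)) g); [|exact Hg].
    intros n. apply Rle_trans with (2 := Hf n). apply re_le_Cmod.
  - apply is_lim_seq_ext with (1 := fun n => eq_sym (Im_Cpartial_sum f n)).
    apply is_lim_partial_sum. apply (ex_series_le (fun k => Im (f k)) g); [|exact Hg].
    intros n. apply Rle_trans with (2 := Hf n). apply Im_le_Cmod.
Qed.

Section Transfer.
Context (a b : nat -> R).
Hypothesis hb : forall n, 0 < b n.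

Definition p_zero n := Re (poly_p a b n 0).
Definition q_zero n := Re (poly_q a b n 0).

Lemma jacobi_solution_real (u0 u1 : C) : Im u0 = 0 -> Im u1 = 0 -> forall n,
  jacobi_solution a b 0 u0 u1 n = RtoC (Re (jacobi_solution a b 0 u0 u1 n)).
Proof.
  intros H0 H1 n.
  cut (Im (jacobi_solution a b 0 u0 u1 n) = 0 /\ Im (jacobi_solution a b 0 u0 u1 (S n)) = 0).
  { intros [H _]. destruct (jacobi_solution a b 0 u0 u1 n) as [x y]. simpl in *. rewrite H. reflexivity. }
  induction n as [|n [I1 I2]]; [split; assumption|]. split; [assumption|].
  rewrite jacobi_solution_step. unfold Cdiv. rewrite <- RtoC_inv by (apply Rgt_not_eq, hb).
  destruct (jacobi_solution a b 0 u0 u1 n) as [x y].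
  destruct (jacobi_solution a b 0 u0 u1 (S n)) as [x' y']. simpl in *. rewrite I1, I2. ring.
Qed.

Lemma poly_p_zero n : poly_p a b n 0 = RtoC (p_zero n).
Proof.
  apply jacobi_solution_real; [reflexivity|].
  unfold Cdiv. rewrite <- RtoC_inv by (apply Rgt_not_eq, hb). simpl. ring.
Qed.

Lemma poly_q_zero n : poly_q a b n 0 = RtoC (q_zero n).
Proof.
  apply jacobi_solution_real; [reflexivity|].
  unfold Cdiv. rewrite <- RtoC_inv by (apply Rgt_not_eq, hb). simpl. ring.
Qed.

Lemma p_zero_0 : p_zero 0 = 1. Proof. reflexivity. Qed.
Lemma q_zero_0 : q_zero 0 = 0. Proof. reflexivity. Qed.

Lemma p_zero_1 : b 0%nat * p_zero 1 = - a 0%nat.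
Proof.
  unfold p_zero, poly_p; simpl jacobi_solution. unfold Cdiv. pose proof (hb 0).
  rewrite <- RtoC_inv by lra. simpl. field. lra.
Qed.

Lemma q_zero_1 : b 0%nat * q_zero 1 = 1.
Proof.
  unfold q_zero, poly_q; simpl jacobi_solution. unfold Cdiv. pose proof (hb 0).
  rewrite <- RtoC_inv by lra. simpl. field. lra.
Qed.

Lemma p_zero_rec n : b (S n) * p_zero (S (S n)) + a (S n) * p_zero (S n) + b n * p_zero n = 0.
Proof.
  apply RtoC_inj. rewrite 2!RtoC_plus, 3!RtoC_mult, <- !poly_p_zero.
  unfold poly_p. rewrite jacobi_solution_step. field. apply RtoC_neq0, Rgt_not_eq, hb.
Qed.

Lemma q_zero_rec n : b (S n) * q_zero (S (S n)) + a (S n) * q_zero (S n) + b n * q_zero n = 0.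
Proof.
  apply RtoC_inj. rewrite 2!RtoC_plus, 3!RtoC_mult, <- !poly_q_zero.
  unfold poly_q. rewrite jacobi_solution_step. field. apply RtoC_neq0, Rgt_not_eq, hb.
Qed.

(** b_n times the Wronskian of two solutions does not depend on n, by the symmetry of
    the matrix. *)
Lemma wronskian n : b n * (p_zero n * q_zero (S n) - p_zero (S n) * q_zero n) = 1.
Proof.
  induction n as [|n IH].
  - rewrite p_zero_0, q_zero_0. pose proof q_zero_1. lra.
  - pose proof (p_zero_rec n). pose proof (q_zero_rec n).
    replace (b (S n) * (p_zero (S n) * q_zero (S (S n)) - p_zero (S (S n)) * q_zero (S n)))
     with (p_zero (S n) * (b (S n) * q_zero (S (S n)) + a (S n) * q_zero (S n) + b n * q_zero n)
           - q_zero (S n) * (b (S n) * p_zero (S (S n)) + a (S n) * p_zero (S n) + b n * p_zero n)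
           + b n * (p_zero n * q_zero (S n) - p_zero (S n) * q_zero n)) by ring.
    rewrite H, H0, IH. ring.
Qed.

Section Solution.
Context (z : C) (u : nat -> C).
Hypothesis Hu : forall n,
  u (S (S n)) = (((z - a (S n)) * u (S n) - b n * u n) / b (S n))%C.

(** Minus the coefficient of p(0), and below the coefficient of q(0), in the expansion
    of u that matches u_n and, for n >= 1, u_{n-1}.  For u = p(z) these are the
    truncations of the series of B and D, for u = q(z) those of A and C. *)
Definition coef_p n : C := (- u 0%nat + z * Cpartial_sum (fun k => q_zero k * u k) n)%C.
Definition coef_q n : C :=
  ((b 0%nat * u 1%nat - (z - a 0%nat) * u 0%nat) + z * Cpartial_sum (fun k => p_zero k * u k) n)%C.
Definition coef_p_lim : C := (- u 0%nat + z * CSeries (fun k => q_zero k * u k))%C.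
Definition coef_q_lim : C :=
  ((b 0%nat * u 1%nat - (z - a 0%nat) * u 0%nat) + z * CSeries (fun k => p_zero k * u k))%C.

Lemma coef_p_lim_eq : coef_p_lim = (coef_p 0 + z * CSeries (fun k => q_zero k * u k))%C.
Proof. unfold coef_p_lim, coef_p; simpl. ring. Qed.
Lemma coef_q_lim_eq : coef_q_lim = (coef_q 0 + z * CSeries (fun k => p_zero k * u k))%C.
Proof. unfold coef_q_lim, coef_q; simpl. ring. Qed.

Lemma coef_p_S n : coef_p (S n) = (coef_p n + z * (q_zero n * u n))%C.
Proof. unfold coef_p; simpl. ring. Qed.
Lemma coef_q_S n : coef_q (S n) = (coef_q n + z * (p_zero n * u n))%C.
Proof. unfold coef_q; simpl. ring. Qed.

(** Both coefficients change by the value of z u_n against the other basis solution;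
    the change is invisible at n, and at n + 1 it contributes z u_n times the
    Wronskian, which is 1. *)
Lemma variation_of_constants n : u n = (- coef_p n * p_zero n + coef_q n * q_zero n)%C.
Proof.
  cut (u n = (- coef_p n * p_zero n + coef_q n * q_zero n)%C /\ u (S n) = (- coef_p (S n) * p_zero (S n) + coef_q (S n) * q_zero (S n))%C); [tauto|].
  induction n as [|n [I1 I2]].
  - split.
    + unfold coef_p, coef_q. rewrite p_zero_0, q_zero_0. simpl. ring.
    + unfold coef_p, coef_q. simpl Cpartial_sum. rewrite p_zero_0, q_zero_0.
      pose proof (RtoC_neq0 (b 0%nat) (Rgt_not_eq _ _ (hb 0))) as Hb.
      pose proof (f_equal RtoC p_zero_1) as H1. pose proof (f_equal RtoC q_zero_1) as H2.
      rewrite RtoC_mult in H1, H2. rewrite RtoC_opp in H1.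
      assert (H1' : RtoC (p_zero 1) = (- a 0%nat / b 0%nat)%C) by (rewrite <- H1; field; exact Hb).
      assert (H2' : RtoC (q_zero 1) = (1 / b 0%nat)%C) by (rewrite <- H2; field; exact Hb).
      rewrite H1', H2'. field. exact Hb.
  - split; [exact I2|]. rewrite Hu.
    pose proof (RtoC_neq0 (b (S n)) (Rgt_not_eq _ _ (hb (S n)))) as Hb.
    replace (- coef_p (S (S n)) * p_zero (S (S n)) + coef_q (S (S n)) * q_zero (S (S n)))%C with
      ((- coef_p (S n) * (b (S n) * p_zero (S (S n)))%R + coef_q (S n) * (b (S n) * q_zero (S (S n)))%R
       + z * u (S n) * (b (S n) * (p_zero (S n) * q_zero (S (S n)) - p_zero (S (S n)) * q_zero (S n)))%R) / b (S n))%C.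
    2:{ rewrite (coef_p_S (S n)), (coef_q_S (S n)). rewrite !RtoC_mult, RtoC_minus, !RtoC_mult. field. exact Hb. }
    rewrite wronskian.
    replace (b (S n) * p_zero (S (S n))) with (- a (S n) * p_zero (S n) - b n * p_zero n) by (pose proof (p_zero_rec n); lra).
    replace (b (S n) * q_zero (S (S n))) with (- a (S n) * q_zero (S n) - b n * q_zero n) by (pose proof (q_zero_rec n); lra).
    f_equal. rewrite !RtoC_minus, !RtoC_mult, !RtoC_opp.
    replace (u n) with (- coef_p (S n) * p_zero n + coef_q (S n) * q_zero n)%C
      by (rewrite coef_p_S, coef_q_S; rewrite I1 at 3; ring).
    rewrite I2. ring.
Qed.

(** Each coefficient moves by |z| |u_n| times a value of p(0) or q(0), and u_n is
    itself bounded by the coefficients.  Useful where p(0) and q(0) are small, that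
    is, for large n. *)
Lemma coef_growth n : Cmod (coef_p (S n)) + Cmod (coef_q (S n)) <=
  (Cmod (coef_p n) + Cmod (coef_q n)) * (1 + Cmod z * (Rabs (p_zero n) + Rabs (q_zero n)) ^ 2).
Proof.
  assert (H : Cmod (u n) <= (Cmod (coef_p n) + Cmod (coef_q n)) * (Rabs (p_zero n) + Rabs (q_zero n))).
  { rewrite variation_of_constants at 1. apply Rle_trans with (1 := Cmod_triangle _ _).
    rewrite !Cmod_mult, Cmod_opp, !Cmod_R.
    pose proof (Cmod_ge_0 (coef_p n)). pose proof (Cmod_ge_0 (coef_q n)).
    pose proof (Rabs_pos (p_zero n)). pose proof (Rabs_pos (q_zero n)). nra. }
  rewrite coef_p_S, coef_q_S.
  pose proof (Cmod_triangle (coef_p n) (z * (q_zero n * u n))) as H1.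
  pose proof (Cmod_triangle (coef_q n) (z * (p_zero n * u n))) as H2.
  rewrite !Cmod_mult, Cmod_R in H1, H2.
  pose proof (Rabs_pos (p_zero n)) as P1. pose proof (Rabs_pos (q_zero n)) as P2. pose proof (Cmod_ge_0 z) as P3.
  assert (H3 : Cmod z * (Rabs (p_zero n) + Rabs (q_zero n)) * Cmod (u n) <=
    Cmod z * (Rabs (p_zero n) + Rabs (q_zero n)) * ((Cmod (coef_p n) + Cmod (coef_q n)) * (Rabs (p_zero n) + Rabs (q_zero n)))).
  { apply Rmult_le_compat_l; [nra|exact H]. }
  lra.
Qed.

(** Since p(0) and q(0) are real, Im(conj(coef_p) coef_q) is the Wronskian of u with
    its conjugate up to a constant factor; for non-real z it is monotone in n. *)
Lemma coef_wronskian n : Im (Cconj (coef_p n) * coef_q n) =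
  Im (Cconj (coef_p 0) * coef_q 0) - Im z * partial_sum (fun k => Cmod (u k) ^ 2) n.
Proof.
  induction n as [|n IH]; [simpl; ring|].
  cbn [partial_sum]. rewrite Rmult_plus_distr_l.
  replace (Im (Cconj (coef_p 0) * coef_q 0) - (Im z * partial_sum (fun k : nat => Cmod (u k) ^ 2) n + Im z * Cmod (u n) ^ 2))
    with (Im (Cconj (coef_p n) * coef_q n) - Im z * Cmod (u n) ^ 2) by (rewrite IH; ring).
  rewrite coef_p_S, coef_q_S. rewrite (variation_of_constants n).
  destruct (coef_p n) as [X1 X2]. destruct (coef_q n) as [Y1 Y2]. destruct z as [z1 z2].
  unfold Cmod. rewrite pow2_sqrt.
  2:{ apply Rplus_le_le_0_compat; apply pow2_ge_0. }
  simpl. ring.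
Qed.

Lemma coef_bounded (m : nat -> R) : ex_series m ->
  (forall n, (Rabs (p_zero n) + Rabs (q_zero n)) ^ 2 <= m n) ->
  exists M, forall n, Cmod (coef_p n) + Cmod (coef_q n) <= M.
Proof.
  intros Hm Hle.
  assert (Pm : forall n, 0 <= m n) by (intros n; apply Rle_trans with (2 := Hle n); apply pow2_ge_0).
  exists ((Cmod (coef_p 0) + Cmod (coef_q 0)) * exp (Cmod z * Series m)). intros n.
  pose proof (Cmod_ge_0 z) as P3.
  apply Rle_trans with ((Cmod (coef_p 0) + Cmod (coef_q 0)) * exp (Cmod z * partial_sum m n - Cmod z * partial_sum m 0)).
  - apply (gronwall (fun n => Cmod (coef_p n) + Cmod (coef_q n)) (fun n => Cmod z * partial_sum m n) 0); [lia|].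
    intros k _. apply Rle_trans with (1 := coef_growth k).
    apply Rmult_le_compat_l.
    + pose proof (Cmod_ge_0 (coef_p k)). pose proof (Cmod_ge_0 (coef_q k)). lra.
    + apply Rle_trans with (2 := exp_ineq1_le _). simpl partial_sum. specialize (Hle k). nra.
  - apply Rmult_le_compat_l.
    + pose proof (Cmod_ge_0 (coef_p 0)). pose proof (Cmod_ge_0 (coef_q 0)). lra.
    + pose proof (partial_sum_le_Series m Pm Hm n). simpl.
      apply exp_le. nra.
Qed.

Lemma coef_limits (m : nat -> R) : ex_series m ->
  (forall n, (Rabs (p_zero n) + Rabs (q_zero n)) ^ 2 <= m n) ->
  climit coef_p coef_p_lim /\ climit coef_q coef_q_lim.
Proof.
  intros Hm Hle. destruct (coef_bounded m Hm Hle) as [M HM].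
  assert (PM : 0 <= M) by (pose proof (HM 0%nat); pose proof (Cmod_ge_0 (coef_p 0)); pose proof (Cmod_ge_0 (coef_q 0)); lra).
  assert (H : forall n, Cmod (u n) <= M * (Rabs (p_zero n) + Rabs (q_zero n))).
  { intros n. rewrite variation_of_constants at 1. apply Rle_trans with (1 := Cmod_triangle _ _).
    rewrite !Cmod_mult, Cmod_opp, !Cmod_R. specialize (HM n).
    pose proof (Cmod_ge_0 (coef_p n)). pose proof (Cmod_ge_0 (coef_q n)).
    pose proof (Rabs_pos (p_zero n)). pose proof (Rabs_pos (q_zero n)). nra. }
  assert (Hex : ex_series (fun n => M * m n)) by (apply (ex_series_scal M m Hm)).
  split; apply climit_affine; apply climit_CSeries with (2 := Hex); intros k;
    rewrite Cmod_mult, Cmod_R; specialize (H k); specialize (Hle k);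
    pose proof (Rabs_pos (p_zero k)); pose proof (Rabs_pos (q_zero k)); pose proof (Cmod_ge_0 (u k)).
  - apply Rle_trans with ((Rabs (p_zero k) + Rabs (q_zero k)) * (M * (Rabs (p_zero k) + Rabs (q_zero k)))); nra.
  - apply Rle_trans with ((Rabs (p_zero k) + Rabs (q_zero k)) * (M * (Rabs (p_zero k) + Rabs (q_zero k)))); nra.
Qed.

End Solution.
End Transfer.

(** * Growth before the turning point *)

Section BeforeTurningPoint.
Context (al b : nat -> R) (x0 c be : R) (h e : nat -> R).
Hypothesis Hcr : critical al b x0 c be h e.

(** T and W stand for the weighted sizes of u and w.  Each of the two updates couples
    them by a factor th or k. *)
Lemma weighted_step (T W T' W' th k q : R) :
  0 <= T -> 0 <= W -> 0 <= th -> 0 <= k -> 0 <= q ->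
  W' <= W + th * T -> T' <= T * (1 + q) + k * W' ->
  T' + W' <= (T + W) * exp (k + q + th).
Proof.
  intros HT HW Hth Hk Hq H1 H2.
  apply Rle_trans with ((T + W) * ((1 + k) * (1 + (q + th)))).
  - assert (k * W' <= k * (W + th * T)) by (apply Rmult_le_compat_l; lra).
    assert (0 <= T * q) by nra. assert (0 <= W * q) by nra.
    assert (0 <= W * th) by nra.
    assert (0 <= k * T) by nra. assert (0 <= k * (T * q)) by nra.
    assert (0 <= k * (W * q)) by nra. assert (0 <= k * (W * th)) by nra. nra.
  - apply Rmult_le_compat_l; [lra|]. replace (k + q + th) with (k + (q + th)) by ring.
    rewrite exp_plus. apply Rmult_le_compat; try lra; apply exp_ineq1_le.
Qed.

(** Weight u by (|z| b_n)^(1/2), with n^be in place of b_n.  Then the two updates of a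
    step each add at most a multiple of (|z|/b_n)^(1/2), up to summable errors and the
    logarithmic growth of the weight.  The sum of |z|^(1/2) n^(-be/2) up to N is of
    order N^(1/2) when |z| ~ N^(be-1). *)
Lemma bound_before_turning_point : exists K, 0 < K /\
  forall (z : C) (u : nat -> C) (N : nat),
  1 <= Cmod z -> Cmod z <= Rpower (INR N) (be - 1) -> Rpower (INR N) (be - 1) <= 4 * Cmod z ->
  (forall n, (1 <= n)%nat ->
     (b n * u (S n) + al n * u n + b (pred n) * u (pred n) = z * u n)%C) ->
  forall n, (1 <= n <= N)%nat ->
    Cmod (u n) <= (sqrt (Cmod z) * Cmod (u 1%nat) + b 0%nat * Cmod (u 1%nat - u 0%nat)) * exp (K * sqrt (INR N)).
Proof.
  pose proof (cr_x0 _ _ _ _ _ _ _ Hcr) as Px0. pose proof (cr_c _ _ _ _ _ _ _ Hcr) as Pc.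
  pose proof (cr_be _ _ _ _ _ _ _ Hcr) as Pbe.
  destruct (offdiag_lower _ _ _ _ _ _ _ Hcr) as [Kb [PKb HKb]].
  destruct (Rpower_diff1 (be / 2)) as [K2 [PK2 HK2]].
  set (K3 := (1 + K2) / Kb). set (K4 := 1 + 4 * x0 * c).
  assert (PK3 : 0 < K3) by (unfold K3; apply Rdiv_lt_0_compat; lra).
  assert (PK4 : 0 < K4) by (unfold K4; nra).
  set (en := fun n => Rpower (INR (S n)) (- (be - 1 / 2)) * Rabs (e (S n))).
  assert (Pen : forall n, 0 <= en n).
  { intros n. unfold en. apply Rmult_le_pos; [apply Rlt_le, Rpower_pos|apply Rabs_pos]. }
  set (C1 := Rpower 2 (be / 2) / (1 - be / 2)).
  set (C2 := Rpower 2 (1 / 2) / (1 - 1 / 2)).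
  assert (PC1 : 0 < C1) by (unfold C1; apply Rdiv_lt_0_compat; [apply Rpower_pos|lra]).
  assert (PC2 : 0 < C2) by (unfold C2; apply Rdiv_lt_0_compat; [apply Rpower_pos|lra]).
  pose proof (cr_e _ _ _ _ _ _ _ Hcr) as Hex. fold en in Hex.
  assert (PSe : 0 <= Series en) by (pose proof (partial_sum_le_Series en Pen Hex 0); assumption).
  exists ((K3 + K4) * C1 + K2 * C2 + 2 * Series en). split.
  { pose proof (Rmult_lt_0_compat (K3 + K4) C1 ltac:(lra) PC1). pose proof (Rmult_lt_0_compat _ _ PK2 PC2). lra. }
  intros z u N Hr1 HrN HNr Hu n Hn. set (r := Cmod z) in *.
  pose proof (INR_ge1 N ltac:(lia)) as PN.
  assert (Psr : 1 <= sqrt r) by (rewrite <- sqrt_1; apply sqrt_le_1_alt; exact Hr1).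
  assert (Hsr : sqrt r * sqrt r = r) by (apply sqrt_sqrt; lra).
  set (w := fun n => (b (pred n) * (u n - u (pred n)))%C).
  set (T := fun n => sqrt r * Rpower (INR n) (be / 2) * Cmod (u n)).
  (* primitives of the three contributions: WKB rate, change of weight, perturbation *)
  set (Th := fun n => (K3 + K4) * C1 * sqrt r * Rpower (INR n) (1 - be / 2)
      + K2 * C2 * Rpower (INR n) (1 - 1 / 2) + 2 * partial_sum en (pred n)).
  assert (PT : forall n, 0 <= T n).
  { intros k. unfold T. apply Rmult_le_pos; [|apply Cmod_ge_0].
    apply Rmult_le_pos; [lra|apply Rlt_le, Rpower_pos]. }
  assert (Hstep : forall k, (1 <= k < n)%nat ->
     T (S k) + Cmod (w (S k)) <= (T k + Cmod (w k)) * exp (Th (S k) - Th k)).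
  { intros k Hk. pose proof (INR_ge1 k ltac:(lia)) as Pk.
    set (ka := sqrt r * Rpower (INR k) (- (be / 2))).
    assert (Pka : 0 < ka) by (unfold ka; apply Rmult_lt_0_compat; [lra|apply Rpower_pos]).
    pose proof (cr_pos _ _ _ _ _ _ _ Hcr k) as Pb.
    set (X := Rpower (INR k) (be / 2)).
    assert (PX : 0 < X) by apply Rpower_pos.
    assert (HX : Rpower (INR k) (- (be / 2)) = / X) by (unfold X; apply Rpower_Ropp).
    assert (HXX : Rpower (INR k) be = X * X) by (unfold X; rewrite <- Rpower_plus; f_equal; field).
    apply Rle_trans with ((T k + Cmod (w k)) *
       exp (K3 * ka + K2 * Rpower (INR k) (-1) + (K4 * ka + 2 * en (pred k)))).
    - apply weighted_step; auto.
      + apply Cmod_ge_0.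
      + specialize (Pen (pred k)). nra.
      + nra.
      + pose proof (Rpower_pos (INR k) (-1)). nra.
      + (* the update of w: up to a constant |z| dominates the regular part of the row
           sum because k <= N *)
        assert (Hw : w (S k) = (w k + (z - RtoC (x0 * c * Rpower (INR k) (be - 1) + e k)) * u k)%C).
        { rewrite <- (cr_row _ _ _ _ _ _ _ Hcr k ltac:(lia)). unfold w. simpl pred.
          rewrite !RtoC_plus.           replace ((z - (al k + b k + b (pred k))) * u k)%C
            with (z * u k - (al k + b k + b (pred k)) * u k)%C by ring.
          rewrite <- (Hu k ltac:(lia)). ring. }
        rewrite Hw. apply Rle_trans with (1 := Cmod_triangle _ _). apply Rplus_le_compat_l.
        rewrite Cmod_mult.
        assert (H1 : Cmod (z - RtoC (x0 * c * Rpower (INR k) (be - 1) + e k)) <=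
                 r + x0 * c * Rpower (INR k) (be - 1) + Rabs (e k)).
        { unfold Cminus. apply Rle_trans with (1 := Cmod_triangle _ _). rewrite Cmod_opp, Cmod_R. fold r.
          pose proof (Rabs_triang (x0 * c * Rpower (INR k) (be - 1)) (e k)) as H2.
          rewrite (Rabs_right (x0 * c * Rpower (INR k) (be - 1))) in H2.
          - lra.
          - apply Rle_ge. apply Rmult_le_pos; [nra|apply Rlt_le, Rpower_pos]. }
        assert (H2 : Rpower (INR k) (be - 1) <= 4 * r).
        { apply Rle_trans with (2 := HNr). apply Rpower_le_base; [lra|lra|apply le_INR; lia]. }
        assert (H3 : r + x0 * c * Rpower (INR k) (be - 1) <= K4 * r).
        { unfold K4. assert (x0 * c * Rpower (INR k) (be - 1) <= x0 * c * (4 * r)) by (apply Rmult_le_compat_l; nra). lra. }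
        assert (H4 : K4 * r = K4 * ka * (sqrt r * X)).
        { unfold ka. rewrite HX. rewrite <- Hsr at 1. field. lra. }
        assert (H5 : Rabs (e k) <= 2 * en (pred k) * (sqrt r * X)).
        { unfold en. replace (S (pred k)) with k by lia.
          assert (H6 : X * (2 * sqrt r) >= Rpower (INR k) (be - 1 / 2)).
          { replace (Rpower (INR k) (be - 1 / 2)) with (X * Rpower (INR k) ((be - 1) / 2))
              by (unfold X; rewrite <- Rpower_plus; f_equal; field).
            apply Rle_ge. apply Rmult_le_compat_l; [lra|].
            replace (2 * sqrt r) with (sqrt (4 * r)).
            2:{ rewrite sqrt_mult by lra. f_equal. replace 4 with (2 * 2) by ring. apply sqrt_square; lra. }
            replace (Rpower (INR k) ((be - 1) / 2)) with (sqrt (Rpower (INR k) (be - 1))).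
            - apply sqrt_le_1_alt, H2.
            - rewrite <- Rpower_sqrt by apply Rpower_pos. rewrite Rpower_mult. f_equal; field. }
          replace (2 * (Rpower (INR k) (- (be - 1 / 2)) * Rabs (e k)) * (sqrt r * X))
            with (Rabs (e k) * (Rpower (INR k) (- (be - 1 / 2)) * (X * (2 * sqrt r)))) by ring.
          rewrite <- (Rmult_1_r (Rabs (e k))) at 1. apply Rmult_le_compat_l; [apply Rabs_pos|].
          apply Rle_trans with (Rpower (INR k) (- (be - 1 / 2)) * Rpower (INR k) (be - 1 / 2)).
          - rewrite <- Rpower_plus, Rplus_opp_l, Rpower_O by lra. lra.
          - apply Rmult_le_compat_l; [apply Rlt_le, Rpower_pos|lra]. }
        unfold T. fold X.
        replace ((K4 * ka + 2 * en (pred k)) * (sqrt r * X * Cmod (u k))) with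
          ((K4 * ka * (sqrt r * X) + 2 * en (pred k) * (sqrt r * X)) * Cmod (u k)) by ring.
        apply Rmult_le_compat_r; [apply Cmod_ge_0|]. rewrite <- H4. lra.
      + (* the update of u: here the weight changes as well *)
        assert (Hu1 : u (S k) = (u k + w (S k) / b k)%C).
        { unfold w. simpl pred. field. intros E. apply RtoC_inj in E. lra. }
        assert (Hc : Cmod (u (S k)) <= Cmod (u k) + Cmod (w (S k)) / b k).
        { rewrite Hu1 at 1. apply Rle_trans with (1 := Cmod_triangle _ _). apply Rplus_le_compat_l.
          unfold Cdiv. rewrite <- RtoC_inv by lra. rewrite Cmod_mult, Cmod_R.
          rewrite Rabs_right by (apply Rgt_ge, Rinv_0_lt_compat, Pb). unfold Rdiv; lra. }
        assert (HS : Rpower (INR (S k)) (be / 2) <= X * (1 + K2 * Rpower (INR k) (-1))).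
        { pose proof (HK2 (INR k) (INR (S k)) Pk ltac:(rewrite S_INR; lra)) as H1.
          pose proof (RRle_abs (Rpower (INR (S k)) (be / 2) - Rpower (INR k) (be / 2))) as H2.
          replace (Rpower (INR k) (be / 2 - 1)) with (X * Rpower (INR k) (-1)) in H1
            by (unfold X; rewrite <- Rpower_plus; f_equal; ring).
          unfold X in *. lra. }
        assert (Hq : Rpower (INR k) (-1) <= 1).
        { apply Rpower_le_1; lra. }
        pose proof (Rpower_pos (INR k) (-1)) as Pq.
        unfold T at 1. set (q := K2 * Rpower (INR k) (-1)) in *.
        assert (0 <= q <= K2) by (unfold q; nra).
        pose proof (Cmod_ge_0 (w (S k))) as Pw. pose proof (Cmod_ge_0 (u k)) as Pu.
        apply Rle_trans with (sqrt r * (X * (1 + q)) * (Cmod (u k) + Cmod (w (S k)) / b k)).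
        { apply Rmult_le_compat; [|apply Cmod_ge_0| |exact Hc].
          - apply Rmult_le_pos; [lra|apply Rlt_le, Rpower_pos].
          - apply Rmult_le_compat_l; [lra|exact HS]. }
        rewrite Rmult_plus_distr_l. apply Rplus_le_compat.
        { unfold T. fold X. right; ring. }
        apply Rle_trans with (sqrt r * (X * (1 + K2)) * (Cmod (w (S k)) / (Kb * (X * X)))).
        { apply Rmult_le_compat.
          - apply Rmult_le_pos; [lra|]. apply Rmult_le_pos; lra.
          - apply Rdiv_le_0_compat; lra.
          - apply Rmult_le_compat_l; [lra|]. apply Rmult_le_compat_l; lra.
          - apply Rmult_le_compat_l; [exact Pw|]. apply Rinv_le_contravar.
            + apply Rmult_lt_0_compat; nra.
            + rewrite <- HXX. apply HKb; lia. }
        right. unfold K3, ka. rewrite HX. field. split; lra.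
    - apply Rmult_le_compat_l; [pose proof (PT k); pose proof (Cmod_ge_0 (w k)); lra|].
      apply exp_le.
      pose proof (Rpower_primitive (be / 2) ltac:(lra) ltac:(lra) k ltac:(lia)) as H1. fold C1 in H1.
      pose proof (Rpower_primitive (1 / 2) ltac:(lra) ltac:(lra) k ltac:(lia)) as H2. fold C2 in H2.
      assert (H3 : Rpower (INR k) (-1) <= Rpower (INR k) (- (1 / 2))) by (apply Rle_Rpower; lra).
      assert (H4 : partial_sum en (pred (S k)) = partial_sum en (pred k) + en (pred k)) by (destruct k; [lia|reflexivity]).
      unfold Th. rewrite H4.
      assert (H5 : (K3 + K4) * ka <= (K3 + K4) * C1 * sqrt r * (Rpower (INR (S k)) (1 - be / 2) - Rpower (INR k) (1 - be / 2))).
      { unfold ka. replace ((K3 + K4) * C1 * sqrt r * (Rpower (INR (S k)) (1 - be / 2) - Rpower (INR k) (1 - be / 2)))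
          with ((K3 + K4) * (sqrt r * (C1 * (Rpower (INR (S k)) (1 - be / 2) - Rpower (INR k) (1 - be / 2))))) by ring.
        apply Rmult_le_compat_l; [lra|]. apply Rmult_le_compat_l; [lra|exact H1]. }
      assert (H6 : K2 * Rpower (INR k) (-1) <= K2 * C2 * (Rpower (INR (S k)) (1 - 1 / 2) - Rpower (INR k) (1 - 1 / 2))).
      { rewrite Rmult_assoc. apply Rmult_le_compat_l; lra. }
      lra. }
  pose proof (gronwall (fun k => T k + Cmod (w k)) Th 1 n ltac:(lia) Hstep) as HG. cbv beta in HG.
  assert (Pn : 1 <= INR n <= INR N) by (split; [apply INR_ge1; lia|apply le_INR; lia]).
  apply Rle_trans with (T n + Cmod (w n)).
  { pose proof (Cmod_ge_0 (w n)). pose proof (Cmod_ge_0 (u n)).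
    assert (1 <= Rpower (INR n) (be / 2)) by (apply Rpower_ge_1; lra).
    unfold T. assert (1 <= sqrt r * Rpower (INR n) (be / 2)) by nra. nra. }
  apply Rle_trans with (1 := HG).
  assert (HF : T 1%nat + Cmod (w 1%nat) = sqrt r * Cmod (u 1%nat) + b 0%nat * Cmod (u 1%nat - u 0%nat)).
  { unfold T, w. simpl pred. simpl INR. rewrite Cmod_mult, Cmod_R.
    rewrite (Rabs_right (b 0%nat)) by (apply Rgt_ge, (cr_pos _ _ _ _ _ _ _ Hcr)).
    unfold Rpower. rewrite ln_1, Rmult_0_r, exp_0. ring. }
  rewrite HF. apply Rmult_le_compat_l.
  { rewrite <- HF. pose proof (PT 1%nat). pose proof (Cmod_ge_0 (w 1%nat)). lra. }
  apply exp_le.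
  assert (HsN : sqrt (INR N) = Rpower (INR N) (1 / 2)) by (rewrite <- Rpower_sqrt by lra; f_equal; field).
  assert (Q1 : sqrt r * Rpower (INR n) (1 - be / 2) <= sqrt (INR N)).
  { apply Rle_trans with (Rpower (INR N) ((be - 1) / 2) * Rpower (INR N) (1 - be / 2)).
    - apply Rmult_le_compat; [lra|apply Rlt_le, Rpower_pos| |apply Rpower_le_base; lra].
      replace (Rpower (INR N) ((be - 1) / 2)) with (sqrt (Rpower (INR N) (be - 1))).
      + apply sqrt_le_1_alt, HrN.
      + rewrite <- Rpower_sqrt by apply Rpower_pos. rewrite Rpower_mult. f_equal; field.
    - rewrite <- Rpower_plus, HsN. right. f_equal. field. }
  assert (Q2 : Rpower (INR n) (1 - 1 / 2) <= sqrt (INR N)).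
  { rewrite HsN. replace (1 - 1 / 2) with (1 / 2) by field. apply Rpower_le_base; lra. }
  assert (Q3 : 2 * partial_sum en (pred n) <= 2 * Series en * sqrt (INR N)).
  { pose proof (partial_sum_le_Series en Pen Hex (pred n)).
    assert (1 <= sqrt (INR N)) by (rewrite <- sqrt_1; apply sqrt_le_1_alt; exact PN). nra. }
  assert (Q4 : 0 <= Th 1%nat).
  { unfold Th. simpl partial_sum. pose proof (Rpower_pos (INR 1) (1 - be / 2)). pose proof (Rpower_pos (INR 1) (1 - 1 / 2)).
    assert (0 <= (K3 + K4) * C1 * sqrt r) by (apply Rmult_le_pos; [apply Rmult_le_pos|]; lra).
    assert (0 <= K2 * C2) by (apply Rmult_le_pos; lra). nra. }
  assert (Q5 : (K3 + K4) * C1 * sqrt r * Rpower (INR n) (1 - be / 2) <= (K3 + K4) * C1 * sqrt (INR N)).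
  { rewrite (Rmult_assoc _ (sqrt r)). apply Rmult_le_compat_l; [|exact Q1]. apply Rmult_le_pos; lra. }
  assert (Q6 : K2 * C2 * Rpower (INR n) (1 - 1 / 2) <= K2 * C2 * sqrt (INR N)).
  { apply Rmult_le_compat_l; [nra|exact Q2]. }
  unfold Th at 1. lra.
Qed.
End BeforeTurningPoint.

(** * Growth at an imaginary spectral parameter *)

(** Re(conj(u) w) + Im(conj(u) w) + g |u|^2.  The last term is a gauge: changing w to
    w + g u shifts the real part of conj(u) w by g |u|^2. *)
Definition flux (u w : C) (g : R) : R :=
  Re u * Re w + Im u * Im w + (Re u * Im w - Im u * Re w) + g * (Re u ^ 2 + Im u ^ 2).

(** At z = i r the imaginary part of conj(u) w gains r |u|^2 and the real part gains
    |w'|^2/b - Q |u|^2.  The part e of Q, which need not be small pointwise, is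
    compensated by the change of gauge from g to g + e; this leaves g' times the
    change of |u|^2, which the gain dominates as g' is small against both b and
    (r b)^(1/2). *)
Lemma flux_step (u w u' w' : C) (b r s e g g' : R) :
  0 < b -> 0 < r -> s <= r / 4 -> Rabs g' <= b / 4 -> 64 * g' ^ 2 <= r * b ->
  g' = g + e ->
  u' = (u + w' / b)%C -> w' = (w + ((0, r) - RtoC (s + e)) * u)%C ->
  flux u w g + / 2 * (Cmod w' ^ 2 / b + r * Cmod u ^ 2) <= flux u' w' g'.
Proof.
  intros Hb Hr Hs Hg1 Hg2 Hg Hu' Hw'. rewrite !Cmod2_alt.
  destruct u as [p q], w' as [m l], w as [mw lw].
  assert (Hm : mw = m - (r * - q - (s + e) * p)) by (injection Hw'; intros; simpl in *; lra).
  assert (Hl : lw = l - (r * p - (s + e) * q)) by (injection Hw'; intros; simpl in *; lra).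
  assert (Hup : u' = (p + m / b, q + l / b)).
  { rewrite Hu'. unfold Cdiv. rewrite <- RtoC_inv by lra. unfold Cplus, Cmult, RtoC; simpl. f_equal; field; lra. }
  rewrite Hup. unfold flux; simpl Re; simpl Im. rewrite Hm, Hl. clear Hw' Hu' Hup Hm Hl u' mw lw.
  assert (HG : - (b / 4) <= g' <= b / 4) by (split; pose proof (RRle_abs g'); pose proof (Rabs_maj2 g'); lra).
  apply (Rmult_le_reg_r b); [exact Hb|].
  assert (A0 : 0 <= m ^ 2 + l ^ 2) by (pose proof (pow2_ge_0 m); pose proof (pow2_ge_0 l); lra).
  assert (A1 : 0 <= p ^ 2 + q ^ 2) by (pose proof (pow2_ge_0 p); pose proof (pow2_ge_0 q); lra).
  assert (A2 : 0 <= (m + 8 * g' * p) ^ 2 + (l + 8 * g' * q) ^ 2)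
    by (pose proof (pow2_ge_0 (m + 8 * g' * p)); pose proof (pow2_ge_0 (l + 8 * g' * q)); lra).
  assert (A3 : 0 <= (r * b - 64 * g' ^ 2) * (p ^ 2 + q ^ 2)) by (apply Rmult_le_pos; lra).
  assert (A4 : 0 <= (r / 4 - s) * b * (p ^ 2 + q ^ 2)) by (apply Rmult_le_pos; [apply Rmult_le_pos|]; lra).
  assert (A5 : 0 <= (b / 4 + g') / b * (m ^ 2 + l ^ 2)) by (apply Rmult_le_pos; [apply Rdiv_le_0_compat|]; lra).
  assert (A6 : 0 <= r * b * (p ^ 2 + q ^ 2)) by (apply Rmult_le_pos; [apply Rmult_le_pos|]; lra).
  match goal with |- ?L <= ?R => cut (0 <= R - L); [lra|] end.
  subst g'.
  match goal with |- 0 <= ?D => replace D with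
    (/ 8 * ((m + 8 * (g + e) * p) ^ 2 + (l + 8 * (g + e) * q) ^ 2)
     + / 8 * ((r * b - 64 * (g + e) ^ 2) * (p ^ 2 + q ^ 2))
     + (r / 4 - s) * b * (p ^ 2 + q ^ 2)
     + (b / 4 + (g + e)) / b * (m ^ 2 + l ^ 2)
     + / 8 * (m ^ 2 + l ^ 2) + / 8 * (r * b * (p ^ 2 + q ^ 2))) by (field; lra) end.
  lra.
Qed.

(** The flux after the step is at most a multiple of (b/r)^(1/2) times the gain of the
    step, so it grows by a fraction of order (r/b)^(1/2).  The condition r <= b says
    that this fraction is at most of order one. *)
Lemma flux_upper (u w' u' : C) (b r g' la : R) :
  0 < b -> 0 < r -> r <= b -> 0 < la -> la ^ 2 = r * b -> 8 * Rabs g' <= la ->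
  u' = (u + w' / b)%C ->
  flux u' w' g' <= 3 * (la / r) * (Cmod w' ^ 2 / b + r * Cmod u ^ 2).
Proof.
  intros Hb Hr Hrb Hla Hla2 Hg Hu'. rewrite !Cmod2_alt.
  assert (Hup : Cmod u' ^ 2 <= 2 * Cmod u ^ 2 + 2 * Cmod w' ^ 2 / b ^ 2).
  { rewrite Hu', !Cmod2_alt. unfold Cdiv. rewrite <- RtoC_inv by lra.
    destruct u as [p q], w' as [m l]. simpl Re; simpl Im.
    pose proof (pow2_ge_0 (p - m / b)). pose proof (pow2_ge_0 (q - l / b)).
    match goal with |- ?L <= ?R => cut (0 <= R - L); [lra|] end.
    match goal with |- 0 <= ?D => replace D with ((p - m / b) ^ 2 + (q - l / b) ^ 2) by (field; lra) end. lra. }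
  rewrite !Cmod2_alt in Hup. clear Hu'.
  destruct u as [p q], w' as [m l], u' as [p' q']. unfold flux. simpl Re in *; simpl Im in *.
  set (U := p ^ 2 + q ^ 2) in *. set (W := m ^ 2 + l ^ 2) in *. set (V := p' ^ 2 + q' ^ 2) in *.
  assert (PU : 0 <= U) by (unfold U; pose proof (pow2_ge_0 p); pose proof (pow2_ge_0 q); lra).
  assert (PW : 0 <= W) by (unfold W; pose proof (pow2_ge_0 m); pose proof (pow2_ge_0 l); lra).
  assert (PV : 0 <= V) by (unfold V; pose proof (pow2_ge_0 p'); pose proof (pow2_ge_0 q'); lra).
  assert (H1 : p' * m + q' * l + (p' * l - q' * m) <= la * V + W / (2 * la)).
  { pose proof (pow2_ge_0 (2 * la * p' - m - l)). pose proof (pow2_ge_0 (2 * la * q' - l + m)).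
    apply (Rmult_le_reg_r (4 * la)); [lra|].
    replace ((la * V + W / (2 * la)) * (4 * la)) with (4 * la ^ 2 * V + 2 * W) by (field; lra).
    unfold V, W. lra. }
  assert (H2 : g' * V <= la / 8 * V) by (apply Rmult_le_compat_r; [exact PV|pose proof (RRle_abs g'); lra]).
  assert (H3 : la / b ^ 2 * W <= la / (r * b) * W).
  { apply Rmult_le_compat_r; [exact PW|]. apply Rmult_le_compat_l; [lra|].
    apply Rinv_le_contravar; [apply Rmult_lt_0_compat; lra|]. nra. }
  assert (H4 : W / (2 * la) = la / (r * b) * W / 2).
  { rewrite <- Hla2. field. lra. }
  assert (H5 : la * V <= la * (2 * U + 2 * W / b ^ 2)) by (apply Rmult_le_compat_l; lra).
  assert (H6 : la * (2 * U + 2 * W / b ^ 2) = 2 * la * U + 2 * (la / b ^ 2 * W)) by (field; lra).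
  replace (3 * (la / r) * (W / b + r * U)) with (3 * (la / (r * b) * W) + 3 * la * U) by (field; lra).
  assert (0 <= la * U) by nra. 
  assert (0 <= la / (r * b) * W) by (apply Rmult_le_pos; [apply Rdiv_le_0_compat; [lra|apply Rmult_lt_0_compat; lra]|exact PW]).
  lra.
Qed.

(** Converts the flux at the end of the growth region into values of the solution, at
    the price of a factor b that is negligible against the exponential growth. *)
Lemma flux_end (u u0 w : C) (b g : R) : 0 < b -> Rabs g <= b / 4 ->
  w = (b * (u - u0))%C -> flux u w g <= 4 * b * (Cmod u ^ 2 + Cmod u0 ^ 2).
Proof.
  intros Hb Hg ->. rewrite !Cmod2_alt. destruct u as [p q], u0 as [p0 q0]. unfold flux. simpl Re; simpl Im.
  set (U := p ^ 2 + q ^ 2).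
  assert (PU : 0 <= U) by (unfold U; pose proof (pow2_ge_0 p); pose proof (pow2_ge_0 q); lra).
  assert (H2 : g * U <= b / 4 * U) by (apply Rmult_le_compat_r; [exact PU|pose proof (RRle_abs g); lra]).
  unfold U in *.
  assert (0 <= b * ((p + p0) ^ 2 + (q + q0) ^ 2)) by (apply Rmult_le_pos; [lra|]; pose proof (pow2_ge_0 (p + p0)); pose proof (pow2_ge_0 (q + q0)); lra).
  assert (0 <= b * ((p + q0) ^ 2 + (q - p0) ^ 2)) by (apply Rmult_le_pos; [lra|]; pose proof (pow2_ge_0 (p + q0)); pose proof (pow2_ge_0 (q - p0)); lra).
  assert (0 <= b * (p0 ^ 2 + q0 ^ 2)) by (apply Rmult_le_pos; [lra|]; pose proof (pow2_ge_0 p0); pose proof (pow2_ge_0 q0); lra).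
  assert (0 <= b * ((p - p0) ^ 2 + (q - q0) ^ 2)) by (apply Rmult_le_pos; [lra|]; pose proof (pow2_ge_0 (p - p0)); pose proof (pow2_ge_0 (q - q0)); lra).
  assert (0 <= b * ((p - q0) ^ 2 + (q + p0) ^ 2)) by (apply Rmult_le_pos; [lra|]; pose proof (pow2_ge_0 (p - q0)); pose proof (pow2_ge_0 (q + p0)); lra).
  assert (0 <= b * (p ^ 2 + q ^ 2)) by (apply Rmult_le_pos; lra).
  lra.
Qed.

Lemma exp_half_le (x : R) : 0 <= x <= 1 -> exp (x / 2) <= 1 + x.
Proof.
  intros Hx. pose proof (exp_ineq1_le (- (x / 2))) as H. rewrite exp_Ropp in H.
  pose proof (exp_pos (x / 2)) as P.
  assert (H1 : exp (x / 2) * (1 - x / 2) <= 1).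
  { apply Rle_trans with (exp (x / 2) * / exp (x / 2)); [apply Rmult_le_compat_l; lra|rewrite Rinv_r; lra]. }
  apply (Rmult_le_reg_r (1 - x / 2)); [lra|]. nra.
Qed.

Lemma geometric_growth (f : nat -> R) (m k : nat) (x : R) :
  (forall j, (j < k)%nat -> exp x * f (m + j)%nat <= f (m + S j)%nat) ->
  exp (INR k * x) * f m <= f (m + k)%nat.
Proof.
  induction k as [|k IH]; intros H.
  - simpl INR. rewrite Rmult_0_l, exp_0, Nat.add_0_r. lra.
  - apply Rle_trans with (2 := H k ltac:(lia)).
    rewrite S_INR, Rmult_plus_distr_r, Rmult_1_l, exp_plus, (Rmult_comm (exp (INR k * x))), Rmult_assoc.
    apply Rmult_le_compat_l; [apply Rlt_le, exp_pos|]. apply IH. intros j Hj; apply H; lia.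
Qed.

(** With t = sqrt m, exp(c t) is the sixth power of exp(c t / 6) >= c t / 6, hence at
    least of order m^3. *)
Lemma square_le_exp_sqrt (c A : R) : 0 < c -> exists m0 : nat, forall m, (m0 <= m)%nat ->
  A * INR m ^ 2 <= exp (c * sqrt (INR m)).
Proof.
  intros Hc.
  destruct (nfloor_ex (Rmax 0 (A * (6 / c) ^ 6))) as [n [_ Hn]]; [apply Rmax_l|].
  exists (S n). intros m Hm.
  assert (Hm' : A * (6 / c) ^ 6 <= INR m).
  { apply le_INR in Hm. rewrite S_INR in Hm. pose proof (Rmax_r 0 (A * (6 / c) ^ 6)). lra. }
  set (t := sqrt (INR m)). assert (Ht : t * t = INR m) by (apply sqrt_sqrt, pos_INR).
  assert (Pt : 0 <= t) by apply sqrt_pos.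
  assert (H1 : (c * t / 6) ^ 6 <= exp (c * t)).
  { replace (exp (c * t)) with (exp (c * t / 6) ^ 6).
    - apply pow_incr. split; [apply Rdiv_le_0_compat; [nra|lra]|]. pose proof (exp_ineq1_le (c * t / 6)). lra.
    - simpl. rewrite Rmult_1_r, <- !exp_plus. f_equal. field. }
  apply Rle_trans with (2 := H1).
  replace ((c * t / 6) ^ 6) with ((c / 6) ^ 6 * (t * t) * (t * t) ^ 2) by (field).
  rewrite Ht. apply Rmult_le_compat_r; [apply pow2_ge_0|].
  assert (P6 : 0 < (c / 6) ^ 6) by (apply pow_lt; lra).
  apply Rle_trans with ((c / 6) ^ 6 * (A * (6 / c) ^ 6)).
  - right. field. lra.
  - apply Rmult_le_compat_l; lra.
Qed.

Lemma partial_sum_abs_le (f g : nat -> R) (n : nat) :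
  (forall k, (k < n)%nat -> Rabs (f k) <= g k) -> Rabs (partial_sum f n) <= partial_sum g n.
Proof.
  induction n as [|n IH]; intros H; simpl; [rewrite Rabs_R0; lra|].
  apply Rle_trans with (1 := Rabs_triang _ _). apply Rplus_le_compat; [apply IH; intros; apply H; lia|apply H; lia].
Qed.

Lemma partial_sum_scal (a : R) (f : nat -> R) (n : nat) : partial_sum (fun k => a * f k) n = a * partial_sum f n.
Proof. induction n as [|n IH]; simpl; [ring|rewrite IH; ring]. Qed.

Lemma partial_sum_shift (f : nat -> R) (n : nat) : partial_sum f (S n) = f 0%nat + partial_sum (fun k => f (S k)) n.
Proof. induction n as [|n IH]; [simpl; ring|]. cbn [partial_sum] in *. rewrite IH. ring. Qed.

Section LowerBound.
Context (al b : nat -> R) (x0 c be : R) (h e : nat -> R).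
Hypothesis Hcr : critical al b x0 c be h e.

Definition row_sum n := match n with O => al 0 + b 0%nat | S k => al (S k) + b (S k) + b k end.
Definition truncated n0 n := if (n <? n0)%nat then 0 else e n.
Definition quasi_deriv (u : nat -> C) n : C :=
  match n with O => RtoC 0 | S k => (b k * (u (S k) - u k))%C end.

(** The gauge is the sum of the e_k with k >= n0, bounded by T n^(be - 1/2).  It
    satisfies the smallness conditions of [flux_step] for n up to 2 m when r is a
    large multiple K' of m^(be-1), so the flux is positive and increasing up to 2 m.
    On the last half of that range the relative gain is at least a multiple of
    m^(-1/2) per step, and m steps give exp(c m^(1/2)), where
    m^(1/2) ~ r^(1/(2 (be - 1))). *)
Lemma square_sum_lower_bound : exists c0 R0, 0 < c0 /\ 0 < R0 /\
  forall (r : R) (u : nat -> C), R0 <= r -> Cmod (u 0%nat) = 1 ->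
  (b 0%nat * u 1%nat + al 0%nat * u 0%nat = (0, r) * u 0%nat)%C ->
  (forall n, (1 <= n)%nat ->
     (b n * u (S n) + al n * u n + b (pred n) * u (pred n) = (0, r) * u n)%C) ->
  exists n, exp (c0 * Rpower r (1 / (2 * (be - 1)))) <= r * partial_sum (fun k => Cmod (u k) ^ 2) n.
Proof.
  pose proof (cr_x0 _ _ _ _ _ _ _ Hcr) as Px0. pose proof (cr_c _ _ _ _ _ _ _ Hcr) as Pc.
  pose proof (cr_be _ _ _ _ _ _ _ Hcr) as Pbe. pose proof (cr_pos _ _ _ _ _ _ _ Hcr) as Pb.
  destruct (offdiag_lower _ _ _ _ _ _ _ Hcr) as [kb [Pkb Hkb]].
  destruct (offdiag_upper _ _ _ _ _ _ _ Hcr) as [KB [PKB HKB]].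
  set (om := be - 1 / 2).
  set (en := fun n => Rpower (INR (S n)) (- om) * Rabs (e (S n))).
  assert (Pen : forall n, 0 <= en n).
  { intros n. unfold en. apply Rmult_le_pos; [apply Rlt_le, Rpower_pos|apply Rabs_pos]. }
  pose proof (cr_e _ _ _ _ _ _ _ Hcr) as Hex. fold om in Hex. fold en in Hex.
  set (T := Series en). assert (PT : 0 <= T) by (pose proof (partial_sum_le_Series en Pen Hex 0); assumption).
  assert (Hn0 : exists n0, (1 <= n0)%nat /\ forall n, (n0 <= n)%nat -> T * Rpower (INR n) (- (1 / 2)) <= kb / 4).
  { assert (Hl : is_lim_seq (fun n => T * Rpower (INR n) (- (1 / 2))) 0).
    { replace (Finite 0) with (Rbar_mult T 0) by (simpl; f_equal; ring).
      apply is_lim_seq_scal_l, is_lim_Rpower_neg. lra. }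
    destruct (is_lim_seq_eventually_le _ _ (kb / 4) Hl ltac:(lra)) as [n0 H].
    exists (S n0). split; [lia|]. intros n Hn. specialize (H n ltac:(lia)).
    rewrite Rminus_0_r in H. pose proof (RRle_abs (T * Rpower (INR n) (- (1 / 2)))). lra. }
  destruct Hn0 as [n0 [Hn0 Hn0']].
  set (gm := partial_sum (truncated n0)).
  assert (Hgm : forall n, Rabs (gm (S n)) <= T * Rpower (INR n) om).
  { intros n. destruct n as [|n].
    - unfold gm. simpl. unfold truncated. replace (0 <? n0)%nat with true by (symmetry; apply Nat.ltb_lt; lia).
      rewrite Rplus_0_l, Rabs_R0. apply Rmult_le_pos; [exact PT|apply Rlt_le, Rpower_pos].
    - unfold gm. rewrite partial_sum_shift. unfold truncated at 1.
      replace (0 <? n0)%nat with true by (symmetry; apply Nat.ltb_lt; lia). rewrite Rplus_0_l.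
      apply Rle_trans with (partial_sum (fun k => Rpower (INR (S n)) om * en k) (S n)).
      + apply partial_sum_abs_le. intros k Hk. unfold truncated, en.
        assert (Hle : Rabs (e (S k)) <= Rpower (INR (S n)) om * (Rpower (INR (S k)) (- om) * Rabs (e (S k)))).
        { rewrite <- Rmult_assoc. rewrite <- (Rmult_1_l (Rabs (e (S k)))) at 1.
          apply Rmult_le_compat_r; [apply Rabs_pos|].
          apply Rle_trans with (Rpower (INR (S k)) om * Rpower (INR (S k)) (- om)).
          - pose proof (INR_S_ge1 k). rewrite <- Rpower_plus, Rplus_opp_r, Rpower_O by lra. lra.
          - apply Rmult_le_compat_r; [apply Rlt_le, Rpower_pos|].
            pose proof (INR_S_ge1 k). apply Rpower_le_base; [unfold om; lra|lra|apply le_INR; lia]. }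
        destruct (S k <? n0)%nat; [|exact Hle]. rewrite Rabs_R0.
        apply Rle_trans with (2 := Hle), Rabs_pos.
      + rewrite partial_sum_scal, Rmult_comm. apply Rmult_le_compat_r; [apply Rlt_le, Rpower_pos|].
        apply (partial_sum_le_Series en Pen Hex). }
  assert (Hgm0 : forall n, (n < n0)%nat -> gm (S n) = 0).
  { intros n Hn. unfold gm. assert (Rabs (partial_sum (truncated n0) (S n)) <= 0).
    { apply Rle_trans with (partial_sum (fun _ => 0 * 0) (S n)); [|rewrite partial_sum_scal; lra].
      apply partial_sum_abs_le. intros k Hk. unfold truncated.
      replace (k <? n0)%nat with true by (symmetry; apply Nat.ltb_lt; lia). rewrite Rabs_R0; lra. }
    pose proof (Rabs_pos (partial_sum (truncated n0) (S n))).
    destruct (Req_dec (partial_sum (truncated n0) (S n)) 0) as [E|E]; [exact E|]. apply Rabs_no_R0 in E. lra. }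
  (* the first term keeps the regular part of the row sums below r / 4, the second
     keeps the gauge below (r b_n)^(1/2) / 8 *)
  set (K' := 4 * (x0 * c) + 64 * T ^ 2 / kb + 1).
  assert (PTk : 0 <= 64 * T ^ 2 / kb) by (apply Rdiv_le_0_compat; [pose proof (pow2_ge_0 T); lra|lra]).
  assert (Pxc : 0 < x0 * c) by nra.
  assert (PK' : 1 <= K') by (unfold K'; lra).
  set (rho := 1 / (2 * (be - 1))).
  set (kap := sqrt (K' / (2 * KB))).
  assert (Pkap : 0 < kap) by (apply sqrt_lt_R0, Rdiv_lt_0_compat; lra).
  destruct (square_le_exp_sqrt (kap / 24) (16 * KB) ltac:(lra)) as [m1 Hm1].
  destruct (nfloor_ex (K' * Rpower 4 (be - 1) / kb)) as [m2 [_ Hm2]].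
  { apply Rdiv_le_0_compat; [|lra]. pose proof (Rpower_pos 4 (be - 1)). nra. }
  set (m0 := (m1 + m2 + 2)%nat).
  (* the rows before n0 have no gauge: r dominates their row sums instead *)
  set (Qs := partial_sum (fun k => Rabs (row_sum k)) n0).
  exists (kap / 24 * (/ 2 * Rpower (/ K') rho)), (2 + 4 * Qs + K' * Rpower (2 * INR m0) (be - 1)).
  assert (PQs : 0 <= Qs).
  { unfold Qs. apply (partial_sum_mono (fun k => Rabs (row_sum k)) (fun k => Rabs_pos _) 0 n0). lia. }
  assert (PP : 0 < K' * Rpower (2 * INR m0) (be - 1)) by (apply Rmult_lt_0_compat; [lra|apply Rpower_pos]).
  split. { apply Rmult_lt_0_compat; [lra|]. apply Rmult_lt_0_compat; [lra|apply Rpower_pos]. }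
  split; [lra|]. intros r u Hr Hu0 Hrow0 Hrow.
  set (R := Rpower (r / K') (1 / (be - 1)) / 2).
  assert (HR : Rpower (2 * R) (be - 1) = r / K').
  { unfold R. replace (2 * (Rpower (r / K') (1 / (be - 1)) / 2)) with (Rpower (r / K') (1 / (be - 1))) by field.
    rewrite Rpower_mult. replace (1 / (be - 1) * (be - 1)) with 1 by (field; lra).
    apply Rpower_1. apply Rdiv_lt_0_compat; lra. }
  assert (PR : 0 < R) by (unfold R; apply Rdiv_lt_0_compat; [apply Rpower_pos|lra]).
  assert (HRm : INR m0 <= R).
  { destruct (Rle_or_lt (INR m0) R) as [H|H]; [exact H|exfalso].
    assert (Rpower (2 * R) (be - 1) < Rpower (2 * INR m0) (be - 1)) by (apply Rlt_Rpower_l; lra).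
    rewrite HR in H0. assert (r < K' * Rpower (2 * INR m0) (be - 1)); [|lra].
    apply (Rmult_lt_reg_r (/ K')); [apply Rinv_0_lt_compat; lra|].
    replace (K' * Rpower (2 * INR m0) (be - 1) * / K') with (Rpower (2 * INR m0) (be - 1)) by (field; lra). exact H0. }
  destruct (nfloor_ex R) as [m [HmR1 HmR2]]; [lra|].
  assert (Hmm0 : (m0 <= m)%nat).
  { apply Nat.lt_succ_r, INR_lt. rewrite S_INR. lra. }
  assert (Hm2' : (2 <= m)%nat) by (unfold m0 in Hmm0; lia).
  assert (Pm : 2 <= INR m) by (apply (le_INR 2); exact Hm2').
  (* r is at least K' n^(be-1) for n <= 2 m, and at most b_n for n >= m *)
  assert (Hrm1 : forall n, (1 <= n <= 2 * m)%nat -> K' * Rpower (INR n) (be - 1) <= r).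
  { intros n Hn. apply Rle_trans with (K' * (r / K')); [|right; field; lra].
    apply Rmult_le_compat_l; [lra|]. rewrite <- HR. apply Rpower_le_base; [lra| |].
    - pose proof (INR_ge1 n ltac:(lia)); lra.
    - apply Rle_trans with (INR (2 * m)); [apply le_INR; lia|rewrite mult_INR; simpl; lra]. }
  assert (Hrm2 : forall n, (m <= n)%nat -> r <= b n).
  { intros n Hn. apply Rle_trans with (2 := Hkb n ltac:(lia)).
    apply Rle_trans with (kb * Rpower (INR m) be).
    2:{ apply Rmult_le_compat_l; [lra|]. apply Rpower_le_base; [lra|lra|apply le_INR; lia]. }
    assert (H1 : r / K' <= Rpower 4 (be - 1) * Rpower (INR m) (be - 1)).
    { rewrite <- HR, Rpower_mult_distr by lra. apply Rpower_le_base; lra. }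
    assert (H2 : r <= K' * Rpower 4 (be - 1) * Rpower (INR m) (be - 1)).
    { apply Rle_trans with (K' * (r / K')); [right; field; lra|]. rewrite Rmult_assoc. apply Rmult_le_compat_l; lra. }
    apply Rle_trans with (1 := H2). rewrite <- (Rpower_pred_mult (INR m) be) by lra.
    rewrite <- Rmult_assoc, (Rmult_comm (kb * _)), <- Rmult_assoc. apply Rmult_le_compat_r; [apply Rlt_le, Rpower_pos|].
    assert (H3 : INR m2 + 1 <= INR m).
    { rewrite <- S_INR. apply le_INR. unfold m0 in Hmm0; lia. }
    assert (H4 : K' * Rpower 4 (be - 1) = kb * (K' * Rpower 4 (be - 1) / kb)) by (field; lra).
    rewrite H4, (Rmult_comm (INR m)). apply Rmult_le_compat_l; lra. }
  set (H := fun n => flux (u n) (quasi_deriv u n) (gm n)).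
  assert (Hu1 : forall n, u (S n) = (u n + quasi_deriv u (S n) / b n)%C).
  { intros n. simpl. field. apply not_eq_sym. intros E. apply RtoC_inj in E. specialize (Pb n). lra. }
  assert (Hw1 : forall n, quasi_deriv u (S n) = (quasi_deriv u n + ((0, r) - RtoC (row_sum n)) * u n)%C).
  { intros n. destruct n as [|n].
    - simpl. rewrite RtoC_plus.
      replace (((0, r) - (al 0%nat + b 0%nat)) * u 0%nat)%C with ((0, r) * u 0%nat - (al 0%nat + b 0%nat) * u 0%nat)%C by ring.
      rewrite <- Hrow0. ring.
    - simpl. rewrite !RtoC_plus.
      replace (((0, r) - (al (S n) + b (S n) + b n)) * u (S n))%C with ((0, r) * u (S n) - (al (S n) + b (S n) + b n) * u (S n))%C by ring.
      rewrite <- (Hrow (S n) ltac:(lia)). simpl pred. ring. }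
  assert (Hg1 : forall n, (n < 2 * m)%nat -> Rabs (gm (S n)) <= b n / 4).
  { intros n Hn. destruct (Nat.lt_ge_cases n n0) as [Hlt|Hge].
    - rewrite Hgm0 by exact Hlt. rewrite Rabs_R0. specialize (Pb n). lra.
    - apply Rle_trans with (1 := Hgm n). specialize (Hn0' n ltac:(lia)). specialize (Hkb n ltac:(lia)).
      replace (Rpower (INR n) om) with (Rpower (INR n) (- (1 / 2)) * Rpower (INR n) be)
        by (unfold om; rewrite <- Rpower_plus; f_equal; field).
      pose proof (Rpower_pos (INR n) be). rewrite <- Rmult_assoc.
      apply Rle_trans with (kb / 4 * Rpower (INR n) be); [apply Rmult_le_compat_r; lra|lra]. }
  assert (Hg2 : forall n, (n < 2 * m)%nat -> 64 * gm (S n) ^ 2 <= r * b n).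
  { intros n Hn. destruct (Nat.lt_ge_cases n n0) as [Hlt|Hge].
    - rewrite Hgm0 by exact Hlt. specialize (Pb n). assert (0 < r * b n) by (apply Rmult_lt_0_compat; lra). lra.
    - specialize (Hgm n). specialize (Hkb n ltac:(lia)). specialize (Hrm1 n ltac:(lia)).
      assert (H1 : gm (S n) ^ 2 <= (T * Rpower (INR n) om) ^ 2) by (apply pow_maj_Rabs, Hgm).
      apply Rle_trans with (K' * Rpower (INR n) (be - 1) * (kb * Rpower (INR n) be)).
      + replace (K' * Rpower (INR n) (be - 1) * (kb * Rpower (INR n) be)) with
          (K' * kb * Rpower (INR n) om ^ 2).
        2:{ replace (Rpower (INR n) om ^ 2) with (Rpower (INR n) (be - 1) * Rpower (INR n) be); [ring|].
            simpl. rewrite Rmult_1_r, <- !Rpower_plus. f_equal. unfold om. field. }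
        assert (H2 : 64 * T ^ 2 <= K' * kb).
        { apply Rle_trans with (64 * T ^ 2 / kb * kb); [right; field; lra|]. apply Rmult_le_compat_r; unfold K'; lra. }
        pose proof (pow2_ge_0 (Rpower (INR n) om)). nra.
      + pose proof (Rpower_pos (INR n) be). pose proof (Rpower_pos (INR n) (be - 1)).
        apply Rmult_le_compat; try assumption; apply Rlt_le, Rmult_lt_0_compat; lra. }
  assert (Hstep : forall n, (n < 2 * m)%nat ->
     H n + / 2 * (Cmod (quasi_deriv u (S n)) ^ 2 / b n + r * Cmod (u n) ^ 2) <= H (S n)).
  { intros n Hn. unfold H.
    apply flux_step with (s := row_sum n - truncated n0 n) (e := truncated n0 n); auto.
    - lra.
    - unfold truncated. destruct (Nat.ltb_spec n n0) as [Hlt|Hge].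
      + rewrite Rminus_0_r. apply Rle_trans with (1 := RRle_abs _).
        apply Rle_trans with Qs; [|lra]. 
        apply Rle_trans with (partial_sum (fun k => Rabs (row_sum k)) (S n)).
        * simpl. pose proof (partial_sum_mono (fun k => Rabs (row_sum k)) (fun k => Rabs_pos _) 0 n ltac:(lia)) as Hq. simpl in Hq. lra.
        * apply partial_sum_mono; [intros; apply Rabs_pos|lia].
      + destruct n as [|n]; [lia|]. unfold row_sum. 
        pose proof (cr_row _ _ _ _ _ _ _ Hcr (S n) ltac:(lia)) as Hq. simpl pred in Hq. rewrite Hq.
        specialize (Hrm1 (S n) ltac:(lia)).
        assert (4 * (x0 * c) * Rpower (INR (S n)) (be - 1) <= K' * Rpower (INR (S n)) (be - 1)).
        { apply Rmult_le_compat_r; [apply Rlt_le, Rpower_pos|unfold K'; lra]. }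
        lra.
    - rewrite Hw1. f_equal. f_equal. f_equal. f_equal. f_equal. ring. }
  assert (Hinc : forall n, (n < 2 * m)%nat -> 1 <= H (S n)).
  { induction n as [|n IH]; intros Hn.
    - apply Rle_trans with (2 := Hstep 0%nat Hn). rewrite Hu0.
      assert (H 0%nat = 0) by (unfold H, flux, gm; simpl; ring).
      assert (0 <= Cmod (quasi_deriv u 1%nat) ^ 2 / b 0%nat) by (apply Rdiv_le_0_compat; [apply pow2_ge_0|apply Pb]). lra.
    - apply Rle_trans with (2 := Hstep (S n) Hn). specialize (IH ltac:(lia)).
      assert (0 <= Cmod (quasi_deriv u (S (S n))) ^ 2 / b (S n)) by (apply Rdiv_le_0_compat; [apply pow2_ge_0|apply Pb]).
      assert (0 <= r * Cmod (u (S n)) ^ 2) by (apply Rmult_le_pos; [lra|apply pow2_ge_0]). lra. }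
  set (x := kap / (6 * sqrt (INR m))).
  assert (Psm : 0 < sqrt (INR m)) by (apply sqrt_lt_R0; lra).
  assert (Px : 0 < x) by (unfold x; apply Rdiv_lt_0_compat; lra).
  assert (Hgrow : forall j, (j < m)%nat -> exp (x / 2) * H (m + j)%nat <= H (m + S j)%nat).
  { intros j Hj. set (n := (m + j)%nat). replace (m + S j)%nat with (S n) by (unfold n; lia).
    assert (Hn : (m <= n < 2 * m)%nat) by (unfold n; lia).
    specialize (Pb n). pose proof (Hrm2 n ltac:(lia)) as Hrb.
    assert (Prb : 0 < r * b n) by (apply Rmult_lt_0_compat; lra).
    set (la := sqrt (r * b n)). assert (Pla : 0 < la) by (apply sqrt_lt_R0, Prb).
    assert (Hla : la ^ 2 = r * b n) by (unfold la; apply pow2_sqrt; lra).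
    assert (HF : H (S n) <= 3 * (la / r) * (Cmod (quasi_deriv u (S n)) ^ 2 / b n + r * Cmod (u n) ^ 2)).
    { unfold H. apply flux_upper; auto; try lra.
      apply Rsqr_incr_0_var; [|lra]. unfold Rsqr. pose proof (Hg2 n ltac:(lia)) as G2.
      rewrite <- Hla in G2. rewrite <- (pow2_abs (gm (S n))) in G2. lra. }
    specialize (Hstep n ltac:(lia)).
    set (E := Cmod (quasi_deriv u (S n)) ^ 2 / b n + r * Cmod (u n) ^ 2) in *.
    set (y := r / (6 * la)).
    assert (Hy : y * H (S n) <= / 2 * E).
    { apply Rle_trans with (y * (3 * (la / r) * E)).
      - apply Rmult_le_compat_l; [|exact HF]. unfold y. apply Rdiv_le_0_compat; lra.
      - right. unfold y. field. lra. }
    assert (Hxy : x <= y).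
    { apply Rsqr_incr_0_var; [|unfold y; apply Rdiv_le_0_compat; lra].
      unfold Rsqr, x, y.
      replace (r / (6 * la) * (r / (6 * la))) with (r ^ 2 / (36 * la ^ 2)) by (field; lra).
      rewrite Hla.
      replace (kap / (6 * sqrt (INR m)) * (kap / (6 * sqrt (INR m)))) with
         ((kap * kap) / (36 * (sqrt (INR m) * sqrt (INR m)))) by (field; lra).
      rewrite sqrt_sqrt by lra. unfold kap. rewrite sqrt_sqrt by (apply Rdiv_le_0_compat; lra).
      replace (r ^ 2 / (36 * (r * b n))) with (r / (36 * b n)) by (field; lra).
      apply Rle_trans with (K' * Rpower (2 * INR m) (be - 1) / (36 * (KB * Rpower (2 * INR m) be))).
      - rewrite <- (Rpower_pred_mult (2 * INR m) be) by lra. pose proof (Rpower_pos (2 * INR m) (be - 1)).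
        right. field. repeat split; lra.
      - assert (E2 : INR (2 * m) = 2 * INR m) by (rewrite mult_INR; simpl; ring).
        pose proof (Hrm1 (2 * m)%nat ltac:(lia)) as HH. rewrite E2 in HH.
        apply Rmult_le_compat.
        + apply Rmult_le_pos; [lra|apply Rlt_le, Rpower_pos].
        + apply Rlt_le, Rinv_0_lt_compat. pose proof (Rpower_pos (2 * INR m) be).
          apply Rmult_lt_0_compat; [lra|apply Rmult_lt_0_compat; lra].
        + exact HH.
        + apply Rinv_le_contravar; [lra|]. apply Rmult_le_compat_l; [lra|].
          apply Rle_trans with (1 := HKB n ltac:(lia)). apply Rmult_le_compat_l; [lra|].
          apply Rpower_le_base; [lra| |].
          * pose proof (INR_ge1 n ltac:(lia)). lra.
          * rewrite <- E2. apply le_INR. lia. }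
    assert (Hy1 : y <= 1).
    { unfold y. assert (r <= la).
      { apply Rsqr_incr_0_var; [|lra]. unfold Rsqr. replace (la * la) with (r * b n) by (rewrite <- Hla; ring). nra. }
      apply (Rmult_le_reg_r (6 * la)); [lra|]. replace (r / (6 * la) * (6 * la)) with r by (field; lra). lra. }
    pose proof (exp_half_le x ltac:(lra)) as HE.
    assert (HSn : 1 <= H (S n)) by (apply Hinc; lia).
    assert (HHn : 0 <= H n) by (destruct n as [|n']; [lia|]; pose proof (Hinc n' ltac:(lia)); lra).
    apply Rle_trans with ((1 + x) * H n); [apply Rmult_le_compat_r; assumption|].
    assert (H n <= (1 - x) * H (S n)) by nra.
    apply Rle_trans with ((1 + x) * ((1 - x) * H (S n))); [apply Rmult_le_compat_l; lra|nra]. }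
  pose proof (geometric_growth H m m (x / 2) Hgrow) as HG.
  replace (INR m * (x / 2)) with (kap / 24 * sqrt (INR m) + kap / 24 * sqrt (INR m)) in HG.
  2:{ unfold x. rewrite <- (sqrt_sqrt (INR m)) at 3 by lra. field. lra. }
  rewrite exp_plus in HG. set (X := exp (kap / 24 * sqrt (INR m))) in *.
  assert (PX : 0 < X) by apply exp_pos.
  set (S2 := partial_sum (fun k => Cmod (u k) ^ 2) (S (2 * m))).
  exists (S (2 * m)). fold S2.
  assert (HS2 : Cmod (u (2 * m)%nat) ^ 2 + Cmod (u (2 * m - 1)%nat) ^ 2 <= S2).
  { unfold S2. set (k := (2 * m - 1)%nat). replace (2 * m)%nat with (S k) by (unfold k; lia).
    pose proof (partial_sum_mono (fun k => Cmod (u k) ^ 2) (fun k => pow2_ge_0 _) 0 k ltac:(lia)) as Hq.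
    cbn [partial_sum] in *. lra. }
  assert (PS2 : 0 <= S2).
  { pose proof (pow2_ge_0 (Cmod (u (2 * m)%nat))). pose proof (pow2_ge_0 (Cmod (u (2 * m - 1)%nat))). lra. }
  assert (Hend : H (m + m)%nat <= 16 * KB * INR m ^ 2 * S2).
  { replace (m + m)%nat with (S (2 * m - 1)) by lia. unfold H.
    apply Rle_trans with (4 * b (2 * m - 1)%nat * (Cmod (u (S (2 * m - 1))) ^ 2 + Cmod (u (2 * m - 1)%nat) ^ 2)).
    { apply flux_end; [apply Pb|apply Hg1; lia|reflexivity]. }
    replace (S (2 * m - 1)) with (2 * m)%nat by lia.
    apply Rmult_le_compat; [specialize (Pb (2 * m - 1)%nat); lra| |  |exact HS2].
    - pose proof (pow2_ge_0 (Cmod (u (2 * m)%nat))). pose proof (pow2_ge_0 (Cmod (u (2 * m - 1)%nat))). lra.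
    - pose proof (HKB (2 * m - 1)%nat ltac:(lia)) as HB.
      assert (Q : Rpower (INR (2 * m - 1)) be <= 4 * INR m ^ 2).
      { apply Rle_trans with (Rpower (2 * INR m) 2).
        - pose proof (INR_ge1 (2 * m - 1) ltac:(lia)).
          apply Rle_trans with (Rpower (INR (2 * m - 1)) 2); [apply Rle_Rpower; lra|].
          apply Rpower_le_base; [lra|lra|]. replace (2 * INR m) with (INR (2 * m)) by (rewrite mult_INR; simpl; ring).
          apply le_INR; lia.
        - replace 2 with (INR 2) at 2 by reflexivity. rewrite Rpower_pow by lra. right. ring. }
      apply Rle_trans with (4 * (KB * (4 * INR m ^ 2))); [|right; ring].
      apply Rmult_le_compat_l; [lra|]. apply Rle_trans with (1 := HB). apply Rmult_le_compat_l; lra. }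
  assert (Hpoly : 16 * KB * INR m ^ 2 <= X).
  { apply Hm1. unfold m0 in Hmm0; lia. }
  (* half of the exponent pays for the polynomial factor *)
  assert (HXS : X <= S2).
  { apply (Rmult_le_reg_l X); [exact PX|].
    assert (1 <= H m) by (destruct m as [|m']; [lia|]; apply Hinc; lia).
    apply Rle_trans with (X * X * H m); [nra|]. apply Rle_trans with (1 := HG).
    apply Rle_trans with (1 := Hend). apply Rmult_le_compat_r; assumption. }
  apply Rle_trans with S2; [|nra].
  apply Rle_trans with (2 := HXS). unfold X. apply exp_le.
  rewrite Rmult_assoc. apply Rmult_le_compat_l; [lra|].
  assert (Hsq : / 2 * Rpower (/ K') rho * Rpower r rho = sqrt (R / 2)).
  { rewrite Rmult_assoc, Rpower_mult_distr by (try apply Rinv_0_lt_compat; lra).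
    replace (/ K' * r) with (r / K') by (unfold Rdiv; ring).
    unfold R. replace (Rpower (r / K') (1 / (be - 1)) / 2 / 2) with ((/ 2 * Rpower (r / K') rho) * (/ 2 * Rpower (r / K') rho)).
    - symmetry. apply sqrt_square. pose proof (Rpower_pos (r / K') rho). lra.
    - replace (Rpower (r / K') (1 / (be - 1))) with (Rpower (r / K') rho * Rpower (r / K') rho); [field|].
      rewrite <- Rpower_plus. f_equal. unfold rho. field. lra. }
  rewrite Hsq. apply sqrt_le_1_alt. lra.
Qed.

End LowerBound.

(** * The limit circle case *)

Lemma ex_series_zero : ex_series (fun _ : nat => 0).
Proof.
  apply (ex_series_of_bounded _ 0); [intros; lra|].
  intros n; induction n as [|n IH]; simpl; lra.
Qed.

Lemma Series_zero (x : nat -> R) : (forall n, x n = 0) -> Series x = 0.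
Proof.
  intros H. rewrite (Series_ext x (fun n => 0 * 0)) by (intros n; rewrite H; ring).
  rewrite Series_scal_l. ring.
Qed.

Lemma ex_series_finite_diff (x y : nat -> R) (N : nat) :
  (forall n, (N <= n)%nat -> x n = y n) -> ex_series x -> ex_series y.
Proof.
  intros H Hx. apply (ex_series_incr_n y N). apply (ex_series_incr_n x N) in Hx.
  revert Hx. apply ex_series_ext. intros n. apply H. lia.
Qed.

(** The elementary form of the Cauchy-Schwarz inequality, that is,
    |x f| <= (x^2/eps + eps f^2)/2. *)
Lemma series_prod_small (x f : nat -> R) (eps : R) : 0 < eps ->
  ex_series (fun n => x n ^ 2) -> Series (fun n => x n ^ 2) <= eps ^ 2 ->
  ex_series (fun n => f n ^ 2) ->
  ex_series (fun n => x n * f n) /\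
  Rabs (Series (fun n => x n * f n)) <= eps * ((1 + Series (fun n => f n ^ 2)) / 2).
Proof.
  intros He Hx Hxe Hf.
  assert (Hle : forall n, Rabs (x n * f n) <= / (2 * eps) * x n ^ 2 + eps / 2 * f n ^ 2).
  { intros n. 
    assert (H1 : 0 <= / (2 * eps) * (x n - eps * f n) ^ 2)
      by (apply Rmult_le_pos; [apply Rlt_le, Rinv_0_lt_compat; lra|apply pow2_ge_0]).
    assert (H2 : 0 <= / (2 * eps) * (x n + eps * f n) ^ 2)
      by (apply Rmult_le_pos; [apply Rlt_le, Rinv_0_lt_compat; lra|apply pow2_ge_0]).
    replace (/ (2 * eps) * (x n - eps * f n) ^ 2) with (/ (2 * eps) * x n ^ 2 + eps / 2 * f n ^ 2 - x n * f n) in H1 by (field; lra).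
    replace (/ (2 * eps) * (x n + eps * f n) ^ 2) with (/ (2 * eps) * x n ^ 2 + eps / 2 * f n ^ 2 + x n * f n) in H2 by (field; lra).
    apply Rabs_le. lra. }
  assert (Hex : ex_series (fun n => / (2 * eps) * x n ^ 2 + eps / 2 * f n ^ 2)).
  { apply (ex_series_plus (fun n => / (2 * eps) * x n ^ 2) (fun n => eps / 2 * f n ^ 2)).
    - apply (ex_series_scal (/ (2 * eps)) (fun n => x n ^ 2) Hx).
    - apply (ex_series_scal (eps / 2) (fun n => f n ^ 2) Hf). }
  assert (Hexa : ex_series (fun n => Rabs (x n * f n))).
  { apply (ex_series_le (fun n => Rabs (x n * f n)) (fun n => / (2 * eps) * x n ^ 2 + eps / 2 * f n ^ 2)); [|exact Hex].
    intros n. unfold norm; simpl. unfold abs; simpl. rewrite Rabs_Rabsolu. apply Hle. }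
  split; [apply ex_series_Rabs, Hexa|].
  apply Rle_trans with (1 := Series_Rabs _ Hexa).
  apply Rle_trans with (Series (fun n => / (2 * eps) * x n ^ 2 + eps / 2 * f n ^ 2)).
  { apply Series_le; [|exact Hex]. intros n; split; [apply Rabs_pos|apply Hle]. }
  rewrite Series_plus.
  - rewrite !Series_scal_l.
    apply Rle_trans with (/ (2 * eps) * eps ^ 2 + eps / 2 * Series (fun n => f n ^ 2)).
    + apply Rplus_le_compat_r. apply Rmult_le_compat_l; [apply Rlt_le, Rinv_0_lt_compat; lra|exact Hxe].
    + right. field. lra.
  - apply (ex_series_scal (/ (2 * eps)) (fun n => x n ^ 2) Hx).
  - apply (ex_series_scal (eps / 2) (fun n => f n ^ 2) Hf).
Qed.

Lemma ell2_part (P : C -> R) (HP : forall z, P z ^ 2 <= Cmod z ^ 2) (x : nat -> C) (eps : R) :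
  0 < eps -> ell2 x -> ell2_norm x < eps ->
  ex_series (fun n => P (x n) ^ 2) /\ Series (fun n => P (x n) ^ 2) <= eps ^ 2.
Proof.
  intros He Hx Hn. split.
  - apply (ex_series_le (fun n => P (x n) ^ 2) (fun n => Cmod (x n) ^ 2)); [|exact Hx].
    intros n. unfold norm; simpl. unfold abs; simpl. rewrite Rabs_right; [apply HP|apply Rle_ge, pow2_ge_0].
  - apply Rle_trans with (Series (fun n => Cmod (x n) ^ 2)).
    + apply Series_le; [|exact Hx]. intros n; split; [apply pow2_ge_0|apply HP].
    + unfold ell2_norm in Hn.
      assert (HS : 0 <= Series (fun n => Cmod (x n) ^ 2)).
      { rewrite <- (Series_zero (fun _ => 0)) by reflexivity. apply Series_le; [|exact Hx].
        intros n; split; [lra|apply pow2_ge_0]. }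
      rewrite <- (sqrt_sqrt _ HS). pose proof (sqrt_pos (Series (fun n => Cmod (x n) ^ 2))). nra.
Qed.

Section LimitCircle.
Context (a b : nat -> R).
Hypothesis hb : forall n, 0 < b n.

Definition real_jacobi (f : nat -> R) n :=
  match n with
  | O => b 0%nat * f 1%nat + a 0%nat * f 0%nat
  | S k => b n * f (S n) + a n * f n + b k * f k
  end.

(** Green's formula: the boundary term at 0 vanishes, the matrix being
    semi-infinite. *)
Lemma jacobi_lagrange (x f : nat -> R) (n : nat) :
  partial_sum (fun k => real_jacobi x k * f k - x k * real_jacobi f k) (S n)
  = b n * (x (S n) * f n - x n * f (S n)).
Proof.
  induction n as [|n IH]; [simpl; ring|]. cbn [partial_sum] in *. rewrite IH. simpl real_jacobi. ring.
Qed.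

Lemma jacobi_apply_part (P : C -> R) (HP1 : forall z w, P (z + w)%C = P z + P w)
  (HP2 : forall r z, P (RtoC r * z)%C = r * P z) (u : nat -> C) n :
  P (jacobi_apply a b u n) = real_jacobi (fun k => P (u k)) n.
Proof. destruct n as [|n]; simpl; rewrite !HP1, !HP2; reflexivity. Qed.

Lemma finite_symmetric (x f : nat -> R) (N : nat) :
  (forall n, (N <= n)%nat -> x n = 0) ->
  Series (fun n => real_jacobi x n * f n) = Series (fun n => x n * real_jacobi f n).
Proof.
  intros Hx.
  assert (Hjx : forall n, (S N <= n)%nat -> real_jacobi x n = 0).
  { intros [|n] Hn; [lia|]. simpl. rewrite !Hx by lia. ring. }
  assert (H0 : ex_series (fun _ : nat => 0)) by exact ex_series_zero.
  assert (E1 : ex_series (fun n => real_jacobi x n * f n)).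
  { apply (ex_series_finite_diff (fun _ => 0) _ (S N)); [|exact H0]. intros n Hn. rewrite Hjx by exact Hn. ring. }
  assert (E2 : ex_series (fun n => x n * real_jacobi f n)).
  { apply (ex_series_finite_diff (fun _ => 0) _ (S N)); [|exact H0]. intros n Hn. rewrite Hx by lia. ring. }
  apply Rminus_diag_uniq. rewrite <- Series_minus by assumption.
  assert (HL : is_lim_seq (partial_sum (fun n => real_jacobi x n * f n - x n * real_jacobi f n)) 0).
  { apply is_lim_seq_ext_loc with (fun _ => 0); [|apply is_lim_seq_const].
    exists (S N). intros [|n] Hn; [lia|]. rewrite jacobi_lagrange, !Hx by lia. ring. }
  assert (HL2 := is_lim_partial_sum _ (ex_series_minus _ _ E1 E2)).
  apply is_lim_seq_unique in HL. 
  change (is_lim_seq (partial_sum (fun n => real_jacobi x n * f n - x n * real_jacobi f n)) (Series (fun n => real_jacobi x n * f n - x n * real_jacobi f n))) in HL2.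
  apply is_lim_seq_unique in HL2. rewrite HL in HL2. injection HL2. auto.
Qed.

(** Stated for an additive P, to be used with the real and the imaginary part.  The
    identity holds for finitely supported vectors by [finite_symmetric] and passes to
    the closure because both sides are continuous in the graph norm. *)
Lemma closure_symmetric (P : C -> R) (HP : forall z, P z ^ 2 <= Cmod z ^ 2)
  (HP1 : forall z w, P (z + w)%C = P z + P w) (HP2 : forall r z, P (RtoC r * z)%C = r * P z)
  (f : nat -> R) (u v : nat -> C) :
  ex_series (fun n => f n ^ 2) -> ex_series (fun n => real_jacobi f n ^ 2) ->
  jacobi_minimal a b u v ->
  Series (fun n => P (v n) * f n) = Series (fun n => P (u n) * real_jacobi f n).
Proof.
  intros Hf Hg (Hu & Hv & Happ).
  set (F := Series (fun n => f n ^ 2)). set (G := Series (fun n => real_jacobi f n ^ 2)).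
  apply Rminus_diag_uniq.
  set (D := Series (fun n => P (v n) * f n) - Series (fun n => P (u n) * real_jacobi f n)).
  assert (Hneg : forall z w, P (z - w)%C = P z - P w).
  { intros z w. unfold Cminus. rewrite HP1. replace (- w)%C with (RtoC (-1) * w)%C.
    - rewrite HP2. ring.
    - apply injective_projections; simpl; ring. }
  assert (HD : forall eps, 0 < eps -> Rabs D <= eps * ((1 + F) / 2 + (1 + G) / 2)).
  { intros eps He. destruct (Happ (mkposreal eps He)) as (u' & v' & ((N & HN) & Hv') & Hdu & Hdv).
    simpl in Hdu, Hdv.
    assert (HN' : forall n, (S N <= n)%nat -> v' n = 0%C).
    { intros [|n] Hn; [lia|]. rewrite Hv'. simpl. rewrite !HN by lia. ring. }
    assert (Lu : ell2 (fun n => u n - u' n)%C).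
    { apply (ex_series_finite_diff (fun n => Cmod (u n) ^ 2) _ N); [|exact Hu]. intros n Hn. rewrite HN by exact Hn.
      replace (u n - 0)%C with (u n) by ring. reflexivity. }
    assert (Lv : ell2 (fun n => v n - v' n)%C).
    { apply (ex_series_finite_diff (fun n => Cmod (v n) ^ 2) _ (S N)); [|exact Hv]. intros n Hn. rewrite HN' by exact Hn.
      replace (v n - 0)%C with (v n) by ring. reflexivity. }
    destruct (ell2_part P HP _ eps He Lu Hdu) as [A1 A2].
    destruct (ell2_part P HP _ eps He Lv Hdv) as [B1 B2].
    destruct (series_prod_small _ f eps He B1 B2 Hf) as [C1 C2]. fold F in C2.
    destruct (series_prod_small _ (real_jacobi f) eps He A1 A2 Hg) as [C3 C4]. fold G in C4.
    assert (HP0 : P 0%C = 0) by (pose proof (HP2 0 (RtoC 0)) as Q; rewrite Cmult_0_l in Q; lra).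
    assert (D1 : Series (fun n => P (v' n) * f n) = Series (fun n => P (u' n) * real_jacobi f n)).
    { rewrite <- (finite_symmetric (fun k => P (u' k)) f N).
      - apply Series_ext. intros n. rewrite Hv', jacobi_apply_part by assumption. reflexivity.
      - intros n Hn. rewrite HN by exact Hn. exact HP0. }
    assert (E0 : ex_series (fun _ : nat => 0)) by exact ex_series_zero.
    assert (E1 : ex_series (fun n => P (v' n) * f n)).
    { apply (ex_series_finite_diff (fun _ => 0) _ (S N)); [|exact E0]. intros n Hn. rewrite HN', HP0 by exact Hn. ring. }
    assert (E2 : ex_series (fun n => P (u' n) * real_jacobi f n)).
    { apply (ex_series_finite_diff (fun _ => 0) _ N); [|exact E0]. intros n Hn. rewrite HN, HP0 by exact Hn. ring. }
    assert (F1 : Series (fun n => P (v n) * f n) = Series (fun n => P (v n - v' n)%C * f n) + Series (fun n => P (v' n) * f n)).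
    { rewrite <- Series_plus by assumption. apply Series_ext. intros n. rewrite Hneg. ring. }
    assert (F2 : Series (fun n => P (u n) * real_jacobi f n) = Series (fun n => P (u n - u' n)%C * real_jacobi f n) + Series (fun n => P (u' n) * real_jacobi f n)).
    { rewrite <- Series_plus by assumption. apply Series_ext. intros n. rewrite Hneg. ring. }
    unfold D. rewrite F1, F2, D1.
    apply Rabs_le_between in C2. apply Rabs_le_between in C4. apply Rabs_le. lra. }
  destruct (Req_dec D 0) as [E|E]; [exact E|exfalso].
  apply Rabs_pos_lt in E. set (Kc := (1 + F) / 2 + (1 + G) / 2) in *.
  pose proof (HD 1 ltac:(lra)) as H1.
  assert (PK : 0 < Kc) by lra.
  specialize (HD (Rabs D / (2 * Kc)) ltac:(apply Rdiv_lt_0_compat; lra)).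
  replace (Rabs D / (2 * Kc) * Kc) with (Rabs D / 2) in HD by (field; lra). lra.
Qed.

Lemma ell2_RtoC (f : nat -> R) : ex_series (fun n => f n ^ 2) -> ell2 (fun n => RtoC (f n)).
Proof.
  apply ex_series_ext. intros n. rewrite Cmod_R. symmetry. apply pow2_abs.
Qed.

(** Real square summable sequences with square summable image belong to the maximal
    operator, which is the adjoint of the minimal one. *)
Lemma maximal_in_adjoint (f : nat -> R) :
  ex_series (fun n => f n ^ 2) -> ex_series (fun n => real_jacobi f n ^ 2) ->
  op_adjoint (jacobi_minimal a b) (fun n => RtoC (f n)) (fun n => RtoC (real_jacobi f n)).
Proof.
  intros Hf Hg. split; [apply ell2_RtoC, Hf|]. split; [apply ell2_RtoC, Hg|].
  intros u v Huv. unfold ell2_inner, CSeries. f_equal.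
  - assert (H := closure_symmetric Re ltac:(intros [x y]; rewrite (Cmod2_alt (x, y)); simpl Re; simpl Im; pose proof (pow2_ge_0 y); lra)
      ltac:(reflexivity) ltac:(intros r [x y]; simpl; ring) f u v Hf Hg Huv).
    rewrite (Series_ext _ (fun n => Re (v n) * f n)) by (intros n; destruct (v n); simpl; ring). rewrite H.
    apply Series_ext. intros n; destruct (u n); simpl; ring.
  - assert (H := closure_symmetric Im ltac:(intros [x y]; rewrite (Cmod2_alt (x, y)); simpl Re; simpl Im; pose proof (pow2_ge_0 x); lra)
      ltac:(reflexivity) ltac:(intros r [x y]; simpl; ring) f u v Hf Hg Huv).
    rewrite (Series_ext _ (fun n => Im (v n) * f n)) by (intros n; destruct (v n); simpl; ring). rewrite H.
    apply Series_ext. intros n; destruct (u n); simpl; ring.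
Qed.

(** The pairs (p(0), 0) and (q(0), e_0) belong to the adjoint.  If the minimal
    operator equalled its adjoint, it would be symmetric on them, but <0, q(0)> = 0
    while <p(0), e_0> = 1. *)
Lemma limit_circle_of_square_summable :
  ex_series (fun n => p_zero a b n ^ 2) -> ex_series (fun n => q_zero a b n ^ 2) -> limit_circle a b.
Proof.
  intros Hp Hq Hsa.
  assert (Jp : forall n, real_jacobi (p_zero a b) n = 0).
  { intros [|n]; simpl real_jacobi; [rewrite p_zero_1, p_zero_0 by exact hb; ring|apply p_zero_rec, hb]. }
  assert (Jq0 : real_jacobi (q_zero a b) 0 = 1).
  { simpl. rewrite q_zero_1, q_zero_0 by exact hb. ring. }
  assert (Jq : forall n, real_jacobi (q_zero a b) (S n) = 0) by (intros n; apply q_zero_rec, hb).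
  assert (E0 : ex_series (fun _ : nat => 0)) by exact ex_series_zero.
  pose proof (maximal_in_adjoint (p_zero a b) Hp) as A1. pose proof (maximal_in_adjoint (q_zero a b) Hq) as A2.
  destruct A2 as (_ & _ & A2).
  { apply (ex_series_finite_diff (fun _ => 0) _ 1); [|exact E0]. intros [|n] Hn; [lia|]. rewrite Jq. ring. }
  specialize (A2 _ _ (proj2 (Hsa _ _) (A1 ltac:(revert E0; apply ex_series_ext; intros n; rewrite Jp; simpl; ring)))).
  unfold ell2_inner, CSeries in A2. apply (f_equal Re) in A2. simpl Re in A2.
  rewrite Series_zero in A2 by (intros n; rewrite Jp; simpl; ring).
  rewrite Series_incr_1 in A2.
  - rewrite Series_zero in A2 by (intros n; rewrite Jq; simpl; ring).
    rewrite Jq0, p_zero_0 in A2. simpl in A2. lra.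
  - apply (ex_series_finite_diff (fun _ => 0) _ 1); [|exact E0]. intros [|n] Hn; [lia|]. rewrite Jq. simpl. ring.
Qed.
End LimitCircle.

(** * From the power asymptotics to the critical regime *)

(** With s y_0 = -2 x_0 the terms of order n^be in s a_n + b_n + b_{n-1} cancel.
    Those of order n^(be-1) combine to 2 x_1 + s y_1 - be x_0 = x_0 (sigma - be), the
    last summand coming from the difference between n^be and (n-1)^be. *)
Lemma critical_of_expansion (a b : nat -> R) (be x0 x1 y0 y1 s : R) (chi mu : nat -> R) :
  (forall n, 0 < b n) ->
  (forall n, (1 <= n)%nat -> b n = Rpower (INR n) be * (x0 + x1 / INR n + chi n)) ->
  (forall n, (1 <= n)%nat -> a n = Rpower (INR n) be * (y0 + y1 / INR n + mu n)) ->
  0 < x0 -> s * s = 1 -> y0 = - 2 * s * x0 ->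
  ex_series (fun n => sqrt (INR (S n)) * (Rabs (chi (S n)) + Rabs (mu (S n)))) ->
  3 / 2 < be < 2 -> be < 2 * x1 / x0 - 2 * y1 / y0 ->
  exists h e, critical (fun n => s * a n) b x0 (2 * x1 / x0 - 2 * y1 / y0 - be) be h e.
Proof.
  intros hb Hb Ha Px0 Hs Hy0 Hsum Hbe Hc.
  set (c := 2 * x1 / x0 - 2 * y1 / y0 - be).
  assert (Hs0 : s <> 0) by (intros E; rewrite E in Hs; lra).
  assert (Hs1 : Rabs s = 1).
  { assert (Rabs s * Rabs s = 1) by (rewrite <- Rabs_mult, Hs; apply Rabs_R1). pose proof (Rabs_pos s). nra. }
  assert (Hxc : x0 * c = 2 * x1 + s * y1 - x0 * be).
  { unfold c. rewrite Hy0. replace (s * y1) with (y1 * (s * s) / s) by (field; exact Hs0). rewrite Hs. field. lra. }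
  assert (Psq : forall n, 1 <= sqrt (INR (S n))).
  { intros n. rewrite <- sqrt_1. apply sqrt_le_1_alt, INR_S_ge1. }
  assert (Hchi : ex_series (fun n => sqrt (INR (S n)) * Rabs (chi (S n)))).
  { apply (ex_series_dominated _ _) with (2 := Hsum). intros n.
    specialize (Psq n). pose proof (Rabs_pos (chi (S n))). pose proof (Rabs_pos (mu (S n))).
    rewrite Rabs_right by nra. nra. }
  exists (fun n => x1 / (x0 * INR n) + chi n / x0),
    (fun n => s * a n + b n + b (pred n) - x0 * c * Rpower (INR n) (be - 1)).
  split.
  - exact Px0.
  - unfold c; lra.
  - exact Hbe.
  - exact hb.
  - intros n Hn. rewrite Hb by exact Hn. pose proof (INR_ge1 n Hn). field. lra.
  - intros n Hn. ring.
  - apply (ex_series_dominated _ (fun n => Rabs x1 / x0 * Rpower (INR (S n)) (- (3 / 2)) + / x0 * (sqrt (INR (S n)) * Rabs (chi (S n))))).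
    + intros n.
      pose proof (INR_S_ge1 n) as Pn. specialize (Psq n).
      rewrite Rabs_mult, Rabs_Rabsolu, (Rabs_right (Rpower _ _)) by (apply Rgt_ge, Rpower_pos).
      assert (H1 : Rabs (x1 / (x0 * INR (S n)) + chi (S n) / x0) <= Rabs x1 / x0 * Rpower (INR (S n)) (-1) + / x0 * Rabs (chi (S n))).
      { apply Rle_trans with (1 := Rabs_triang _ _). right. unfold Rdiv.
        rewrite !Rabs_mult, !Rabs_inv, Rabs_mult, (Rabs_right x0), (Rabs_right (INR (S n))) by lra.
        replace (Rpower (INR (S n)) (-1)) with (/ INR (S n)).
        - field. lra.
        - change (-1) with (- (1)). rewrite Rpower_Ropp, Rpower_1 by lra. reflexivity. }
      assert (H2 : Rpower (INR (S n)) (- (1 / 2)) <= 1).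
      { apply Rpower_le_1; lra. }
      pose proof (Rpower_pos (INR (S n)) (- (1 / 2))) as P1.
      assert (H3 : Rpower (INR (S n)) (- (3 / 2)) = Rpower (INR (S n)) (- (1 / 2)) * Rpower (INR (S n)) (-1)).
      { rewrite <- Rpower_plus. f_equal. field. }
      apply Rle_trans with (1 := Rmult_le_compat_l _ _ _ (Rlt_le _ _ P1) H1).
      rewrite H3. rewrite Rmult_plus_distr_l. apply Rplus_le_compat; [right; ring|].
      assert (P2 : 0 <= / x0 * Rabs (chi (S n))).
      { apply Rmult_le_pos; [apply Rlt_le, Rinv_0_lt_compat, Px0|apply Rabs_pos]. }
      nra.
    + apply (ex_series_plus (fun n => Rabs x1 / x0 * Rpower (INR (S n)) (- (3 / 2))) (fun n => / x0 * (sqrt (INR (S n)) * Rabs (chi (S n))))).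
      * apply (ex_series_scal (Rabs x1 / x0) (fun n => Rpower (INR (S n)) (- (3 / 2)))). apply ex_series_Rpower; lra.
      * apply (ex_series_scal (/ x0) (fun n => sqrt (INR (S n)) * Rabs (chi (S n))) Hchi).
  - replace (Finite 0) with (Finite (x1 / x0 * 0 + / x0 * 0)) by (f_equal; ring).
    assert (Hc0 : is_lim_seq chi 0).
    { apply is_lim_seq_incr_1. apply is_lim_seq_abs_0.
      apply is_lim_seq_le_le with (fun _ => 0) (fun n => sqrt (INR (S n)) * Rabs (chi (S n))).
      - intros n. specialize (Psq n). pose proof (Rabs_pos (chi (S n))). split; nra.
      - apply is_lim_seq_const.
      - apply (ex_series_lim_0 _ Hchi). }
    apply is_lim_seq_ext_loc with (fun n => x1 / x0 * Rpower (INR n) (- (1)) + / x0 * chi n).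
    { exists 1%nat. intros n Hn. pose proof (INR_ge1 n Hn). rewrite Rpower_Ropp, Rpower_1 by lra. field. lra. }
    apply is_lim_seq_plus'; apply is_lim_seq_mult'; try apply is_lim_seq_const; [apply is_lim_Rpower_neg; lra|exact Hc0].
  - apply ex_series_incr_1.
    destruct (Rpower_diff2 be) as [K1 [PK1 HK1]]. destruct (Rpower_diff1 (be - 1)) as [K2 [PK2 HK2]].
    set (K := x0 * K1 + x0 * be * K2 + Rabs x1 * K2).
    apply (ex_series_dominated _ (fun n => sqrt (INR (S (S n))) * (Rabs (chi (S (S n))) + Rabs (mu (S (S n))))
       + sqrt (INR (S n)) * Rabs (chi (S n)) + K * Rpower (INR (S n)) (- (3 / 2)))).
    + intros k. set (n := S (S k)). set (m := S k). change (pred n) with m.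
      rewrite Rabs_mult, Rabs_Rabsolu, (Rabs_right (Rpower _ _)) by (apply Rgt_ge, Rpower_pos).
      pose proof (INR_ge1 n ltac:(unfold n; lia)) as Pn. pose proof (INR_ge1 m ltac:(unfold m; lia)) as Pm.
      assert (Hnm : INR n = INR m + 1) by (unfold n, m; rewrite <- S_INR; reflexivity).
      rewrite (Ha n), (Hb n), (Hb m) by (unfold n, m; lia).
      set (D1 := Rpower (INR n) be - Rpower (INR m) be - be * Rpower (INR m) (be - 1)).
      set (D2 := Rpower (INR n) (be - 1) - Rpower (INR m) (be - 1)).
      assert (HD1 : Rabs D1 <= K1 * Rpower (INR m) (be - 2)).
      { unfold D1. rewrite Hnm. apply HK1, Pm. }
      assert (HD2 : Rabs D2 <= K2 * Rpower (INR m) (be - 2)).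
      { unfold D2. replace (be - 2) with (be - 1 - 1) by ring. apply HK2; lra. }
      (* the remainders D1, D2 of the two power differences are O(n^(be-2)) *)
      match goal with |- _ * Rabs ?X <= _ => replace X with
        (Rpower (INR n) be * (s * mu n + chi n) + Rpower (INR m) be * chi m
          + (- x0 * D1 + x0 * be * D2 - x1 * D2)) end.
      2:{ rewrite Hxc, Hy0. unfold D1, D2.
          rewrite <- (Rpower_pred_mult (INR n) be), <- (Rpower_pred_mult (INR m) be) by lra.
          replace (s * (Rpower (INR n) (be - 1) * INR n * (-2 * s * x0 + y1 / INR n + mu n)))
            with (Rpower (INR n) (be - 1) * INR n * (-2 * (s * s) * x0 + s * y1 / INR n + s * mu n)) by (field; lra).
          rewrite Hs. field. lra. }
      assert (Hin : Rabs (Rpower (INR n) be * (s * mu n + chi n) + Rpower (INR m) be * chi m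
          + (- x0 * D1 + x0 * be * D2 - x1 * D2)) <=
          Rpower (INR n) be * (Rabs (chi n) + Rabs (mu n)) + Rpower (INR m) be * Rabs (chi m) + K * Rpower (INR m) (be - 2)).
      { apply Rle_trans with (1 := Rabs_triang _ _). apply Rplus_le_compat.
        - apply Rle_trans with (1 := Rabs_triang _ _). rewrite !Rabs_mult, !(Rabs_right (Rpower _ _)) by (apply Rgt_ge, Rpower_pos).
          apply Rplus_le_compat_r. apply Rmult_le_compat_l; [apply Rlt_le, Rpower_pos|].
          apply Rle_trans with (1 := Rabs_triang _ _). rewrite Rabs_mult, Hs1. lra.
        - unfold Rminus at 1. apply Rle_trans with (1 := Rabs_triang _ _).
          apply Rle_trans with (1 := Rplus_le_compat_r _ _ _ (Rabs_triang _ _)).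
          rewrite Rabs_Ropp, !Rabs_mult, Rabs_Ropp, (Rabs_right x0), (Rabs_right be) by lra.
          unfold K. pose proof (Rabs_pos x1).
          assert (x0 * Rabs D1 <= x0 * (K1 * Rpower (INR m) (be - 2))) by (apply Rmult_le_compat_l; lra).
          assert (x0 * be * Rabs D2 <= x0 * be * (K2 * Rpower (INR m) (be - 2))) by (apply Rmult_le_compat_l; nra).
          assert (Rabs x1 * Rabs D2 <= Rabs x1 * (K2 * Rpower (INR m) (be - 2))) by (apply Rmult_le_compat_l; lra).
          lra. }
      set (om := be - 1 / 2) in *.
      assert (Hpm : Rpower (INR n) (- om) <= Rpower (INR m) (- om)) by (apply Rpower_le_base_neg; unfold om; lra).
      assert (Q1 : Rpower (INR n) (- om) * Rpower (INR n) be = sqrt (INR n)).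
      { rewrite <- Rpower_plus, <- Rpower_sqrt by lra. f_equal. unfold om. field. }
      assert (Q2 : Rpower (INR m) (- om) * Rpower (INR m) be = sqrt (INR m)).
      { rewrite <- Rpower_plus, <- Rpower_sqrt by lra. f_equal. unfold om. field. }
      assert (Q3 : Rpower (INR m) (- om) * Rpower (INR m) (be - 2) = Rpower (INR m) (- (3 / 2))).
      { rewrite <- Rpower_plus. f_equal. unfold om. field. }
      pose proof (Rpower_pos (INR n) (- om)) as Pno.
      apply Rle_trans with (1 := Rmult_le_compat_l _ _ _ (Rlt_le _ _ Pno) Hin).
      assert (PK : 0 <= K).
      { unfold K. pose proof (Rabs_pos x1). assert (0 <= x0 * K1) by nra. assert (0 <= x0 * be * K2) by (repeat apply Rmult_le_pos; lra). nra. }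
      assert (R1 : Rpower (INR n) (- om) * (Rpower (INR m) be * Rabs (chi m)) <= sqrt (INR m) * Rabs (chi m)).
      { rewrite <- Q2, Rmult_assoc. apply Rmult_le_compat_r; [|exact Hpm].
        apply Rmult_le_pos; [apply Rlt_le, Rpower_pos|apply Rabs_pos]. }
      assert (R2 : Rpower (INR n) (- om) * (K * Rpower (INR m) (be - 2)) <= K * Rpower (INR m) (- (3 / 2))).
      { rewrite <- Q3. replace (K * (Rpower (INR m) (- om) * Rpower (INR m) (be - 2))) with (Rpower (INR m) (- om) * (K * Rpower (INR m) (be - 2))) by ring.
        apply Rmult_le_compat_r; [|exact Hpm]. apply Rmult_le_pos; [exact PK|apply Rlt_le, Rpower_pos]. }
      assert (R3 : Rpower (INR n) (- om) * (Rpower (INR n) be * (Rabs (chi n) + Rabs (mu n))) = sqrt (INR n) * (Rabs (chi n) + Rabs (mu n))).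
      { rewrite <- Q1. ring. }
      replace (Rpower (INR n) (- om) *
        (Rpower (INR n) be * (Rabs (chi n) + Rabs (mu n)) + Rpower (INR m) be * Rabs (chi m) + K * Rpower (INR m) (be - 2)))
        with (Rpower (INR n) (- om) * (Rpower (INR n) be * (Rabs (chi n) + Rabs (mu n))) + Rpower (INR n) (- om) * (Rpower (INR m) be * Rabs (chi m)) + Rpower (INR n) (- om) * (K * Rpower (INR m) (be - 2))) by ring.
      rewrite R3. lra.
    + apply (ex_series_plus (fun n => sqrt (INR (S (S n))) * (Rabs (chi (S (S n))) + Rabs (mu (S (S n)))) + sqrt (INR (S n)) * Rabs (chi (S n))) (fun n => K * Rpower (INR (S n)) (- (3 / 2)))).
      * apply (ex_series_plus (fun n => sqrt (INR (S (S n))) * (Rabs (chi (S (S n))) + Rabs (mu (S (S n))))) (fun n => sqrt (INR (S n)) * Rabs (chi (S n)))).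
        -- apply (ex_series_incr_1 (fun n => sqrt (INR (S n)) * (Rabs (chi (S n)) + Rabs (mu (S n))))). exact Hsum.
        -- exact Hchi.
      * apply (ex_series_scal K (fun n => Rpower (INR (S n)) (- (3 / 2)))). apply ex_series_Rpower; lra.
Qed.

(** * Bounds for the Nevanlinna matrix *)

Definition solves (a b : nat -> R) (z : C) (u : nat -> C) : Prop :=
  forall n, u (S (S n)) = (((z - a (S n)) * u (S n) - b n * u n) / b (S n))%C.

Section Flip.
Context (a b : nat -> R) (s : R).
Hypothesis hb : forall n, 0 < b n.
Hypothesis Hs : s * s = 1.

Lemma Rabs_sign : Rabs s = 1.
Proof.
  assert (H : Rabs s * Rabs s = 1) by (rewrite <- Rabs_mult, Hs; apply Rabs_R1).
  pose proof (Rabs_pos s). nra.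
Qed.

Lemma flip_real (u : nat -> R) :
  (forall n, b (S n) * u (S (S n)) + a (S n) * u (S n) + b n * u n = 0) ->
  forall n, (1 <= n)%nat ->
   b n * (s ^ S n * u (S n)) + s * a n * (s ^ n * u n) + b (pred n) * (s ^ pred n * u (pred n)) = 0.
Proof.
  intros Hu [|n] Hn; [lia|]. simpl pred.
  replace (b (S n) * (s ^ S (S n) * u (S (S n))) + s * a (S n) * (s ^ S n * u (S n)) + b n * (s ^ n * u n))
    with ((s * s) * s ^ n * (b (S n) * u (S (S n)) + a (S n) * u (S n)) + s ^ n * (b n * u n)) by (simpl; ring).
  specialize (Hu n). rewrite Hs.
  replace (b (S n) * u (S (S n)) + a (S n) * u (S n)) with (- (b n * u n)) by lra. ring.
Qed.

(** Multiplying u_n by s^n changes the sign of both off-diagonal terms relative to the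
    diagonal one, that is, (a, z) into (s a, s z). *)
Lemma flip_complex (z : C) (u : nat -> C) : solves a b z u ->
  forall n, (1 <= n)%nat ->
   (b n * (RtoC (s ^ S n) * u (S n)) + RtoC (s * a n) * (RtoC (s ^ n) * u n) + b (pred n) * (RtoC (s ^ pred n) * u (pred n))
    = (s * z) * (RtoC (s ^ n) * u n))%C.
Proof.
  intros Hu [|n] Hn; [lia|]. simpl pred. rewrite (Hu n).
  assert (Hb : RtoC (b (S n)) <> RtoC 0) by (apply RtoC_neq0, Rgt_not_eq, hb).
  replace (s ^ S (S n)) with (s ^ n) by (simpl; rewrite <- Rmult_assoc, Hs; ring).
  replace (s ^ S n) with (s * s ^ n) by reflexivity.
  rewrite !RtoC_mult.
  assert (HsC : (s * s = 1)%C) by (rewrite <- RtoC_mult, Hs; reflexivity).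
  replace (s * z * (s * RtoC (s ^ n) * u (S n)))%C with ((s * s) * (z * RtoC (s ^ n) * u (S n)))%C by ring.
  replace (s * a (S n) * (s * RtoC (s ^ n) * u (S n)))%C with ((s * s) * (a (S n) * RtoC (s ^ n) * u (S n)))%C by ring.
  rewrite HsC. field. exact Hb.
Qed.

Lemma Rabs_sign_pow n : Rabs (s ^ n) = 1.
Proof. rewrite <- RPow_abs, Rabs_sign. apply pow1. Qed.

End Flip.

Section Growth.
Context (a b : nat -> R) (x0 c be s : R) (h e : nat -> R).
Hypothesis Hs : s * s = 1.
Hypothesis Hcr : critical (fun n => s * a n) b x0 c be h e.

Let hb : forall n, 0 < b n := cr_pos _ _ _ _ _ _ _ Hcr.
Let om := be - 1 / 2.
Let rho := 1 / (2 * (be - 1)).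

Definition decay_weight K n := match n with O => (Rabs (p_zero a b 0) + Rabs (q_zero a b 0)) ^ 2
   | S _ => K * Rpower (INR n) (- om) end.

Lemma zero_solutions_decay : exists K, 0 < K /\ forall n, (Rabs (p_zero a b n) + Rabs (q_zero a b n)) ^ 2 <= decay_weight K n.
Proof.
  assert (Hg : forall u : nat -> R, (forall n, b (S n) * u (S (S n)) + a (S n) * u (S n) + b n * u n = 0) ->
    exists K, 0 < K /\ forall n, (1 <= n)%nat -> Rabs (u n) <= K * Rpower (INR n) (- (om / 2))).
  { intros u Hu.
    destruct (solution_bound _ _ _ _ _ _ _ Hcr (fun n => s ^ n * u n)) as [K [PK HK]].
    - apply flip_real; assumption.
    - exists K; split; [exact PK|]. intros n Hn. specialize (HK n Hn).
      rewrite Rabs_mult, (Rabs_sign_pow s Hs), Rmult_1_l in HK. exact HK. }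
  destruct (Hg _ (p_zero_rec a b hb)) as [Kp [PKp HKp]]. destruct (Hg _ (q_zero_rec a b hb)) as [Kq [PKq HKq]].
  exists ((Kp + Kq) ^ 2). split; [apply pow_lt; lra|]. intros [|n]; [apply Rle_refl|]. unfold decay_weight.
  specialize (HKp (S n) ltac:(lia)). specialize (HKq (S n) ltac:(lia)).
  replace (Rpower (INR (S n)) (- om)) with (Rpower (INR (S n)) (- (om / 2)) ^ 2).
  - rewrite <- Rpow_mult_distr. apply pow_incr. split; [|lra].
    pose proof (Rabs_pos (p_zero a b (S n))). pose proof (Rabs_pos (q_zero a b (S n))). lra.
  - simpl pow. rewrite Rmult_1_r, <- Rpower_plus. f_equal. field.
Qed.

Lemma decay_weight_summable K : ex_series (decay_weight K).
Proof.
  pose proof (cr_be _ _ _ _ _ _ _ Hcr) as Pbe.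
  apply ex_series_incr_1. apply (ex_series_scal K (fun n => Rpower (INR (S n)) (- om))).
  apply ex_series_Rpower. unfold om; lra.
Qed.

Lemma zero_solutions_square_summable : ex_series (fun n => p_zero a b n ^ 2) /\ ex_series (fun n => q_zero a b n ^ 2).
Proof.
  destruct zero_solutions_decay as [K [_ HK]].
  split; apply ex_series_dominated with (2 := decay_weight_summable K); intros n;
    apply Rle_trans with (2 := HK n); rewrite <- RPow_abs; apply pow_incr;
    pose proof (Rabs_pos (p_zero a b n)); pose proof (Rabs_pos (q_zero a b n)); lra.
Qed.

Lemma coef_converge (z : C) (u : nat -> C) : solves a b z u ->
  climit (coef_p a b z u) (coef_p_lim a b z u) /\ climit (coef_q a b z u) (coef_q_lim a b z u).
Proof.
  intros Hu. destruct zero_solutions_decay as [K [_ HK]].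
  apply coef_limits with (decay_weight K); auto. apply decay_weight_summable.
Qed.

Lemma coef_lim_le (z : C) (u : nat -> C) (M : R) (N : nat) : solves a b z u ->
  (forall n, (N <= n)%nat -> Cmod (coef_p a b z u n) + Cmod (coef_q a b z u n) <= M) ->
  Cmod (coef_p_lim a b z u) + Cmod (coef_q_lim a b z u) <= M.
Proof.
  intros Hu HM. destruct (coef_converge z u Hu) as [H1 H2].
  apply (is_lim_seq_le_loc (fun n => Cmod (coef_p a b z u n) + Cmod (coef_q a b z u n)) (fun _ => M)
    (Cmod (coef_p_lim a b z u) + Cmod (coef_q_lim a b z u)) M).
  - exists N. exact HM.
  - apply is_lim_seq_plus'; apply climit_Cmod; assumption.
  - apply is_lim_seq_const.
Qed.

(** N is the turning point.  Up to N the coefficients are sums of at most N terms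
    controlled by [bound_before_turning_point]; from N on [coef_growth] applies with
    the decay of p(0) and q(0), and the primitive of n^(-om) is of order N^(1 - om),
    so that |z| N^(1 - om) ~ N^(1/2). *)
Lemma coef_lim_upper (D : R) : 0 <= D -> exists K, 0 < K /\
  forall (z : C) (u : nat -> C), 1 <= Cmod z -> solves a b z u ->
  Cmod (u 0%nat) <= 1 -> Cmod (u 1%nat) <= D * Cmod z ->
  Cmod (coef_p a b z u 0) <= 1 -> Cmod (coef_q a b z u 0) <= 1 ->
  Cmod (coef_p_lim a b z u) + Cmod (coef_q_lim a b z u) <= exp (K * Rpower (Cmod z) rho).
Proof.
  intros PD.
  pose proof (cr_be _ _ _ _ _ _ _ Hcr) as Pbe.
  destruct (bound_before_turning_point _ _ _ _ _ _ _ Hcr) as [K1 [PK1 HK1]].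
  destruct zero_solutions_decay as [Km [PKm HKm]].
  set (Kp := Rabs (p_zero a b 0) + Rabs (q_zero a b 0) + Km + 1).
  assert (HKp : forall n, Rabs (p_zero a b n) + Rabs (q_zero a b n) <= Kp).
  { intros n. unfold Kp. destruct n as [|n]; [lra|]. specialize (HKm (S n)). unfold decay_weight in HKm.
    assert (Rpower (INR (S n)) (- om) <= 1).
    { apply Rpower_le_1; [apply INR_S_ge1|unfold om; lra]. }
    pose proof (Rabs_pos (p_zero a b (S n))). pose proof (Rabs_pos (q_zero a b (S n))).
    pose proof (Rabs_pos (p_zero a b 0)). pose proof (Rabs_pos (q_zero a b 0)).
    pose proof (Rpower_pos (INR (S n)) (- om)). nra. }
  assert (PKp : 1 <= Kp) by (unfold Kp; pose proof (Rabs_pos (p_zero a b 0)); pose proof (Rabs_pos (q_zero a b 0)); lra).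
  set (F := D + b 0%nat * (D + 1) + 1).
  pose proof (hb 0) as Pb0.
  assert (PF : 1 <= F) by (unfold F; assert (0 <= b 0%nat * (D + 1)) by (apply Rmult_le_pos; lra); lra).
  set (C3 := Rpower 2 om / (om - 1)).
  assert (PC3 : 0 < C3) by (unfold C3; apply Rdiv_lt_0_compat; [apply Rpower_pos|unfold om; lra]).
  set (K2 := (2 + Kp * F) + (8 + K1) + Km * C3).
  assert (PKF : 1 <= Kp * F) by nra.
  assert (PKC : 0 < Km * C3) by nra.
  assert (PK2 : 0 < K2) by (unfold K2; lra).
  exists (2 * K2). split; [lra|]. intros z u Hz Hu Hu0 Hu1 HX0 HY0. set (r := Cmod z) in *.
  destruct (nfloor_ex (Rpower r (1 / (be - 1)))) as [N1 [HN1 HN2]]; [apply Rlt_le, Rpower_pos|].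
  set (N := S N1).
  assert (HNN : Rpower r (1 / (be - 1)) <= INR N <= 2 * Rpower r (1 / (be - 1))).
  { unfold N. rewrite S_INR.
    assert (1 <= Rpower r (1 / (be - 1))).
    { apply Rpower_ge_1; [exact Hz|]. apply Rdiv_le_0_compat; lra. }
    lra. }
  pose proof (INR_ge1 N ltac:(unfold N; lia)) as PN. pose proof (Rpower_pos r (1 / (be - 1))) as PR.
  assert (Hpow : Rpower (Rpower r (1 / (be - 1))) (be - 1) = r).
  { rewrite Rpower_mult. replace (1 / (be - 1) * (be - 1)) with 1 by (field; lra). apply Rpower_1; lra. }
  assert (HrN : r <= Rpower (INR N) (be - 1)).
  { rewrite <- Hpow at 1. apply Rpower_le_base; lra. }
  assert (HNr : Rpower (INR N) (be - 1) <= 4 * r).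
  { apply Rle_trans with (Rpower (2 * Rpower r (1 / (be - 1))) (be - 1)); [apply Rpower_le_base; lra|].
    rewrite <- Rpower_mult_distr, Hpow by lra. apply Rmult_le_compat_r; [lra|].
    apply Rle_trans with (Rpower 2 1); [apply Rle_Rpower; lra|rewrite Rpower_1; lra]. }
  assert (HrN1 : r <= INR N).
  { apply Rle_trans with (1 := HrN). apply Rle_trans with (Rpower (INR N) 1); [apply Rle_Rpower; lra|rewrite Rpower_1; lra]. }
  set (t := sqrt (INR N)).
  assert (Pt : 1 <= t) by (unfold t; rewrite <- sqrt_1; apply sqrt_le_1_alt; exact PN).
  assert (Htt : t * t = INR N) by (apply sqrt_sqrt; lra).
  assert (Hsz : Cmod (s * z) = r) by (rewrite Cmod_mult, Cmod_R, (Rabs_sign s Hs); unfold r; ring).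
  (* u itself, up to the turning point *)
  assert (Hcrude : forall n, (n <= N)%nat -> Cmod (u n) <= F * INR N ^ 2 * exp (K1 * t)).
  { intros n Hn. pose proof (exp_ineq1_le (K1 * t)) as Pe. assert (Pe1 : 1 <= exp (K1 * t)) by nra.
    assert (PN2 : 1 <= INR N ^ 2) by nra.
    destruct n as [|n].
    { apply Rle_trans with 1; [exact Hu0|]. assert (1 <= F * INR N ^ 2) by nra. nra. }
    pose proof (HK1 (s * z)%C (fun n => RtoC (s ^ n) * u n)%C N) as HC. rewrite Hsz in HC.
    specialize (HC Hz HrN HNr (flip_complex a b s hb Hs z u Hu) (S n) ltac:(lia)).
    cbv beta in HC. fold t in HC.
    rewrite (Cmod_mult (RtoC (s ^ S n))), Cmod_R, (Rabs_sign_pow s Hs), Rmult_1_l in HC.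
    apply Rle_trans with (1 := HC). apply Rmult_le_compat_r; [lra|].
    rewrite Cmod_mult, Cmod_R, (Rabs_sign_pow s Hs), Rmult_1_l.
    assert (Hd : Cmod (RtoC (s ^ 1) * u 1%nat - RtoC (s ^ 0) * u 0%nat) <= D * r + 1).
    { apply Rle_trans with (1 := Cmod_triangle _ _). rewrite Cmod_opp, !Cmod_mult, !Cmod_R, !(Rabs_sign_pow s Hs). lra. }
    assert (Hsr : 0 <= sqrt r <= INR N).
    { split; [apply sqrt_pos|]. apply Rle_trans with (2 := HrN1). rewrite <- (sqrt_square r) at 2 by lra.
      apply sqrt_le_1_alt. nra. }
    assert (Hur : Cmod (u 1%nat) <= D * INR N) by (apply Rle_trans with (1 := Hu1); apply Rmult_le_compat_l; lra).
    assert (H1 : sqrt r * Cmod (u 1%nat) <= INR N * (D * INR N)).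
    { apply Rmult_le_compat; [lra|apply Cmod_ge_0|lra|exact Hur]. }
    assert (H2 : b 0%nat * Cmod (RtoC (s ^ 1) * u 1%nat - RtoC (s ^ 0) * u 0%nat) <= b 0%nat * ((D + 1) * INR N ^ 2)).
    { apply Rmult_le_compat_l; [lra|]. apply Rle_trans with (1 := Hd). 
      assert (D * r <= D * INR N ^ 2) by (apply Rmult_le_compat_l; nra). nra. }
    unfold F. nra. }
  (* the coefficients at the turning point *)
  set (B := r * Kp * (F * INR N ^ 2 * exp (K1 * t))).
  assert (PB : 0 <= B).
  { unfold B. pose proof (exp_pos (K1 * t)). repeat apply Rmult_le_pos; try lra. }
  assert (Hacc : forall n, (n <= N)%nat -> Cmod (coef_p a b z u n) + Cmod (coef_q a b z u n) <= 2 + INR n * B).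
  { induction n as [|n IH]; intros Hn; [simpl INR; lra|]. specialize (IH ltac:(lia)).
    rewrite coef_p_S, coef_q_S, S_INR.
    pose proof (Cmod_triangle (coef_p a b z u n) (z * (q_zero a b n * u n))) as T1.
    pose proof (Cmod_triangle (coef_q a b z u n) (z * (p_zero a b n * u n))) as T2.
    rewrite !Cmod_mult, Cmod_R in T1, T2. fold r in T1, T2.
    assert (T3 : r * ((Rabs (p_zero a b n) + Rabs (q_zero a b n)) * Cmod (u n)) <= B).
    { unfold B. rewrite Rmult_assoc. apply Rmult_le_compat_l; [lra|].
      pose proof (Rabs_pos (p_zero a b n)). pose proof (Rabs_pos (q_zero a b n)).
      apply Rmult_le_compat; [lra|apply Cmod_ge_0|apply HKp|apply Hcrude; lia]. }
    lra. }
  assert (HE : 2 + INR N * B <= exp ((2 + Kp * F + (8 + K1)) * t)).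
  { assert (Het : t <= exp t) by (pose proof (exp_ineq1_le t); lra).
    assert (HN4 : INR N ^ 4 <= exp (8 * t)).
    { replace (exp (8 * t)) with (exp t ^ 8) by (simpl; rewrite Rmult_1_r, <- !exp_plus; f_equal; ring).
      rewrite <- Htt. replace ((t * t) ^ 4) with (t ^ 8) by ring. apply pow_incr. lra. }
    pose proof (exp_pos (K1 * t)) as P1.
    assert (P2 : 1 <= exp ((8 + K1) * t)) by (pose proof (exp_ineq1_le ((8 + K1) * t)); nra).
    assert (HB : INR N * B <= Kp * F * exp ((8 + K1) * t)).
    { replace ((8 + K1) * t) with (8 * t + K1 * t) by ring. rewrite exp_plus. unfold B.
      apply Rle_trans with (Kp * F * (INR N ^ 4 * exp (K1 * t))).
      - replace (INR N * (r * Kp * (F * INR N ^ 2 * exp (K1 * t)))) with (Kp * F * (r * INR N ^ 3 * exp (K1 * t))) by ring.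
        apply Rmult_le_compat_l; [lra|]. apply Rmult_le_compat_r; [lra|].
        replace (INR N ^ 4) with (INR N * INR N ^ 3) by ring. apply Rmult_le_compat_r; [|exact HrN1].
        apply pow_le; lra.
      - apply Rmult_le_compat_l; [lra|]. apply Rmult_le_compat_r; lra. }
    rewrite Rmult_plus_distr_r, exp_plus.
    apply Rle_trans with ((2 + Kp * F) * exp ((8 + K1) * t)); [nra|].
    apply Rmult_le_compat_r; [lra|]. pose proof (exp_ineq1_le ((2 + Kp * F) * t)). nra. }
  (* the coefficients beyond the turning point *)
  apply (coef_lim_le z u _ N Hu). intros n Hn.
  set (Th := fun k => - (r * Km * C3 * Rpower (INR k) (1 - om))).
  assert (HG : Cmod (coef_p a b z u n) + Cmod (coef_q a b z u n) <=
     (Cmod (coef_p a b z u N) + Cmod (coef_q a b z u N)) * exp (Th n - Th N)).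
  { apply (gronwall (fun k => Cmod (coef_p a b z u k) + Cmod (coef_q a b z u k)) Th N n Hn).
    intros k Hk. apply Rle_trans with (1 := coef_growth a b hb z u Hu k).
    apply Rmult_le_compat_l.
    { pose proof (Cmod_ge_0 (coef_p a b z u k)). pose proof (Cmod_ge_0 (coef_q a b z u k)). lra. }
    apply Rle_trans with (2 := exp_ineq1_le _). fold r. apply Rplus_le_compat_l.
    pose proof (HKm k) as W. destruct k as [|k]; [unfold N in Hk; lia|]. unfold decay_weight in W.
    pose proof (Rpower_primitive om ltac:(unfold om; lra) ltac:(unfold om; lra) (S k) ltac:(lia)) as Hp.
    replace (Rpower 2 om / (1 - om)) with (- C3) in Hp by (unfold C3; field; unfold om; lra).
    apply Rle_trans with (r * (Km * Rpower (INR (S k)) (- om))); [apply Rmult_le_compat_l; lra|].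
    unfold Th. 
    apply Rle_trans with (r * (Km * (- C3 * (Rpower (INR (S (S k))) (1 - om) - Rpower (INR (S k)) (1 - om))))).
    - apply Rmult_le_compat_l; [lra|]. apply Rmult_le_compat_l; lra.
    - right. ring. }
  apply Rle_trans with (1 := HG).
  assert (HTh : Th n - Th N <= Km * C3 * t).
  { unfold Th. pose proof (Rpower_pos (INR n) (1 - om)) as Pn.
    assert (0 <= r * Km * C3) by (apply Rmult_le_pos; [apply Rmult_le_pos|]; lra).
    assert (0 <= r * Km * C3 * Rpower (INR n) (1 - om)) by (apply Rmult_le_pos; lra).
    assert (HrNt : r * Rpower (INR N) (1 - om) <= t).
    { apply Rle_trans with (Rpower (INR N) (be - 1) * Rpower (INR N) (1 - om)).
      - apply Rmult_le_compat_r; [apply Rlt_le, Rpower_pos|exact HrN].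
      - right. unfold t. rewrite <- Rpower_plus, <- Rpower_sqrt by lra. f_equal. unfold om. field. }
    assert (r * Km * C3 * Rpower (INR N) (1 - om) <= Km * C3 * t).
    { replace (r * Km * C3 * Rpower (INR N) (1 - om)) with (Km * C3 * (r * Rpower (INR N) (1 - om))) by ring.
      apply Rmult_le_compat_l; lra. }
    lra. }
  apply Rle_trans with (exp ((2 + Kp * F + (8 + K1)) * t) * exp (Km * C3 * t)).
  { apply Rmult_le_compat; [|apply Rlt_le, exp_pos| |apply exp_le, HTh].
    - pose proof (Cmod_ge_0 (coef_p a b z u N)). pose proof (Cmod_ge_0 (coef_q a b z u N)). lra.
    - apply Rle_trans with (2 := HE). apply Hacc. lia. }
  rewrite <- exp_plus. apply exp_le.
  replace ((2 + Kp * F + (8 + K1)) * t + Km * C3 * t) with (K2 * t) by (unfold K2; ring).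
  rewrite (Rmult_comm 2), Rmult_assoc. apply Rmult_le_compat_l; [lra|].
  apply Rsqr_incr_0_var; [|pose proof (Rpower_pos r rho); lra]. unfold Rsqr. rewrite Htt.
  apply Rle_trans with (1 := proj2 HNN).
  replace (2 * Rpower r rho * (2 * Rpower r rho)) with (4 * (Rpower r rho * Rpower r rho)) by ring.
  rewrite <- Rpower_plus. replace (rho + rho) with (1 / (be - 1)) by (unfold rho; field; lra). lra.
Qed.

Lemma p_solves z : solves a b z (fun n => poly_p a b n z).
Proof. intros n. apply jacobi_solution_step. Qed.

Lemma q_solves z : solves a b z (fun n => poly_q a b n z).
Proof. intros n. apply jacobi_solution_step. Qed.

Lemma coef_q_start_p z : coef_q a b z (fun n => poly_p a b n z) 0 = RtoC 0.
Proof.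
  unfold coef_q; simpl. unfold poly_p; simpl. field. apply RtoC_neq0, Rgt_not_eq, hb.
Qed.

Lemma coef_q_start_q z : coef_q a b z (fun n => poly_q a b n z) 0 = RtoC 1.
Proof.
  unfold coef_q; simpl. unfold poly_q; simpl. field. apply RtoC_neq0, Rgt_not_eq, hb.
Qed.

Lemma coef_p_start_p z : coef_p a b z (fun n => poly_p a b n z) 0 = (- (1))%C.
Proof. unfold coef_p, poly_p; simpl. ring. Qed.

Lemma coef_p_start_q z : coef_p a b z (fun n => poly_q a b n z) 0 = RtoC 0.
Proof. unfold coef_p, poly_q; simpl. ring. Qed.

Lemma CSeries_ext (f g : nat -> C) : (forall n, f n = g n) -> CSeries f = CSeries g.
Proof. intros H. unfold CSeries. f_equal; apply Series_ext; intros n; rewrite H; reflexivity. Qed.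

Lemma nev_B_coef z : nev_B a b z = coef_p_lim a b z (fun n => poly_p a b n z).
Proof.
  rewrite coef_p_lim_eq, coef_p_start_p. unfold nev_B. do 2 f_equal. apply CSeries_ext.
  intros n. rewrite (poly_q_zero a b hb). reflexivity.
Qed.

Lemma nev_A_coef z : nev_A a b z = coef_p_lim a b z (fun n => poly_q a b n z).
Proof.
  rewrite coef_p_lim_eq, coef_p_start_q, Cplus_0_l. unfold nev_A. f_equal. apply CSeries_ext.
  intros n. rewrite (poly_q_zero a b hb). reflexivity.
Qed.

Lemma nev_D_coef z : nev_D a b z = coef_q_lim a b z (fun n => poly_p a b n z).
Proof.
  rewrite coef_q_lim_eq, coef_q_start_p, Cplus_0_l. unfold nev_D. f_equal. apply CSeries_ext.
  intros n. rewrite (poly_p_zero a b hb). reflexivity.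
Qed.

Lemma nev_C_coef z : nev_C a b z = coef_q_lim a b z (fun n => poly_q a b n z).
Proof.
  rewrite coef_q_lim_eq, coef_q_start_q. unfold nev_C. do 2 f_equal. apply CSeries_ext.
  intros n. rewrite (poly_p_zero a b hb). reflexivity.
Qed.

Lemma mat_norm_nevanlinna z : mat_norm (nevanlinna a b z) =
  sqrt ((Cmod (nev_A a b z) ^ 2 + Cmod (nev_C a b z) ^ 2) + (Cmod (nev_B a b z) ^ 2 + Cmod (nev_D a b z) ^ 2)).
Proof.
  unfold mat_norm. f_equal. rewrite sum_Sn, sum_O. cbv beta. rewrite !sum_Sn, !sum_O. reflexivity.
Qed.

Lemma nevanlinna_upper : exists K, 0 < K /\ forall z, 1 <= Cmod z ->
  mat_norm (nevanlinna a b z) <= exp (K * Rpower (Cmod z) rho).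
Proof.
  pose proof (cr_be _ _ _ _ _ _ _ Hcr) as Pbe.
  set (D := (1 + Rabs (a 0%nat)) / b 0%nat). pose proof (hb 0) as Pb0. pose proof (Rabs_pos (a 0%nat)) as Pa0.
  assert (PD : 0 <= D) by (unfold D; apply Rdiv_le_0_compat; lra).
  destruct (coef_lim_upper D PD) as [K [PK HK]]. exists (K + 1). split; [lra|]. intros z Hz.
  assert (Hinv : Cmod (/ b 0%nat) = / b 0%nat).
  { rewrite <- RtoC_inv by lra. rewrite Cmod_R, Rabs_right; [reflexivity|]. apply Rgt_ge, Rinv_0_lt_compat, Pb0. }
  assert (Pi : 0 < / b 0%nat) by (apply Rinv_0_lt_compat, Pb0).
  assert (HP : Cmod (nev_B a b z) + Cmod (nev_D a b z) <= exp (K * Rpower (Cmod z) rho)).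
  { rewrite nev_B_coef, nev_D_coef. apply HK; [exact Hz|apply p_solves| | | |].
    - unfold poly_p; simpl. rewrite Cmod_1. lra.
    - unfold poly_p; simpl. unfold Cdiv. rewrite Cmod_mult, Hinv. unfold D, Rdiv.
      rewrite (Rmult_comm _ (/ b 0%nat)), (Rmult_comm _ (/ b 0%nat)), Rmult_assoc. apply Rmult_le_compat_l; [lra|].
      apply Rle_trans with (1 := Cmod_triangle _ _). rewrite Cmod_opp, Cmod_R. nra.
    - rewrite coef_p_start_p, Cmod_opp, Cmod_1. lra.
    - rewrite coef_q_start_p, Cmod_0. lra. }
  assert (HQ : Cmod (nev_A a b z) + Cmod (nev_C a b z) <= exp (K * Rpower (Cmod z) rho)).
  { rewrite nev_A_coef, nev_C_coef. apply HK; [exact Hz|apply q_solves| | | |].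
    - unfold poly_q; simpl. rewrite Cmod_0. lra.
    - unfold poly_q; simpl. unfold Cdiv. rewrite Cmult_1_l, Hinv. unfold D, Rdiv.
      assert (0 <= Rabs (a 0%nat) * / b 0%nat) by (apply Rmult_le_pos; lra). nra.
    - rewrite coef_p_start_q, Cmod_0. lra.
    - rewrite coef_q_start_q, Cmod_1. lra. }
  rewrite mat_norm_nevanlinna. set (E := exp (K * Rpower (Cmod z) rho)) in *.
  assert (PE : 0 < E) by apply exp_pos.
  pose proof (Cmod_ge_0 (nev_A a b z)). pose proof (Cmod_ge_0 (nev_B a b z)).
  pose proof (Cmod_ge_0 (nev_C a b z)). pose proof (Cmod_ge_0 (nev_D a b z)).
  apply Rle_trans with (2 * E).
  - rewrite <- (sqrt_square (2 * E)) by lra. apply sqrt_le_1_alt. nra.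
  - rewrite Rmult_plus_distr_r, exp_plus. fold E. rewrite Rmult_comm. apply Rmult_le_compat_l; [lra|].
    pose proof (exp_ineq1_le (1 * Rpower (Cmod z) rho)).
    assert (1 <= Rpower (Cmod z) rho).
    { apply Rpower_ge_1; [exact Hz|]. unfold rho. apply Rdiv_le_0_compat; lra. }
    lra.
Qed.

(** At z = s i r the sequence s^n p_n(z) solves the recurrence for s a at the spectral
    parameter i r.  By [coef_wronskian] the product of the coefficients of p(z) is at least r times the sum of |p_k(z)|^2,
    and the inequality survives the limit n -> oo. *)
Lemma nevanlinna_lower : exists c0 R0, 0 < c0 /\ 0 < R0 /\ forall r, R0 <= r ->
  exists z, Cmod z = r /\ exp (c0 * Rpower r rho) <= mat_norm (nevanlinna a b z).
Proof.
  destruct (square_sum_lower_bound _ _ _ _ _ _ _ Hcr) as [c0 [R0 [Pc0 [PR0 HL]]]]. fold rho in HL.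
  exists (c0 / 2), R0. split; [lra|]. split; [lra|]. intros r Hr.
  set (z := (RtoC s * (0, r))%C).
  assert (Hz0 : Cmod (0, r) = r).
  { unfold Cmod; simpl fst; simpl snd. replace (0 ^ 2 + r ^ 2) with (r * r) by ring. apply sqrt_square; lra. }
  assert (Hz : Cmod z = r) by (unfold z; rewrite Cmod_mult, Cmod_R, (Rabs_sign s Hs), Hz0; ring).
  exists z. split; [exact Hz|].
  assert (HsC : (RtoC s * RtoC s = 1)%C) by (rewrite <- RtoC_mult, Hs; reflexivity).
  assert (Hsz : (RtoC s * z)%C = (0, r)) by (unfold z; rewrite Cmult_assoc, HsC, Cmult_1_l; reflexivity).
  set (p := fun n => poly_p a b n z).
  destruct (HL r (fun n => RtoC (s ^ n) * p n)%C Hr) as [n Hn].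
  - unfold p, poly_p; simpl. rewrite Cmult_1_l, Cmod_1. reflexivity.
  - unfold p, poly_p; simpl. rewrite Rmult_1_r, RtoC_mult. rewrite <- Hsz. field. apply RtoC_neq0, Rgt_not_eq, hb.
  - rewrite <- Hsz. apply (flip_complex a b s hb Hs z p (p_solves z)).
  - assert (HS : partial_sum (fun k => Cmod (RtoC (s ^ k) * p k) ^ 2) n = partial_sum (fun k => Cmod (p k) ^ 2) n).
    { clear Hn. induction n as [|n IH]; [reflexivity|]. cbn [partial_sum]. rewrite IH.
      rewrite Cmod_mult, Cmod_R, (Rabs_sign_pow s Hs), Rmult_1_l. reflexivity. }
    rewrite HS in Hn.
    set (L := exp (c0 * Rpower r rho)) in *.
    assert (HXY : forall k, (n <= k)%nat -> L <= Cmod (coef_p a b z p k) * Cmod (coef_q a b z p k)).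
    { intros k Hk. pose proof (coef_wronskian a b hb z p (p_solves z) k) as W.
      replace (coef_q a b z p 0) with (RtoC 0) in W by (symmetry; apply coef_q_start_p).
      replace (Im (Cconj (coef_p a b z p 0) * 0)) with 0 in W by (rewrite Cmult_0_r; reflexivity).
      assert (HIm : Rabs (Im z) = r).
      { unfold z; simpl. replace (s * r + 0 * 0) with (s * r) by ring.
        rewrite Rabs_mult, (Rabs_sign s Hs), Rabs_right by lra. ring. }
      pose proof (partial_sum_mono (fun k => Cmod (p k) ^ 2) (fun k => pow2_ge_0 _) n k Hk) as Hm.
      pose proof (partial_sum_mono (fun k => Cmod (p k) ^ 2) (fun k => pow2_ge_0 _) 0 k ltac:(lia)) as Hm0. simpl partial_sum in Hm0 at 1.
      apply Rle_trans with (1 := Hn).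
      apply Rle_trans with (r * partial_sum (fun k => Cmod (p k) ^ 2) k); [apply Rmult_le_compat_l; lra|].
      apply Rle_trans with (Rabs (Im (Cconj (coef_p a b z p k) * coef_q a b z p k))).
      - rewrite W, Rminus_0_l, Rabs_Ropp, Rabs_mult, HIm. apply Rmult_le_compat_l; [lra|]. apply RRle_abs.
      - apply Rle_trans with (1 := Im_le_Cmod _). rewrite Cmod_mult, Cmod_conj. lra. }
    destruct (coef_converge z p (p_solves z)) as [LX LY].
    assert (HB : L <= Cmod (nev_B a b z) * Cmod (nev_D a b z)).
    { rewrite nev_B_coef, nev_D_coef.
      apply (is_lim_seq_le_loc (fun _ => L) (fun k => Cmod (coef_p a b z p k) * Cmod (coef_q a b z p k)) L
        (Cmod (coef_p_lim a b z p) * Cmod (coef_q_lim a b z p))).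
      - exists n. exact HXY.
      - apply is_lim_seq_const.
      - apply is_lim_seq_mult'; apply climit_Cmod; assumption. }
    rewrite mat_norm_nevanlinna.
    replace (exp (c0 / 2 * Rpower r rho)) with (sqrt L).
    + apply sqrt_le_1_alt. pose proof (pow2_ge_0 (Cmod (nev_A a b z))). pose proof (pow2_ge_0 (Cmod (nev_C a b z))).
      pose proof (pow2_ge_0 (Cmod (nev_B a b z) - Cmod (nev_D a b z))).
      pose proof (exp_pos (c0 * Rpower r rho)). fold L in H2. nra.
    + rewrite <- (sqrt_square (exp (c0 / 2 * Rpower r rho))) by (apply Rlt_le, exp_pos). f_equal.
      rewrite <- exp_plus. unfold L. f_equal. field.
Qed.
End Growth.

(** * From bounds on circles to growth and order *)

Lemma circle_max_between (f : C -> R) (r L U : R) :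
  (forall z, Cmod z = r -> f z <= U) -> (exists z, Cmod z = r /\ L <= f z) ->
  L <= circle_max f r <= U.
Proof.
  intros HU [z [Hz HL]]. unfold circle_max.
  set (E := fun t => exists z : C, Cmod z = r /\ t = f z).
  destruct (Lub_Rbar_correct E) as [H1 H2].
  assert (HE : E (f z)) by (exists z; auto).
  specialize (H1 _ HE). specialize (H2 (Finite U)).
  assert (HU' : is_ub_Rbar E U) by (intros t [w [Hw ->]]; apply HU, Hw).
  specialize (H2 HU'). destruct (Lub_Rbar E) as [l| |]; simpl in *; try contradiction; try lra.
Qed.

(** An upper bound on the whole circle and a lower bound at a single point of it
    determine the maximum up to the constants in the exponent, and these disappear
    after two logarithms and division by log r. *)
Lemma growth_order_of_bounds (W : C -> @matrix C 2 2) (rho c1 c2 R0 : R) :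
  0 < rho -> 0 < c1 -> 0 < c2 -> 0 < R0 ->
  (forall r, R0 <= r -> (forall z, Cmod z = r -> mat_norm (W z) <= exp (c2 * Rpower r rho)) /\
     exists z, Cmod z = r /\ exp (c1 * Rpower r rho) <= mat_norm (W z)) ->
  asymp_infty (fun r => circle_max (fun z => ln (mat_norm (W z))) r) (fun r => Rpower r rho)
  /\ has_order W rho.
Proof.
  intros Prho P1 P2 PR H. split.
  - exists c1, c2, R0. split; [exact P1|]. split; [exact P2|]. split; [exact PR|].
    intros r Hr. destruct (H r Hr) as [HU [z1 [Hz1 HL]]]. apply circle_max_between.
    + intros z Hz. specialize (HU z Hz).
      destruct (Rle_or_lt (mat_norm (W z)) 0) as [Hn|Hp].
      * unfold ln. destruct (Rlt_dec 0 (mat_norm (W z))) as [Hp|_]; [exfalso; lra|].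
        apply Rlt_le, Rmult_lt_0_compat; [exact P2|apply Rpower_pos].
      * rewrite <- (ln_exp (c2 * Rpower r rho)). apply ln_le; assumption.
    + exists z1. split; [exact Hz1|].
      rewrite <- (ln_exp (c1 * Rpower r rho)). apply ln_le; [apply exp_pos|exact HL].
  - unfold has_order. 
    set (g := fun r => ln (ln (circle_max (fun z => mat_norm (W z)) r)) / ln r).
    set (A := Rabs (ln c1) + Rabs (ln c2)).
    assert (HB : forall r, R0 <= r -> 1 < r -> rho - A / ln r <= g r <= rho + A / ln r).
    { intros r Hr Hr1. destruct (H r Hr) as [HU HL].
      pose proof (circle_max_between (fun z => mat_norm (W z)) r _ _ HU HL) as [M1 M2].
      set (M := circle_max (fun z => mat_norm (W z)) r) in *.
      assert (Pl : 0 < ln r) by (rewrite <- ln_1 at 1; apply ln_increasing; lra).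
      assert (PM : 0 < M) by (pose proof (exp_pos (c1 * Rpower r rho)); lra).
      apply ln_le in M1; [|apply exp_pos]. apply ln_le in M2; [|exact PM]. rewrite ln_exp in M1, M2.
      pose proof (Rpower_pos r rho) as Pr.
      assert (Q1 : 0 < c1 * Rpower r rho) by (apply Rmult_lt_0_compat; assumption).
      assert (Q2 : 0 < ln M) by lra.
      apply ln_le in M1; [|exact Q1]. apply ln_le in M2; [|exact Q2].
      rewrite ln_mult in M1, M2 by assumption. unfold Rpower in M1, M2. rewrite ln_exp in M1, M2.
      unfold g. fold M.
      pose proof (RRle_abs (ln c2)). pose proof (Rabs_maj2 (ln c1)). pose proof (Rabs_pos (ln c2)). pose proof (Rabs_pos (ln c1)).
      split; apply (Rmult_le_reg_r (ln r)); try exact Pl.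
      - replace ((rho - A / ln r) * ln r) with (rho * ln r - A) by (field; lra).
        replace (ln (ln M) / ln r * ln r) with (ln (ln M)) by (field; lra). unfold A. lra.
      - replace ((rho + A / ln r) * ln r) with (rho * ln r + A) by (field; lra).
        replace (ln (ln M) / ln r * ln r) with (ln (ln M)) by (field; lra). unfold A. lra. }
    assert (PA : 0 <= A) by (unfold A; pose proof (Rabs_pos (ln c2)); pose proof (Rabs_pos (ln c1)); lra).
    intros eps. pose proof (cond_pos eps) as Pe.
    set (R1 := Rmax R0 (exp ((A + 1) / eps))).
    assert (HR1 : forall r, R1 <= r -> rho - eps < g r < rho + eps).
    { intros r Hr. assert (Hr0 : R0 <= r) by (pose proof (Rmax_l R0 (exp ((A + 1) / eps))); unfold R1 in Hr; lra).
      assert (Hre : exp ((A + 1) / eps) <= r) by (pose proof (Rmax_r R0 (exp ((A + 1) / eps))); unfold R1 in Hr; lra).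
      assert (P0 : 0 < (A + 1) / eps) by (apply Rdiv_lt_0_compat; lra).
      assert (Hr1 : 1 < r) by (pose proof (exp_ineq1_le ((A + 1) / eps)); lra).
      pose proof (HB r Hr0 Hr1) as HBr.
      apply ln_le in Hre; [|apply exp_pos]. rewrite ln_exp in Hre.
      assert (HA : A / ln r < eps).
      { apply (Rmult_lt_reg_r (ln r)); [lra|]. replace (A / ln r * ln r) with A by (field; lra).
        assert ((A + 1) / eps * eps <= ln r * eps) by (apply Rmult_le_compat_r; lra).
        replace ((A + 1) / eps * eps) with (A + 1) in H0 by (field; lra). lra. }
      lra. }
    split.
    + intros r0. exists (Rmax r0 R1). split; [apply Rmax_l|]. apply HR1, Rmax_r.
    + exists R1. intros r Hr. apply HR1, Hr.
Qed.

Theorem theorem1p4 (a b : nat -> R) (beta1 beta2 x0 x1 y0 y1 : R)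
  (chi mu : nat -> R)
  (hb_pos : forall n : nat, 0 < b n)
  (hb : forall n : nat, (1 <= n)%nat ->
     b n = Rpower (INR n) beta1 * (x0 + x1 / INR n + chi n))
  (ha : forall n : nat, (1 <= n)%nat ->
     a n = Rpower (INR n) beta2 * (y0 + y1 / INR n + mu n))
  (hx0 : 0 < x0) (hy0 : y0 <> 0)
  (hsum : ex_series (fun n : nat =>
     sqrt (INR (S n)) * (Rabs (chi (S n)) + Rabs (mu (S n)))))
  (beta sigma : R)
  (hbeta1 : beta1 = beta) (hbeta2 : beta2 = beta)
  (hcrit : Rabs y0 = 2 * x0)
  (hsigma : sigma = 2 * x1 / x0 - 2 * y1 / y0)
  (hne : beta <> sigma)
  (hbeta_gt : 3 / 2 < beta) (hbeta_lt : beta < Rmin 2 sigma) :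
  limit_circle a b /\
  asymp_infty
    (fun r => circle_max (fun z => ln (mat_norm (nevanlinna a b z))) r)
    (fun r => Rpower r (1 / (2 * (beta - 1)))) /\
  has_order (nevanlinna a b) (Finite (1 / (2 * (beta - 1)))).
Proof.
  subst beta1 beta2.
  pose proof (Rmin_l 2 sigma) as Hm1. pose proof (Rmin_r 2 sigma) as Hm2.
  assert (Hs : exists s, s * s = 1 /\ y0 = - 2 * s * x0).
  { unfold Rabs in hcrit. destruct (Rcase_abs y0); [exists 1|exists (-1)]; split; lra. }
  destruct Hs as [s [Hs Hy]].
  destruct (critical_of_expansion a b beta x0 x1 y0 y1 s chi mu hb_pos hb ha hx0 Hs Hy hsum) as [h [e Hcr]];
    [lra|lra|].
  destruct (zero_solutions_square_summable _ _ _ _ _ _ _ _ Hs Hcr) as [Hp Hq].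
  split; [exact (limit_circle_of_square_summable a b hb_pos Hp Hq)|].
  destruct (nevanlinna_upper _ _ _ _ _ _ _ _ Hs Hcr) as [K [PK HK]].
  destruct (nevanlinna_lower _ _ _ _ _ _ _ _ Hs Hcr) as [c0 [R0 [Pc0 [PR0 HL]]]].
  apply growth_order_of_bounds with (c1 := c0) (c2 := K) (R0 := Rmax 1 R0); try assumption.
  - apply Rdiv_lt_0_compat; lra.
  - apply Rlt_le_trans with (2 := Rmax_l _ _). lra.
  - intros r Hr. pose proof (Rmax_l 1 R0). pose proof (Rmax_r 1 R0). split.
    + intros z Hz. rewrite <- Hz. apply HK. lra.
    + apply HL. lra.
Qed.
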